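(* (Smooth case.) Let $M=\mathbb{R}^2$ with canonical coordinates $(x,y)$, let $g:\mathbb{R}^2\to\mathbb{R}$ be a smooth function which does not vanish unless $x=0$ (i.e. $g(x,y)\neq 0$ whenever $x\neq 0$), and equip $M$ with the Poisson structure $\pi_M$ determined by $\{x,y\}_M=f(x,y)=x\,g(x,y)$. Then $(M,\pi_M)$ admits no proper symplectic resolution. (Real analytic and holomorphic cases.) Suppose either that $M=\mathbb{R}^2$ and that $f(x,y)=x\,g(x,y)$ is real analytic, or that $M\subset\mathbb{C}^2$ is an open subset containing $(0,0)$ and that $f(x,y)=x\,g(x,y)$ is holomorphic on $M$; in both cases suppose that $g(x,y)\neq 0$ whenever $x\neq 0$, and equip $M$ with the Poisson structure determined by $\{x,y\}_M=f(x,y)$. Then $(M,\pi_M)$ admits no connected real analytic (respectively, connected holomorphic) symplectic resolution.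
   Context: Manifolds are Hausdorff and paracompact (possibly with uncountably many connected components). A symplectic manifold is a Poisson manifold whose bivector field is invertible at every point. A Poisson morphism $\varphi:\Sigma\to M$ is a map (smooth, real analytic or holomorphic, according to the setting) with $\{\varphi^*F,\varphi^*G\}_\Sigma=\varphi^*\{F,G\}_M$ for all local functions $F,G$ on $M$. A symplectic resolution of a Poisson manifold $(M,\pi_M)$ of dimension $n$ is a triple $(\Sigma,\Pi_\Sigma,\varphi)$ where $(\Sigma,\Pi_\Sigma)$ is a symplectic manifold of the same dimension $n$ and $\varphi:\Sigma\to M$ is a surjective Poisson morphism (not necessarily a submersion). It is called proper if $\varphi$ is a proper map, i.e. the inverse image of every compact subset of $M$ is compact. It is called connected if $\Sigma$ is connected. It is called real analytic (resp. holomorphic) if $\Sigma$, $\Pi_\Sigma$ and $\varphi$ are real analytic (resp. holomorphic; dimensions are then complex dimensions). *)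

(* Defs.v *)
From HB Require Import structures.
From mathcomp Require Import all_boot all_order all_algebra.
From mathcomp Require Import complex.
From mathcomp Require Import all_classical all_reals all_analysis.

Set Implicit Arguments.
Unset Strict Implicit.
Unset Printing Implicit Defensive.

Import Order.TTheory GRing.Theory Num.Theory.
Import numFieldNormedType.Exports.

Local Open Scope classical_set_scope.
Local Open Scope ring_scope.

(* [C n U f] : the K-valued function f is of the given regularity on the open
   subset U of K^n.  The values of f outside U are irrelevant. *)
Definition regularity (K : numFieldType) : Type :=
  forall n : nat, set 'rV[K]_n -> ('rV[K]_n -> K) -> Prop.

Definition partial (K : numFieldType) (n : nat) (i : 'I_n)
    (f : 'rV[K]_n -> K) : 'rV[K]_n -> K :=
  fun u => 'D_(delta_mx 0 i) f u.

Fixpoint Ck_on (R : realType) (k : nat) (n : nat) (U : set 'rV[R]_n)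
    (f : 'rV[R]_n -> R) : Prop :=
  (forall u, U u -> {for u, continuous f}) /\
  if k is k'.+1 then
    forall i : 'I_n,
      (forall u, U u -> derivable f u (delta_mx 0 i)) /\
      Ck_on k' U (partial i f)
  else True.

Definition smooth_on (R : realType) : regularity R :=
  fun n U f => forall k, Ck_on k U f.

Definition monomial (R : realType) (n : nat) (v : 'rV[R]_n)
    (alpha : {ffun 'I_n -> nat}) : R := \prod_i v 0 i ^+ alpha i.

(* The family (a_alpha v^alpha)_alpha is absolutely summable, with sum s; by
   absolute summability s may be computed along the boxes [0, N-1]^n. *)
Definition power_series_sum (R : realType) (n : nat)
    (a : {ffun 'I_n -> nat} -> R) (v : 'rV[R]_n) (s : R) : Prop :=
  summable setT (fun alpha => (a alpha * monomial v alpha)%:E) /\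
  (fun N : nat => \sum_(beta : {ffun 'I_n -> 'I_N})
     let alpha := [ffun i => nat_of_ord (beta i)] in
     a alpha * monomial v alpha) @ \oo --> s.

Definition real_analytic_on (R : realType) : regularity R :=
  fun n U f => forall u0, U u0 ->
    exists a : {ffun 'I_n -> nat} -> R,
      \forall u \near u0, power_series_sum a (u - u0) (f u).

(* R[i] seen as a numFieldType, from which its topology is inferred. *)
Definition Cplx (R : realType) : numFieldType := R[i].

(* Differentiability is over [Cplx R], i.e. with C-linear differential. *)
Definition holomorphic_on (R : realType) : regularity (Cplx R) :=
  fun n U f => forall u, U u -> differentiable f u.

Definition paracompact_space (T : topologicalType) : Prop :=
  forall F : set (set T),
    (forall A, F A -> open A) -> \bigcup_(A in F) A = setT ->
  exists G : set (set T),
    [/\ forall B, G B -> open B,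
        \bigcup_(B in G) B = setT,
        forall B, G B -> exists2 A, F A & B `<=` A
      & forall p : T, exists2 W, nbhs p W &
          finite_set [set B | G B /\ B `&` W !=set0]].

Record chart (K : numFieldType) (n : nat) (T : Type) := Chart {
  chart_dom : set T ;
  chart_map : T -> 'rV[K]_n }.

Definition is_chart (K : numFieldType) (n : nat) (T : topologicalType)
    (c : chart K n T) : Prop :=
  [/\ open (chart_dom c),
      {in chart_dom c &, injective (chart_map c)},
      forall p, chart_dom c p -> {for p, continuous (chart_map c)}
    & forall W, open W -> W `<=` chart_dom c -> open (chart_map c @` W)].

(* F \o (chart_map c)^-1, extended by 0 outside of the image of the chart. *)
Definition local_expr (K : numFieldType) (n : nat) (T : Type)
    (c : chart K n T) (F : T -> K) (u : 'rV[K]_n) : K :=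
  match pselect (exists p, chart_dom c p /\ chart_map c p = u) with
  | left ex => F (projT1 (cid ex))
  | right _ => 0
  end.

(* Raw data of a manifold of dimension n over K with a bivector field:
   [biv c p] is the matrix, in the coordinates c, of the bivector at p,
   so that pi = (1/2) \sum_(i, j) biv c p i j d_i /\ d_j. *)
Record bivector_manifold (K : numFieldType) (n : nat) := BivectorManifold {
  space :> topologicalType ;
  atlas : set (chart K n space) ;
  biv : chart K n space -> space -> 'M[K]_n }.

Section PoissonManifolds.
Variables (K : numFieldType) (C : regularity K) (n : nat).
Implicit Types (S M : bivector_manifold K n).

Definition regular_fun S (W : set S) (F : S -> K) : Prop :=
  forall c, atlas c -> C (chart_map c @` (chart_dom c `&` W)) (local_expr c F).

Definition is_manifold S : Prop :=
  [/\ hausdorff_space S,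
      paracompact_space S,
      forall c : chart K n S, atlas c -> is_chart c,
      forall p : S, exists2 c, atlas c & chart_dom c p
    & forall (c : chart K n S) (i : 'I_n), atlas c ->
        regular_fun (chart_dom c) (fun p => chart_map c p 0 i)].

Definition bracket S (c : chart K n S) (F G : S -> K) (p : S) : K :=
  \sum_i \sum_j biv c p i j * partial i (local_expr c F) (chart_map c p)
                            * partial j (local_expr c G) (chart_map c p).

(* The clauses: skew-symmetry, regularity, tensoriality under change of
   coordinates, and [pi, pi] = 0 written as the Jacobi identity
   {x_i, {x_j, x_k}} + {x_j, {x_k, x_i}} + {x_k, {x_i, x_j}} = 0
   (recall that {x_i, x_j} = biv c _ i j). *)
Definition is_poisson_manifold S : Prop :=
  let x (c : chart K n S) i := fun p : S => chart_map c p 0 i in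
  let br (c : chart K n S) i j := fun p : S => biv c p i j in
  [/\ is_manifold S,
      forall (c : chart K n S) p, atlas c -> chart_dom c p ->
        (biv c p)^T = - biv c p,
      forall (c : chart K n S) i j, atlas c ->
        regular_fun (chart_dom c) (br c i j),
      forall (c d : chart K n S) p i j,
        atlas c -> atlas d -> chart_dom c p -> chart_dom d p ->
        biv d p i j = bracket c (x d i) (x d j) p
    & forall (c : chart K n S) p i j k, atlas c -> chart_dom c p ->
        bracket c (x c i) (br c j k) p + bracket c (x c j) (br c k i) p
        + bracket c (x c k) (br c i j) p = 0].

Definition is_symplectic_manifold S : Prop :=
  is_poisson_manifold S /\
  forall (c : chart K n S) p, atlas c -> chart_dom c p ->
    biv c p \in @unitmx K n.

Definition regular_map S M (phi : S -> M) : Prop :=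
  continuous phi /\
  forall (d : chart K n M) (i : 'I_n), atlas d ->
    regular_fun (phi @^-1` chart_dom d) (fun p => chart_map d (phi p) 0 i).

Definition poisson_morphism S M (phi : S -> M) : Prop :=
  regular_map phi /\
  forall (V : set M) (F G : M -> K), open V ->
    regular_fun V F -> regular_fun V G ->
  forall (c : chart K n S) (d : chart K n M) p,
    atlas c -> atlas d -> chart_dom c p -> chart_dom d (phi p) -> V (phi p) ->
    bracket c (F \o phi) (G \o phi) p = bracket d F G (phi p).

Definition symplectic_resolution M S (phi : S -> M) : Prop :=
  [/\ is_symplectic_manifold S,
      poisson_morphism phi
    & forall q : M, exists p : S, phi p = q].

End PoissonManifolds.

Definition proper_map (S M : topologicalType) (phi : S -> M) : Prop :=
  forall A : set M, compact A -> compact (phi @^-1` A).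

Definition xcoord (K : numFieldType) (u : 'rV[K]_2) : K := u ord0 ord0.

(* The surface T with a single global chart z and bracket {x, y} = f(x, y). *)
Definition planar_poisson (K : numFieldType) (T : topologicalType)
    (z : T -> 'rV[K]_2) (f : 'rV[K]_2 -> K) : bivector_manifold K 2 :=
  {| space := T ;
     atlas := [set Chart setT z] ;
     biv := fun _ p =>
       f (z p) *: (delta_mx ord0 ord_max - delta_mx ord_max ord0) |}.

Definition poisson_plane (R : realType) (f : 'rV[R]_2 -> R) :
    bivector_manifold R 2 := @planar_poisson R 'rV[R]_2 id f.

Definition poisson_open (R : realType) (M : set 'rV[Cplx R]_2)
    (f : 'rV[Cplx R]_2 -> Cplx R) : bivector_manifold (Cplx R) 2 :=
  @planar_poisson (Cplx R) (set_type M) set_val f.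

(* Main.v *)
Require Import Defs.
From HB Require Import structures.
From mathcomp Require Import all_boot all_order all_algebra.
From mathcomp Require Import complex ring lra.
From mathcomp Require Import all_classical all_reals all_analysis.
Import Order.TTheory GRing.Theory Num.Theory.
Import numFieldNormedType.Exports.
Local Open Scope classical_set_scope.
Local Open Scope ring_scope.
Set Implicit Arguments.
Unset Strict Implicit.
Unset Printing Implicit Defensive.

(** Let [phi] be a symplectic resolution of the plane with bracket [{x, y} = f = x g],
    and let [X], [Y] be the pull-backs by [phi] of the two coordinates. In a chart of the
    resolution, compatibility with the brackets reads [b det(dX, dY) = f(X, Y)], where the
    coefficient [b] of the bivector does not vanish ([resolution_bracket]). As [f] is
    divisible by [x], the Jacobian [det(dX, dY)] is [O(|X|)] near every point of the set
    [Z] of zeros of [X] ([jacobian_small]). This is a linear differential inequality for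
    [X] along the levels of [Y], that is, along the orbits of the Hamiltonian field of [Y]:
    near a point where [dY] is nonzero, a level of [Y] that meets [Z] is contained in [Z]
    ([regular_level], proved with Euler polygons).

    Smooth proper case ([no_proper_resolution]). Fix [y] in [0, 1] and let [p_n] be mapped
    to [(1/n, y)]. By properness the [p_n] accumulate at some point [p] of [Z] with
    [Y p = y]. If [dY] were nonzero at [p], then [p_n], being on the level of [Y] through
    [p], would lie in [Z] for some [n], which it does not. So every [y] in [0, 1] is a
    critical value of [Y] on a compact set, against Sard's theorem ([sard]).

    Analytic and holomorphic connected cases ([no_connected_resolution]). The interior of
    [Z] is closed, by the identity principle, hence empty, because [X] is not identically
    zero. At a point [p] of [Z] where [dY] is nonzero, [X] has isolated zeros on a line
    transverse to the levels of [Y]: were it zero on that line, it would vanish near [p],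
    since the levels crossing the line would be in [Z]. So near [p] the set [Z] is
    contained in one level of [Y]. Hence [Y] maps [Z] locally, and by second countability
    globally, onto a null set ([zero_set_null], [countable_charts]). But [phi] is onto, so
    [Y] maps [Z] onto a neighbourhood of 0, which is absurd.

    The proof runs simultaneously over the fields R and C, of which it only uses an
    absolute value with a mean value inequality ([abs_field]) and the ideal of Lebesgue
    null sets ([null_ideal]). The analytic classes enter through two facts: their members
    are of class [C^3], and near each point of a line they vanish identically or at that
    point at most ([isolated_zeros]). For real analytic functions this comes from termwise
    differentiation of power series ([power_series_Ck], [power_series_isolated]); for
    holomorphic functions, from Goursat's theorem and the expansion of Cauchy's formula on
    a square ([goursat], [cauchy_expansion]). *)

(** * Fields with an absolute value *)

(** A derivative as a first-order expansion: there is no division by the increment, so the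
    estimate can be used as it stands. *)
Definition has_diff (R : realType) (K : numFieldType) (N : K -> R)
    (h : K -> K) (z d : K) : Prop :=
  forall e : R, 0 < e -> exists2 r : R, 0 < r &
    forall t, N t < r -> N (h (z + t) - h z - t * d) <= e * N t.

Section DirectionalDerivative.
Context {R : realType} {K : numFieldType} (N : K -> R).
Hypotheses (N_ge0 : forall x, 0 <= N x) (N_eq0 : forall x, N x = 0 -> x = 0).
Hypotheses (N0 : N 0 = 0) (NM : forall x y, N (x * y) = N x * N y).
Hypothesis N_nbhs : forall (x : K) (A : set K), nbhs x A <->
  exists2 r : R, 0 < r & forall y, N (y - x) < r -> A y.

(** Multiplying by the increment turns the limit of difference quotients into an estimate
    that also holds for the increment 0. *)
Lemma first_order_derive (V : normedModType K) (F : V -> K) (u v : V) (d : K) :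
  (forall e : R, 0 < e -> exists2 r : R, 0 < r & forall t : K, N t < r ->
     N (F (u + t *: v) - F u - t * d) <= e * N t) <-> is_derive u v F d.
Proof.
have N_gt0 x : x != 0 -> 0 < N x.
  by move=> x0; rewrite lt_neqAle N_ge0 andbT eq_sym; apply: contra x0 => /eqP/N_eq0 ->.
split=> [h|h e e0].
  have H : (fun t => t^-1 *: ((F \o shift u) (t *: v) - F u)) @ 0^' --> d.
    move=> A /N_nbhs[e e0 eA].
    have [|r r0 rP] := h (e / 2); first by rewrite divr_gt0.
    apply/N_nbhs; exists r => // t; rewrite subr0 => tr /= t0.
    apply: eA; rewrite /shift /= [t *: _ + u]addrC /GRing.scale /=.
    have Nt := N_gt0 _ t0.
    have := rP t tr.
    have -> : F (u + t *: v) - F u - t * d = t * (t^-1 * (F (u + t *: v) - F u) - d).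
      by rewrite mulrBr mulrA mulfV// mul1r.
    rewrite NM mulrC ler_pM2r// => /le_lt_trans; apply.
    by lra.
  apply: DeriveDef; last exact: (cvg_lim _ H).
  by apply/cvg_ex; exists d.
have [/(@cvg_ex _) [l Hl] dE] := h.
have el : l = d by rewrite -dE; symmetry; exact: (cvg_lim _ Hl).
rewrite el in Hl.
have /Hl/N_nbhs[r r0 rP] : nbhs d [set y | N (y - d) < e].
  by apply/N_nbhs; exists e.
exists r => // t tr.
have [->|t0] := eqVneq t 0.
  by rewrite scale0r addr0 subrr mul0r subr0 N0 mulr0.
have := rP t; rewrite subr0 => /(_ tr t0) /=.
rewrite /shift /= [t *: _ + u]addrC /GRing.scale /= => /ltW.
rewrite -(@ler_pM2r _ (N t)) ?N_gt0// -NM.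
by rewrite mulrBl [_^-1 * _]mulrC -mulrA mulVf// mulr1 [d * t]mulrC.
Qed.

Lemma has_diff_derive (h : K -> K) (z d : K) : has_diff N h z d <-> is_derive z (1 : K) h d.
Proof.
have e t : t *: (1 : K) = t :> K by exact: mulr1.
by split=> [hd|/first_order_derive hd];
  [apply/first_order_derive|] => f /hd[r r0 rP]; exists r => // t /rP; rewrite e.
Qed.

End DirectionalDerivative.

(** What the proof uses of R and C. The factor 2 in [absf_mvi] leaves room for treating
    the real and the imaginary part of a complex function separately; [absf_real] provides
    the segments along which zeros are propagated. *)
Record abs_field (R : realType) (K : numFieldType) := AbsField {
  absf :> K -> R ;
  absf_ge0 : forall x, 0 <= absf x ;
  absf_eq0 : forall x, absf x = 0 -> x = 0 ;
  absfM : forall x y, absf (x * y) = absf x * absf y ;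
  absfD : forall x y, absf (x + y) <= absf x + absf y ;
  absf_nat : forall n : nat, absf n%:R = n%:R ;
  absf_nbhs : forall (x : K) (A : set K), nbhs x A <->
    exists2 r : R, 0 < r & forall y, absf (y - x) < r -> A y ;
  absf_complete : forall u : nat -> K,
    (forall e : R, 0 < e -> exists n0, forall m n, (n0 <= m)%N -> (n0 <= n)%N ->
       absf (u m - u n) < e) ->
    exists l, forall e : R, 0 < e -> exists n0, forall n, (n0 <= n)%N ->
       absf (u n - l) < e ;
  absf_real : exists iota : R -> K, [/\ iota 0 = 0, iota 1 = 1 &
    forall s t, absf (iota s - iota t) = `|s - t|] ;
  absf_mvi : forall (h h' : K -> K) (a b : K) (B : R),
    (forall z, absf (z - a) <= absf (b - a) ->
       has_diff absf h z (h' z) /\ absf (h' z) <= B) ->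
    absf (h b - h a) <= 2 * B * absf (b - a) }.

Section AbsField.
Context {R : realType} {K : numFieldType} (N : abs_field R K).
Implicit Types (x y z t : K).

Lemma absf0 : N 0 = 0. Proof. by rewrite -[0]/(0%:R) absf_nat. Qed.

Lemma absf1 : N 1 = 1. Proof. by rewrite -[1]/(1%:R) absf_nat. Qed.

Lemma absfN x : N (- x) = N x.
Proof.
suff h : N (-1) = 1 by rewrite -mulN1r absfM h mul1r.
apply/eqP; rewrite -(@eqrXn2 _ 2%N) ?absf_ge0 ?ler01//.
by rewrite expr1n expr2 -absfM mulrNN mulr1 absf1.
Qed.

Lemma absfBC x y : N (x - y) = N (y - x).
Proof. by rewrite -absfN opprB. Qed.

Lemma absfB x y : N (x - y) <= N x + N y.
Proof. by rewrite (le_trans (absfD _ _ _))// absfN. Qed.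

Lemma absf_split x y z : N (x - z) <= N (x - y) + N (y - z).
Proof. by have := absfD N (x - y) (y - z); rewrite addrA subrK. Qed.

Lemma absf_dist x y : N x - N y <= N (x - y).
Proof. by rewrite lerBlDr (le_trans _ (absfD _ _ _))// subrK. Qed.

Lemma absf_gt0 x : x != 0 -> 0 < N x.
Proof.
move=> x0; rewrite lt_neqAle absf_ge0 andbT eq_sym.
by apply: contra x0 => /eqP /absf_eq0 ->.
Qed.

Lemma absfV x : N x^-1 = (N x)^-1.
Proof.
have [->|x0] := eqVneq x 0; first by rewrite invr0 absf0 invr0.
have Nx := absf_gt0 x0.
by apply: (mulfI (lt0r_neq0 Nx)); rewrite -absfM !mulfV ?absf1// lt0r_neq0.
Qed.

Lemma absf_le0 x : (forall e : R, 0 < e -> N x <= e) -> x = 0.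
Proof.
move=> h; apply: (absf_eq0 (a0 := N)).
apply/eqP; rewrite eq_le absf_ge0 andbT leNgt; apply/negP => Nx.
have := h (N x / 2); rewrite divr_gt0// => /(_ erefl).
by have := Nx; lra.
Qed.

Lemma absf_small (e : R) : 0 < e -> exists2 t, t != 0 & N t < e.
Proof.
move=> e0; exists ((Num.truncn e^-1).+1%:R^-1).
  by rewrite invr_eq0 pnatr_eq0.
rewrite absfV absf_nat invf_plt ?posrE ?ltr0n//.
by rewrite truncnS_gt// ltW// invr_gt0.
Qed.

Lemma absf_arch (B e : R) : 0 < e -> exists2 n, (0 < n)%N & B / n%:R < e.
Proof.
move=> e0; exists (Num.truncn (`|B| / e)).+1 => //.
rewrite ltr_pdivrMr ?ltr0n// mulrC -ltr_pdivrMr//.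
have h : B / e <= `|B| / e by rewrite ler_pM2r ?invr_gt0// ler_norm.
by rewrite (le_lt_trans h)// truncnS_gt// divr_ge0// ltW.
Qed.

(** ** Neighbourhoods and continuity on the plane *)

Lemma nbhs_row n (u : 'rV[K]_n) (A : set 'rV[K]_n) : nbhs u A <->
  exists2 r : R, 0 < r & forall v : 'rV[K]_n,
    (forall k, N (v 0 k - u 0 k) < r) -> A v.
Proof.
split=> [[P P_nbhs PA]|[r r0 rA]].
  have /choice [f f_gt0P] : forall k : 'I_n, exists r, 0 < r /\
      forall y : K, N (y - u 0 k) < r -> P 0 k y.
    by move=> k; have /(absf_nbhs N) [r r0 h] := P_nbhs 0 k; exists r.
  exists (\big[Num.min/1]_k f k).
    by apply/lt_bigmin; [exact: ltr01 | move=> k _; have [] := f_gt0P k].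
  move=> v hv; apply: PA => i j; rewrite ord1; have [_] := f_gt0P j; apply.
  by apply: lt_le_trans (hv j) _; exact: bigmin_le.
exists (fun _ k => [set y | N (y - u 0 k) < r]) => [i j|v hv].
  by rewrite ord1; apply/(absf_nbhs N); exists r.
by apply: rA => k; apply: hv.
Qed.

Lemma continuous_row n (f : 'rV[K]_n -> K) (u : 'rV[K]_n) :
  {for u, continuous f} <-> forall e : R, 0 < e -> exists2 r : R, 0 < r &
    forall v : 'rV[K]_n, (forall k, N (v 0 k - u 0 k) < r) -> N (f v - f u) < e.
Proof.
split=> [fu e e0|h A].
  have /fu/nbhs_row[r r0 rP] : nbhs (f u) [set y | N (y - f u) < e].
    by apply/(absf_nbhs N); exists e.
  by exists r.
move=> /(absf_nbhs N)[e /h[r r0 rP] eA].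
apply/nbhs_row; exists r => // v /rP; exact: eA.
Qed.

(** ** Partial derivatives *)

Definition has_partial n (F : 'rV[K]_n -> K) (i : 'I_n) (u : 'rV[K]_n) (d : K) :=
  forall e : R, 0 < e -> exists2 r : R, 0 < r &
    forall t, N t < r ->
      N (F (u + t *: delta_mx 0 i) - F u - t * d) <= e * N t.

Lemma has_partialP n (F : 'rV[K]_n -> K) (i : 'I_n) (u : 'rV[K]_n) (d : K) :
  has_partial F i u d <-> is_derive u (delta_mx 0 i) F d.
Proof.
exact: (first_order_derive (absf_ge0 N) (@absf_eq0 _ _ N) absf0 (absfM N) (absf_nbhs N)).
Qed.

Lemma has_diffP (h : K -> K) (z d : K) : has_diff N h z d <-> is_derive z (1 : K) h d.
Proof.
exact: (has_diff_derive (absf_ge0 N) (@absf_eq0 _ _ N) absf0 (absfM N) (absf_nbhs N)).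
Qed.

Lemma derivable_partial n (F : 'rV[K]_n -> K) (i : 'I_n) (u : 'rV[K]_n) :
  derivable F u (delta_mx 0 i) -> has_partial F i u (partial i F u).
Proof. by move=> h; apply/has_partialP/derivableP. Qed.

Lemma has_partial_eq n (F : 'rV[K]_n -> K) (i : 'I_n) (u : 'rV[K]_n) (d : K) :
  has_partial F i u d -> partial i F u = d.
Proof. by move=> /has_partialP/(@derive_val _ _ _ _ _ _ _). Qed.

Lemma has_partial_derivable n (F : 'rV[K]_n -> K) (i : 'I_n) (u : 'rV[K]_n) (d : K) :
  has_partial F i u d -> derivable F u (delta_mx 0 i).
Proof. by move=> /has_partialP []. Qed.

End AbsField.
(* Partial derivatives are handled through [has_partial] from here on. *)
Opaque partial.

(** * Differential calculus on the plane *)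

(** Over C the directional derivatives are C-linear ones, so this is already a strong
    condition for [k = 1]. *)
Fixpoint Ck (K : numFieldType) (k n : nat) (U : set 'rV[K]_n)
    (f : 'rV[K]_n -> K) : Prop :=
  (forall u, U u -> {for u, continuous f}) /\
  if k is k'.+1 then
    forall i : 'I_n,
      (forall u, U u -> derivable f u (delta_mx 0 i)) /\ Ck k' U (partial i f)
  else True.

Lemma nbhsI (T : topologicalType) (p : T) (A B : set T) :
  nbhs p A -> nbhs p B -> nbhs p (A `&` B).
Proof. exact: filterI. Qed.

Definition swap2 (i : 'I_2) : 'I_2 := if i == 0 then 1 else 0.

Lemma ord2P (i : 'I_2) : i = 0 \/ i = 1.
Proof. by case: i => [[|[|//]] h]; [left|right]; apply/val_inj. Qed.

Lemma swap2_neq (i : 'I_2) : (swap2 i == i) = false.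
Proof. by case: (ord2P i) => ->. Qed.

Lemma eq_swap2 (i k : 'I_2) : k != i -> k = swap2 i.
Proof. by case: (ord2P i) => ->; case: (ord2P k) => ->. Qed.

Lemma sum2 (V : nmodType) (i : 'I_2) (a : 'I_2 -> V) :
  \sum_k a k = a i + a (swap2 i).
Proof.
have e : \sum_k a k = a 0 + a 1.
  rewrite big_ord_recl big_ord1; congr (_ + _).
  by congr (a _); apply/val_inj.
by case: (ord2P i) => ->; rewrite e// addrC.
Qed.

Section Plane.
Context {R : realType} {K : numFieldType} (N : abs_field R K).
Implicit Types (x y z t : K) (u v w p : 'rV[K]_2) (i j k : 'I_2)
  (F : 'rV[K]_2 -> K).

Local Notation E i := (delta_mx (0 : 'I_1) (i : 'I_2) : 'rV[K]_2).

Lemma moveE u t i k : (u + t *: E i) 0 k = u 0 k + t *+ (k == i).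
Proof. by rewrite !mxE eqxx /= mulr_natr. Qed.

Lemma move_eq u t i : (u + t *: E i) 0 i = u 0 i + t.
Proof. by rewrite moveE eqxx. Qed.

Lemma move_swap u t i : (u + t *: E i) 0 (swap2 i) = u 0 (swap2 i).
Proof. by rewrite moveE swap2_neq addr0. Qed.

Lemma row2P i u v : u 0 i = v 0 i -> u 0 (swap2 i) = v 0 (swap2 i) -> u = v.
Proof.
move=> e1 e2; apply/rowP => k.
by have [->//|/eq_swap2 ->] := eqVneq k i.
Qed.

Definition box p (r : R) : set 'rV[K]_2 := [set v | forall k, N (v 0 k - p 0 k) < r].

Lemma nbhs_box p r : 0 < r -> nbhs p (box p r).
Proof. by move=> r0; apply/(nbhs_row N); exists r. Qed.

Lemma box_center p r : 0 < r -> box p r p.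
Proof. by move=> r0 k; rewrite subrr absf0. Qed.

Lemma box_le p r r' : r <= r' -> box p r `<=` box p r'.
Proof. by move=> rr v h k; apply: lt_le_trans (h k) rr. Qed.

Definition dist2 u v : R := \sum_k N (v 0 k - u 0 k).

Lemma dist2_ge0 u v : 0 <= dist2 u v.
Proof. by apply: sumr_ge0 => k _; exact: absf_ge0. Qed.

Definition polydisc u v : set 'rV[K]_2 :=
  [set w | forall k, N (w 0 k - u 0 k) <= N (v 0 k - u 0 k)].

Lemma polydisc_dist u v w : polydisc u v w -> dist2 u w <= dist2 u v.
Proof. by move=> h; apply: ler_sum => k _; exact: h. Qed.

Lemma polydisc_trans u v w w' :
  polydisc u v w -> polydisc u w w' -> polydisc u v w'.
Proof. by move=> h h' k; apply: le_trans (h' k) (h k). Qed.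

Lemma polydisc_box p r u v : box p (r / 3) u -> box p (r / 3) v ->
  polydisc u v `<=` box p r.
Proof.
move=> hu hv w hw k.
have h1 := absf_split N (w 0 k) (u 0 k) (p 0 k).
have h2 := absf_split N (v 0 k) (p 0 k) (u 0 k).
have := hu k; have := hv k; have := hw k.
rewrite (absfBC N (p 0 k)) in h2.
by lra.
Qed.

Lemma mvi_coord F (D : 'rV[K]_2 -> K) i u t (B : R) :
  (forall s, N s <= N t -> has_partial N F i (u + s *: E i) (D (u + s *: E i))
     /\ N (D (u + s *: E i)) <= B) ->
  N (F (u + t *: E i) - F u) <= 2 * B * N t.
Proof.
move=> h; have := @absf_mvi _ _ N (fun s => F (u + s *: E i))
  (fun s => D (u + s *: E i)) 0 t B.
rewrite subr0 scale0r addr0; apply => z; rewrite subr0 => zt.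
have [h1 h2] := h z zt; split => // e e0.
have [r r0 rP] := h1 e e0; exists r => // s /rP.
by rewrite scalerDl addrA.
Qed.

(** Going from [u] to [v] one coordinate after the other, one stays in [polydisc u v] and
    meets partial derivatives only. *)
Lemma mvi2 F (D : 'I_2 -> 'rV[K]_2 -> K) (B : 'I_2 -> R) u v :
  (forall w, polydisc u v w -> forall k,
     has_partial N F k w (D k w) /\ N (D k w) <= B k) ->
  N (F v - F u) <= 2 * \sum_k B k * N (v 0 k - u 0 k).
Proof.
move=> h; rewrite (sum2 0) /=.
set v' := u + (v 0 0 - u 0 0) *: E 0.
have ev : v = v' + (v 0 1 - u 0 1) *: E 1.
  apply: (@row2P 0); rewrite /swap2 /= !moveE /= ?eqxx ?addr0 ?mulr1n.
    by rewrite addrC subrK.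
  by rewrite addrC subrK.
have h1 : N (F v' - F u) <= 2 * B 0 * N (v 0 0 - u 0 0).
  apply: (@mvi_coord F (D 0)) => s hs; apply: h => k.
  rewrite moveE [_ + _ *+ _]addrC addrK.
  by case: (ord2P k) => -> //=; rewrite absf0 absf_ge0.
have h2 : N (F v - F v') <= 2 * B 1 * N (v 0 1 - u 0 1).
  rewrite [in F v]ev; apply: (@mvi_coord F (D 1)) => s hs; apply: h => k.
  rewrite !moveE.
  by case: (ord2P k) => -> /=; rewrite ?mulr1n ?addr0 addrC ?addKr// addrK.
have := absf_split N (F v) (F v') (F u).
by lra.
Qed.

Lemma has_partial_sublin F i u d (a : 'I_2 -> K) : has_partial N F i u d ->
  has_partial N (fun w => F w - \sum_k a k * w 0 k) i u (d - a i).
Proof.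
move=> h e e0; have [r r0 rP] := h e e0; exists r => // t /rP.
rewrite !(sum2 i) move_eq move_swap.
rewrite (_ : F _ - _ - _ - _ = F (u + t *: E i) - F u - t * d)//.
by ring.
Qed.

(** Apply [mvi2] to [F] minus its linear approximation at [u]. *)
Lemma taylor1 F (D : 'I_2 -> 'rV[K]_2 -> K) (A : R) u v :
  (forall w, polydisc u v w -> forall k,
     has_partial N F k w (D k w) /\ N (D k w - D k u) <= A) ->
  N (F v - F u - \sum_k D k u * (v 0 k - u 0 k)) <= 2 * A * dist2 u v.
Proof.
move=> h.
have := @mvi2 (fun w => F w - \sum_k D k u * w 0 k)
  (fun k w => D k w - D k u) (fun=> A) u v.
rewrite -mulr_sumr -/(dist2 u v) mulrA.
rewrite (_ : F v - _ - _ = F v - F u - \sum_k D k u * (v 0 k - u 0 k)); last first.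
  by rewrite !(sum2 0); ring.
apply => w hw k; have [h1 h2] := h w hw k; split=> //.
exact: has_partial_sublin.
Qed.

(** Second derivatives bound the variation of the first ones, which is the constant of
    [taylor1]. *)
Lemma taylor2 F (D : 'I_2 -> 'rV[K]_2 -> K) (D2 : 'I_2 -> 'I_2 -> 'rV[K]_2 -> K)
    (B : R) u v : 0 <= B ->
  (forall w, polydisc u v w -> forall k, has_partial N F k w (D k w)) ->
  (forall w, polydisc u v w -> forall k l,
     has_partial N (D k) l w (D2 k l w) /\ N (D2 k l w) <= B) ->
  N (F v - F u - \sum_k D k u * (v 0 k - u 0 k)) <= 4 * B * dist2 u v ^+ 2.
Proof.
move=> B0 h1 h2.
have h3 w : polydisc u v w -> forall k, N (D k w - D k u) <= 2 * B * dist2 u v.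
  move=> hw k; apply: (@le_trans _ _ (2 * B * dist2 u w)).
    have := @mvi2 (D k) (D2 k) (fun=> B) u w.
    rewrite -mulr_sumr -/(dist2 u w) mulrA; apply => w' hw' l.
    by apply: h2; apply: polydisc_trans hw hw'.
  by rewrite ler_wpM2l ?mulr_ge0// polydisc_dist.
have := @taylor1 F D (2 * B * dist2 u v) u v.
have -> : 2 * (2 * B * dist2 u v) * dist2 u v = 4 * B * dist2 u v ^+ 2 by ring.
by apply => w hw k; split; [exact: h1|exact: h3].
Qed.

(** ** Functions of class [Ck] near a point *)

Lemma nbhs_forall2 (T : Type) (A : set_system T) (P : 'I_2 -> set T) :
  Filter A -> (forall k, A (P k)) -> A [set v | forall k, P k v].
Proof.
move=> FA h; apply: filterS2 (h 0) (h 1) => v h0 h1 k.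
by case: (ord2P k) => ->.
Qed.

Lemma Ck_continuous m (U : set 'rV[K]_2) F u :
  Ck m U F -> U u -> {for u, continuous F}.
Proof. by case: m => [|m] [h _] Uu; exact: h. Qed.

Lemma Ck_has_partial m (U : set 'rV[K]_2) F i u :
  Ck m.+1 U F -> U u -> has_partial N F i u (partial i F u).
Proof. by move=> [_ /(_ i)[h _]] Uu; apply/derivable_partial/h. Qed.

Lemma Ck_partial m (U : set 'rV[K]_2) F i :
  Ck m.+1 U F -> Ck m U (partial i F).
Proof. by move=> [_ /(_ i)[]]. Qed.

Lemma CkW m (U : set 'rV[K]_2) F : Ck m.+1 U F -> Ck m U F.
Proof.
elim: m F => [|m IH] F [h1 h2]; split => // i; have [h3 h4] := h2 i.
by split => //; exact: IH.
Qed.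

Lemma nbhs_bounded F p : {for p, continuous F} ->
  exists B : R, nbhs p [set v | N (F v) <= B].
Proof.
move=> /(continuous_row N)/(_ 1 ltr01)[r r0 rP].
exists (N (F p) + 1); apply/(nbhs_row N); exists r => // v /rP.
have := absf_dist N (F v) (F p); rewrite /=; lra.
Qed.

Lemma nbhs_bounded2 (F : 'I_2 -> 'rV[K]_2 -> K) p :
  (forall k, exists B : R, nbhs p [set v | N (F k v) <= B]) ->
  exists B : R, nbhs p [set v | forall k, N (F k v) <= B].
Proof.
move=> /choice[B hB]; exists (Num.max (B 0) (B 1)).
apply: nbhs_forall2 => k; apply: filterS (hB k) => v /= /le_trans; apply.
by rewrite le_max; case: (ord2P k) => ->; rewrite lexx ?orbT.
Qed.

Lemma Ck2_bounded (U : set 'rV[K]_2) F p : open U -> U p -> Ck 2 U F ->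
  exists2 B : R, 0 < B & exists2 r : R, 0 < r & forall v, box p r v ->
    [/\ U v, forall k, N (partial k F v) <= B
      & forall k l, N (partial l (partial k F) v) <= B].
Proof.
move=> oU Up F2.
have [B1 h1] : exists B : R, nbhs p [set v | forall k, N (partial k F v) <= B].
  apply: (@nbhs_bounded2 (fun k => partial k F)) => k; apply: nbhs_bounded.
  by apply: (@Ck_continuous 1 U) => //; exact: Ck_partial.
have [B2 h2] : exists B : R,
    nbhs p [set v | forall k, N (partial k (partial 0 F) v) <= B].
  apply: (@nbhs_bounded2 (fun k => partial k (partial 0 F))) => k.
  apply: nbhs_bounded; apply: (@Ck_continuous 0 U) => //.
  by do 2 apply: Ck_partial.
have [B3 h3] : exists B : R,
    nbhs p [set v | forall k, N (partial k (partial 1 F) v) <= B].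
  apply: (@nbhs_bounded2 (fun k => partial k (partial 1 F))) => k.
  apply: nbhs_bounded; apply: (@Ck_continuous 0 U) => //.
  by do 2 apply: Ck_partial.
exists (`|B1| + `|B2| + `|B3| + 1); first by rewrite ltr_wpDl// !addr_ge0.
have hU : nbhs p U by exact: open_nbhs_nbhs.
have /(nbhs_row N)[r r0 rP] := nbhsI (nbhsI hU h1) (nbhsI h2 h3).
exists r => // v /rP [[Uv b1] [b2 b3]].
have l1 := ler_norm B1; have l2 := ler_norm B2; have l3 := ler_norm B3.
have n1 := normr_ge0 B1; have n2 := normr_ge0 B2; have n3 := normr_ge0 B3.
split => // k; first by have := b1 k; rewrite /=; lra.
by move=> l; case: (ord2P k) => ->; [have := b2 l|have := b3 l]; rewrite /=; lra.
Qed.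

End Plane.

(** * Levels near a regular point *)

Definition jacobian (K : numFieldType) (X Y : 'rV[K]_2 -> K) (u : 'rV[K]_2) : K :=
  partial 0 X u * partial 1 Y u - partial 1 X u * partial 0 Y u.

Section Levels.
Context {R : realType} {K : numFieldType} (N : abs_field R K).
Implicit Types (x y z t s : K) (u v w p q : 'rV[K]_2).

Local Notation E i := (delta_mx (0 : 'I_1) (i : 'I_2) : 'rV[K]_2).

(** Near [p] the derivative of [Y] in direction [j] is within a quarter of its value [c]
    at [p], so the levels of [Y] are graphs over the other coordinate [i]. An Euler step of
    length [s] along the field tangent to the levels changes [Y] by [O(s^2)] only, whereas
    the derivative of [X] along that field is the Jacobian divided by [partial j Y], that
    is [O(|X|)]. So a polygon that starts where [X = 0] ends where [X] is small. *)
Section Euler.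
Variables (X Y : 'rV[K]_2 -> K) (p : 'rV[K]_2) (j : 'I_2) (c : K) (B r : R).
Hypotheses (B0 : 0 < B) (r0 : 0 < r) (c0 : c != 0).
Hypothesis X1 : forall v, box N p r v -> forall k,
  has_partial N X k v (partial k X v) /\ N (partial k X v) <= B.
Hypothesis Y1 : forall v, box N p r v -> forall k,
  has_partial N Y k v (partial k Y v) /\ N (partial k Y v) <= B.
Hypothesis X2 : forall v, box N p r v -> forall k l,
  has_partial N (partial k X) l v (partial l (partial k X) v) /\
  N (partial l (partial k X) v) <= B.
Hypothesis Y2 : forall v, box N p r v -> forall k l,
  has_partial N (partial k Y) l v (partial l (partial k Y) v) /\
  N (partial l (partial k Y) v) <= B.
Hypothesis Yj : forall v, box N p r v -> N (partial j Y v - c) <= N c / 4.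
Hypothesis det : forall v, box N p r v -> N (jacobian X Y v) <= B * N (X v).

Let i := swap2 j.
(* A step of length [s] moves a point by at most [H s]; [T s^2] bounds what remains beyond
   the first order. *)
Let H : R := 1 + 2 * B / N c.
Let T : R := 4 * B * H ^+ 2.

Let Nc : 0 < N c. Proof. exact: absf_gt0. Qed.

Let H0 : 0 < H.
Proof. by rewrite /H ltr_wpDr// divr_ge0 ?mulr_ge0// ?ltW. Qed.

Let T0 : 0 < T.
Proof. by rewrite /T mulr_gt0 ?exprn_gt0// mulr_gt0. Qed.

Let TN_ge0 s : 0 <= T * N s ^+ 2.
Proof. by apply: mulr_ge0; [exact: ltW|rewrite exprn_ge0// absf_ge0]. Qed.

(** On a line of direction [j], [Y] differs from [c] times the coordinate by a function with
    Lipschitz constant [N c / 2]. *)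
Lemma level_inverse u v : box N p (r / 3) u -> box N p (r / 3) v ->
  u 0 i = v 0 i -> N (v 0 j - u 0 j) <= 2 / N c * N (Y v - Y u).
Proof.
move=> hu hv e.
have := @mvi2 _ _ N (fun w => Y w - \sum_k (if k == j then c else 0) * w 0 k)
  (fun k w => partial k Y w - (if k == j then c else 0))
  (fun k => if k == j then N c / 4 else B) u v.
rewrite !(sum2 j) /= swap2_neq eqxx !mul0r !addr0 -/i e subrr absf0 mulr0 addr0.
rewrite (_ : Y v - _ - _ = Y v - Y u - c * (v 0 j - u 0 j)); last by ring.
have main : N (Y v - Y u - c * (v 0 j - u 0 j)) <=
    2 * (N c / 4 * N (v 0 j - u 0 j)) ->
    N (v 0 j - u 0 j) <= 2 / N c * N (Y v - Y u).
  move=> h; rewrite mulrAC ler_pdivlMr//.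
  have := absf_dist N (c * (v 0 j - u 0 j)) (Y v - Y u).
  rewrite absfM (absfBC N (c * _)); lra.
move=> h; apply: main; apply: h => w hw k.
have hb : box N p r w by exact: (polydisc_box hu hv).
have [h1 h2] := Y1 hb k; split.
  have := @has_partial_sublin _ _ N Y k w _ (fun k => if k == j then c else 0) h1.
  exact.
have [->|/eq_swap2 ek] := eqVneq k j; first exact: Yj.
by rewrite subr0; exact: h2.
Qed.

Let step q s := q + s *: E i + (- (s * (partial i Y q / partial j Y q))) *: E j.

Let step_i q s : step q s 0 i = q 0 i + s.
Proof. by rewrite /step !moveE eqxx swap2_neq addr0. Qed.

Let step_j q s : step q s 0 j = q 0 j - s * (partial i Y q / partial j Y q).
Proof. by rewrite /step !moveE eqxx [j == i]eq_sym swap2_neq addr0. Qed.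

Let Yj_ge q : box N p r q -> 3 / 4 * N c <= N (partial j Y q).
Proof.
move=> /Yj; have := absf_dist N c (partial j Y q).
by rewrite absfBC; lra.
Qed.

Let Yj_neq0 q : box N p r q -> partial j Y q != 0.
Proof.
move=> /Yj_ge h; apply/eqP => e; move: h; rewrite e absf0.
by have := Nc; lra.
Qed.

Let Bslope q : box N p r q -> B <= 2 * B / N c * N (partial j Y q).
Proof.
move=> /Yj_ge h; rewrite mulrAC ler_pdivlMr//.
by have := ler_wpM2l (ltW B0) h; have := mulr_gt0 B0 Nc; lra.
Qed.

Let slope_le q : box N p r q -> N (partial i Y q / partial j Y q) <= 2 * B / N c.
Proof.
move=> hq; have h := Yj_ge hq; have [_ h'] := Y1 hq i.
have Nj : 0 < N (partial j Y q) by apply: lt_le_trans h; rewrite mulr_gt0// ?divr_gt0.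
by rewrite absfM absfV ler_pdivrMr// (le_trans h')// Bslope.
Qed.

Let dist2_step q s : box N p r q -> dist2 N q (step q s) <= H * N s.
Proof.
move=> hq; rewrite /dist2 (sum2 i) /= step_i (_ : swap2 i = j); last first.
  by rewrite /i; case: (ord2P j) => ->.
rewrite step_j addrAC subrr add0r addrAC subrr add0r absfN absfM /H.
have := slope_le hq; have := absf_ge0 N s.
set a := N s; set b := N (_ / _); set d := 2 * B / _; nra.
Qed.

Let Yswap q s : \sum_k partial k Y q * (step q s 0 k - q 0 k) =
  s * (partial i Y q - partial j Y q * (partial i Y q / partial j Y q)).
Proof.
rewrite (sum2 j) -/i step_i step_j.
move: (partial i Y q) (partial j Y q) => a b; set m := a / b; clearbody m; ring.
Qed.

(* In the Taylor expansions the first-order term of [Y] cancels by the choice of the slope,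
   and that of [X] is the Jacobian over [partial j Y]. *)
Let step_est q s : box N p (r / 3) q -> box N p (r / 3) (step q s) ->
  N (Y (step q s) - Y q) <= T * N s ^+ 2 /\
  N (X (step q s)) <= N (X q) * (1 + 2 * B / N c * N s) + T * N s ^+ 2.
Proof.
move=> hq hs.
have hq' : box N p r q by apply: box_le hq; have := r0; lra.
have hd : 4 * B * dist2 N q (step q s) ^+ 2 <= T * N s ^+ 2.
  rewrite /T -[leRHS]mulrA -exprMn ler_wpM2l ?mulr_ge0 ?(ltW B0)//.
  by rewrite lerXn2r ?nnegrE ?dist2_ge0 ?mulr_ge0 ?absf_ge0 ?(ltW H0)// dist2_step.
have hw w : polydisc N q (step q s) w -> box N p r w by exact: polydisc_box hq hs w.
have tY := @taylor2 _ _ N Y (fun k => partial k Y) (fun k l => partial l (partial k Y))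
  B q (step q s) (ltW B0) (fun w h k => proj1 (Y1 (hw w h) k)) (fun w h => Y2 (hw w h)).
have tX := @taylor2 _ _ N X (fun k => partial k X) (fun k l => partial l (partial k X))
  B q (step q s) (ltW B0) (fun w h k => proj1 (X1 (hw w h) k)) (fun w h => X2 (hw w h)).
have Yj0 := Yj_neq0 hq'.
split.
  apply: le_trans hd; apply: le_trans tY.
  by rewrite Yswap mulrCA mulfV// mulr1 subrr mulr0 subr0.
set S := \sum_k _ in tX.
have eS : N S = N s * N (jacobian X Y q / partial j Y q).
  rewrite -absfM.
  have -> : S = s * (partial i X q - partial j X q * (partial i Y q / partial j Y q)).
    rewrite /S (sum2 j) -/i step_i step_j.
    move: (partial i X q) (partial j X q) (partial i Y q) (partial j Y q) => a b a' b'.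
    by set m := a' / b'; clearbody m; ring.
  rewrite -(@absfN _ _ N (s * (jacobian _ _ _ / _))).
  move: Yj0; rewrite /jacobian /i /swap2; case: (ord2P j) => -> /=.
    move: (partial 0 X q) (partial 1 X q) (partial 0 Y q) (partial 1 Y q) => a b c' d' h.
    by congr (N _); field.
  rewrite -absfN.
  move: (partial 0 X q) (partial 1 X q) (partial 0 Y q) (partial 1 Y q) => a b c' d' h.
  by congr (N _); field.
have hS : N (jacobian X Y q / partial j Y q) <= N (X q) * (2 * B / N c).
  have hj := Yj_ge hq'; have hD := det hq'.
  have Nj : 0 < N (partial j Y q).
    by apply: lt_le_trans hj; rewrite mulr_gt0// ?divr_gt0.
  rewrite absfM absfV ler_pdivrMr// (le_trans hD)//.
  by rewrite mulrC -[leRHS]mulrA ler_wpM2l ?absf_ge0// Bslope.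
have := absf_split N (X (step q s) - X q) S (- X q).
rewrite opprK subrK => h1.
have := absfD N S (X q) => h2.
have : N s * N (jacobian X Y q / partial j Y q) <= N s * (N (X q) * (2 * B / N c)).
  by rewrite ler_wpM2l ?absf_ge0.
move=> h3.
have := tX; rewrite -eS in h3; lra.
Qed.

(** [n] steps of length [s / n]: the quadratic errors add up to [O(1 / n)]. The last
    bound on [s] keeps the growth factor of [X] along the polygon below 2, as in
    Gronwall's lemma. *)
Lemma euler_polygon q s n : (0 < n)%N -> box N p (r / 6) q -> H * N s <= r / 6 ->
  2 * B / N c * N s <= 1 / 2 ->
  exists q', [/\ box N p (r / 3) q', q' 0 i = q 0 i + s, dist2 N q q' <= H * N s,
    N (Y q' - Y q) <= T * N s ^+ 2 / n%:R &
    X q = 0 -> N (X q') <= 2 * T * N s ^+ 2 / n%:R].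
Proof.
move=> n0 hq hs hs2.
have nR : (0 : R) < n%:R by rewrite ltr0n.
set D := T * N s ^+ 2 / n%:R ^+ 2.
have D0 : 0 <= D by rewrite /D divr_ge0 ?mulr_ge0 ?exprn_ge0 ?absf_ge0 ?ltW.
have nK : (n%:R : K) != 0 by rewrite pnatr_eq0 -lt0n.
suff main k : (k <= n)%N -> exists q', [/\ q' 0 i = q 0 i + k%:R * (s / n%:R),
    dist2 N q q' <= k%:R * (H * N s / n%:R), N (Y q' - Y q) <= k%:R * D &
    X q = 0 -> N (X q') <= k%:R * (2 * D)].
  have [q' [h1 h2 h3 h4]] := main n (leqnn n).
  have h5 : dist2 N q q' <= H * N s.
    by apply: le_trans h2 _; rewrite mulrCA mulfV ?mulr1 ?lt0r_neq0.
  exists q'; split => //.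
  - move=> k; have := hq k; have := absf_split N (q' 0 k) (q 0 k) (p 0 k).
    have : N (q' 0 k - q 0 k) <= dist2 N q q'.
      by rewrite /dist2 (sum2 k) lerDl absf_ge0.
    by move: hs h5 r0; lra.
  - by rewrite h1 mulrCA mulfV// mulr1.
  - rewrite (le_trans h3)// /D le_eqVlt; apply/orP; left; apply/eqP; field.
    exact: lt0r_neq0.
  - move=> /h4 h; rewrite (le_trans h)// /D le_eqVlt; apply/orP; left; apply/eqP; field.
    exact: lt0r_neq0.
elim: k => [_|k IH kn].
  exists q; rewrite !mul0r addr0; split=> //.
  - by rewrite /dist2 big1// => k _; rewrite subrr absf0.
  - by rewrite subrr absf0.
  - by move=> ->; rewrite absf0.
have [q' [h1 h2 h3 h4]] := IH (ltnW kn).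
have Ns : N (s / n%:R) = N s / n%:R by rewrite absfM absfV absf_nat.
have Hs0 : 0 <= H * N s by rewrite mulr_ge0 ?absf_ge0 ?ltW.
have inb m q'' : (m <= n)%N -> dist2 N q q'' <= m%:R * (H * N s / n%:R) ->
    box N p (r / 3) q''.
  move=> mn hm k'; have := hq k'; have := absf_split N (q'' 0 k') (q 0 k') (p 0 k').
  have : N (q'' 0 k' - q 0 k') <= dist2 N q q''.
    by rewrite /dist2 (sum2 k') lerDl absf_ge0.
  have : m%:R * (H * N s / n%:R) <= H * N s.
    by rewrite mulrCA ler_piMr// ler_pdivrMr// mul1r ler_nat.
  by move: hs hm r0; lra.
have hq' := inb _ _ (ltnW kn) h2.
have hq'r : box N p r q' by apply: box_le hq'; have := r0; lra.
set q2 := step q' (s / n%:R).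
have hd2 : dist2 N q q2 <= k.+1%:R * (H * N s / n%:R).
  have hst := dist2_step (s / n%:R) hq'r.
  have : dist2 N q q2 <= dist2 N q q' + dist2 N q' q2.
    rewrite /dist2 -big_split; apply: ler_sum => k' _ /=.
    by rewrite addrC absf_split.
  rewrite Ns mulrA -/q2 in hst.
  by move: h2 hst; rewrite -natr1; lra.
have hq2 := inb _ _ kn hd2.
have [sY sX] := step_est hq' hq2.
have eD : T * N (s / n%:R) ^+ 2 = D by rewrite Ns /D expr_div_n mulrA.
rewrite eD in sX sY.
exists q2; split=> //.
- by rewrite step_i h1 -addrA -natr1 mulrDl mul1r.
- have := absf_split N (Y q2) (Y q') (Y q).
  by move: sY h3; rewrite -/q2 -natr1; lra.
- move=> /h4 hX.
  have c1 : 2 * B / N c * N (s / n%:R) <= 1 / 2 / n%:R.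
    by rewrite Ns mulrA ler_pM2r ?invr_gt0.
  have c2 : N (X q') * (2 * B / N c * N (s / n%:R)) <= D.
    have cc : 0 <= 2 * B / N c * N (s / n%:R).
      by rewrite mulr_ge0 ?absf_ge0// divr_ge0 ?mulr_ge0// ltW.
    apply: le_trans (ler_pM (absf_ge0 _ _) cc hX c1) _.
    have : k%:R / n%:R <= 1 :> R by rewrite ler_pdivrMr// mul1r ler_nat ltnW.
    have -> : k%:R * (2 * D) * (1 / 2 / n%:R) = D * (k%:R / n%:R).
      by field; exact: lt0r_neq0.
    by move=> h; rewrite ler_piMr.
  rewrite -/q2 in sX; rewrite (le_trans sX)// mulrDr mulr1 -natr1 mulrDl mul1r.
  by move: hX c2; lra.
Qed.

(* Within the box of radius [r1], [euler_polygon] goes from any point to the coordinate [i]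
   of any other one. *)
Let r1 := Num.min (r / 6) (Num.min (r / (12 * H)) (N c / (8 * B))).

Let r1_gt0 : 0 < r1.
Proof. by rewrite !lt_min !divr_gt0 ?mulr_gt0. Qed.

Let r1_small s : N s <= 2 * r1 -> H * N s <= r / 6 /\ 2 * B / N c * N s <= 1 / 2.
Proof.
move=> hs; have a1 : r1 <= r / (12 * H) by rewrite /r1 !ge_min lexx orbT.
have a2 : r1 <= N c / (8 * B) by rewrite /r1 !ge_min lexx !orbT.
split.
  apply: (@le_trans _ _ (H * (2 * (r / (12 * H))))).
    by rewrite ler_wpM2l ?(ltW H0)// (le_trans hs)// ler_wpM2l.
  by rewrite le_eqVlt; apply/orP; left; apply/eqP; field; exact: lt0r_neq0.
apply: (@le_trans _ _ (2 * B / N c * (2 * (N c / (8 * B))))).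
  by rewrite ler_wpM2l ?divr_ge0 ?mulr_ge0 ?(ltW B0) ?(ltW Nc)// (le_trans hs)// ler_wpM2l.
rewrite le_eqVlt; apply/orP; left; apply/eqP; field.
by rewrite !lt0r_neq0.
Qed.

Let r1_dist q q' k : box N p r1 q -> box N p r1 q' -> N (q' 0 k - q 0 k) <= 2 * r1.
Proof.
move=> h h'; have := h k; have := h' k.
have := absf_split N (q' 0 k) (p 0 k) (q 0 k); rewrite (absfBC N (p 0 k)); lra.
Qed.

(** The polygon from [q] that stops above the coordinate [i] of [q'] ends close to [q'],
    since [Y] takes almost the same value there ([level_inverse]); let [n] grow. *)
Lemma level_transport q q' : box N p r1 q -> box N p r1 q' -> Y q = Y q' ->
  X q = 0 -> X q' = 0.
Proof.
move=> hq hq' eY Xq.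
set s := q' 0 i - q 0 i.
have [s1 s2] := r1_small (r1_dist i hq hq').
have hq6 : box N p (r / 6) q by apply: box_le hq; rewrite /r1 ge_min lexx.
have hq3 : box N p (r / 3) q'.
  by apply: box_le hq'; rewrite (@le_trans _ _ (r / 6)) ?ge_min ?lexx//; have := r0; lra.
apply: (absf_le0 (N := N)) => e e0.
set A := (2 * T * N s ^+ 2 + 2 * B * (2 / N c * (T * N s ^+ 2))).
have [n n0 hn] := absf_arch A e0.
have [v [v1 v2 v3 v4 v5]] := euler_polygon n0 hq6 s1 s2.
have ev : v 0 i = q' 0 i by rewrite v2 addrC subrK.
have d1 := level_inverse v1 hq3 ev.
have d2 : N (X q' - X v) <= 2 * B * N (q' 0 j - v 0 j).
  have := @mvi2 _ _ N X (fun k => partial k X) (fun=> B) v q'.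
  rewrite (sum2 j) -/i ev subrr absf0 mulr0 addr0 mulrA.
  by apply => w hw k; apply: X1; exact: (polydisc_box v1 hq3 hw).
have d3 : N (X q') <= N (X q' - X v) + N (X v) by have := absfD N (X q' - X v) (X v); rewrite subrK.
have d4 : N (q' 0 j - v 0 j) <= 2 / N c * (T * N s ^+ 2 / n%:R).
  by rewrite (le_trans d1)// ler_wpM2l ?divr_ge0 ?(ltW Nc)// -eY absfBC.
have d5 : 2 * B * N (q' 0 j - v 0 j) <= 2 * B * (2 / N c * (T * N s ^+ 2 / n%:R)).
  by rewrite ler_wpM2l// mulr_ge0 ?(ltW B0).
have d6 := v5 Xq.
apply: ltW; apply: le_lt_trans hn.
have -> : A / n%:R = 2 * T * N s ^+ 2 / n%:R +
   2 * B * (2 / N c * (T * N s ^+ 2 / n%:R)) by rewrite /A mulrDl !mulrA.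
by move: d2 d3 d5 d6; lra.
Qed.

(** By [level_inverse] the end points of the polygons with [n] steps form a Cauchy
    sequence. *)
Lemma level_crossing q : box N p (r1 / (2 + 2 * H)) q ->
  exists q', [/\ box N p r1 q', q' 0 i = p 0 i & Y q' = Y q].
Proof.
move=> hq; set s := p 0 i - q 0 i.
have HH : 2 + 2 * H != 0 by rewrite lt0r_neq0// ltr_wpDr// mulr_ge0// ltW.
have r2 : r1 / (2 + 2 * H) <= r1.
  by rewrite ler_pdivrMr ?ltr_wpDr// ?mulr_ge0 ?(ltW H0)// ler_peMr ?ltW//; have := H0; lra.
have hq1 : box N p r1 q := box_le r2 hq.
have hs : N s < r1 / (2 + 2 * H) by rewrite /s absfBC; exact: hq.
have [s1 s2] : H * N s <= r / 6 /\ 2 * B / N c * N s <= 1 / 2.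
  by apply: r1_small; move: hs r2 r1_gt0; lra.
have hq6 : box N p (r / 6) q by apply: box_le hq1; rewrite /r1 ge_min lexx.
have hp3 : box N p (r / 3) p by apply: box_center; rewrite divr_gt0.
have /choice[f fP] : forall n, exists v, [/\ box N p (r / 3) v, v 0 i = p 0 i,
    dist2 N q v <= H * N s & N (Y v - Y q) <= T * N s ^+ 2 / n.+1%:R].
  move=> n; have [v [v1 v2 v3 v4 _]] := euler_polygon (ltn0Sn n) hq6 s1 s2.
  by exists v; split => //; rewrite v2 addrC subrK.
have fj m n : N (f m 0 j - f n 0 j) <=
    2 / N c * (T * N s ^+ 2 / m.+1%:R + T * N s ^+ 2 / n.+1%:R).
  have [a1 a2 a3 a4] := fP m; have [b1 b2 b3 b4] := fP n.
  apply: le_trans (level_inverse b1 a1 _) _; first by rewrite a2 b2.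
  rewrite ler_wpM2l ?divr_ge0 ?(ltW Nc)//.
  have := absf_split N (Y (f m)) (Y q) (Y (f n)).
  rewrite (absfBC N (Y q)) => h; apply: le_trans h _; exact: lerD.
have [l hl] : exists l, forall e : R, 0 < e -> exists n0, forall n, (n0 <= n)%N ->
    N (f n 0 j - l) < e.
  apply: absf_complete => e e0.
  have [n0 n00 hn0] := absf_arch (2 / N c * (2 * (T * N s ^+ 2))) e0.
  exists n0 => m n mn nn; apply: le_lt_trans (fj m n) _; apply: le_lt_trans hn0.
  rewrite -[leRHS]mulrA ler_wpM2l ?divr_ge0 ?(ltW Nc)//.
  have -> : 2 * (T * N s ^+ 2) / n0%:R = T * N s ^+ 2 / n0%:R + T * N s ^+ 2 / n0%:R.
    by field; rewrite pnatr_eq0 -lt0n.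
  have a0 : 0 <= T * N s ^+ 2 by rewrite mulr_ge0 ?exprn_ge0 ?absf_ge0// ltW.
  by apply: lerD; rewrite ler_wpM2l// lef_pV2 ?posrE ?ltr0n// ler_nat leqW.
pose q' := p + (l - p 0 j) *: E j.
have qi : q' 0 i = p 0 i by rewrite /q' move_swap.
have qj : q' 0 j = l by rewrite /q' move_eq addrC subrK.
have fq (e : R) : 0 < e -> exists2 n, forall k, N (q' 0 k - f n 0 k) < e &
    N (Y (f n) - Y q) < e.
  move=> e0; have [n1 h1] := hl e e0.
  have [n2 n20 h2] := absf_arch (T * N s ^+ 2) e0.
  exists (maxn n1 n2).
    move=> k; have [->|/eq_swap2 ->] := eqVneq k j.
      by rewrite qj absfBC; apply: h1; rewrite leq_maxl.
    by rewrite -/i qi; have [_ -> _ _] := fP (maxn n1 n2); rewrite subrr absf0.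
  have [_ _ _ b4] := fP (maxn n1 n2); apply: le_lt_trans b4 _; apply: le_lt_trans h2.
  rewrite ler_wpM2l//.
  by rewrite lef_pV2 ?posrE ?ltr0n// ler_nat leqW// leq_maxr.
have hq' : box N p r1 q'.
  have b0 : 0 < r1 / (2 + 2 * H) by rewrite divr_gt0// ltr_wpDr// mulr_ge0// ltW.
  have [n hn _] := fq _ b0.
  have [_ _ b3 _] := fP n; move=> k.
  have := absf_split N (q' 0 k) (f n 0 k) (p 0 k).
  have := absf_split N (f n 0 k) (q 0 k) (p 0 k).
  have : N (f n 0 k - q 0 k) <= dist2 N q (f n).
    by rewrite /dist2 (sum2 k) lerDl absf_ge0.
  have : H * N s <= H * (r1 / (2 + 2 * H)) by rewrite ler_wpM2l ?(ltW H0)// ltW.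
  have e1 : r1 / (2 + 2 * H) * 2 + H * (r1 / (2 + 2 * H)) * 2 = r1 by field.
  have := hq k; have := hn k; have h0 : 0 < H * (r1 / (2 + 2 * H)) by rewrite mulr_gt0.
  by move: b3; lra.
exists q'; split=> //; apply/eqP; rewrite -subr_eq0; apply/eqP.
apply: (absf_le0 (N := N)) => e e0.
have e1 : 0 < e / (1 + 4 * B) by rewrite divr_gt0// ltr_wpDr// mulr_ge0// ltW.
have [n hn hn2] := fq _ e1.
have [a1 a2 _ _] := fP n.
have hq3 : box N p (r / 3) q'.
  by apply: box_le hq'; rewrite (@le_trans _ _ (r / 6)) ?ge_min ?lexx//; have := r0; lra.
have d2 : N (Y q' - Y (f n)) <= 2 * B * N (q' 0 j - f n 0 j).
  have := @mvi2 _ _ N Y (fun k => partial k Y) (fun=> B) (f n) q'.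
  rewrite (sum2 j) -/i a2 qi subrr absf0 mulr0 addr0 mulrA.
  by apply => w hw k; apply: Y1; exact: (polydisc_box a1 hq3 hw).
have := absf_split N (Y q') (Y (f n)) (Y q).
have : 2 * B * N (q' 0 j - f n 0 j) <= 2 * B * (e / (1 + 4 * B)).
  by rewrite ler_wpM2l ?mulr_ge0 ?(ltW B0)// ltW.
have ee : e / (1 + 4 * B) + 4 * B * (e / (1 + 4 * B)) = e.
  by field; rewrite lt0r_neq0// ltr_wpDr// mulr_ge0// ltW.
have : 0 < B * (e / (1 + 4 * B)) by rewrite mulr_gt0.
by move: hn2 d2; lra.
Qed.

End Euler.

(** ** Regular points of Y *)

(** The levels of [Y] near [p] are transverse to direction [j], and along each of them the
    bound on the Jacobian is a linear differential inequality for [X], so that [X] vanishes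
    on the whole level or nowhere on it. *)
Theorem regular_level (U : set 'rV[K]_2) (X Y : 'rV[K]_2 -> K) p (j : 'I_2) (C e : R) :
  0 < e -> open U -> U p -> Ck 2 U X -> Ck 2 U Y -> partial j Y p != 0 ->
  nbhs p [set v | N (jacobian X Y v) <= C * N (X v)] ->
  exists2 r : R, 0 < r <= e & exists2 r' : R, 0 < r' <= r & [/\ box N p r `<=` U,
    forall q q', box N p r q -> box N p r q' -> Y q = Y q' -> X q = 0 -> X q' = 0 &
    forall q, box N p r' q -> exists q', [/\ box N p r q', q' 0 (swap2 j) = p 0 (swap2 j)
       & Y q' = Y q]].
Proof.
move=> e0 oU Up X2 Y2 c0 hC; set c := partial j Y p.
have [B1 B10 [r1 r10 h1]] := Ck2_bounded N oU Up X2.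
have [B2 B20 [r2 r20 h2]] := Ck2_bounded N oU Up Y2.
have [r3 r30 h3] : exists2 r : R, 0 < r & forall v : 'rV[K]_2,
    (forall k, N (v 0 k - p 0 k) < r) -> N (partial j Y v - c) < N c / 4.
  apply: (proj1 (continuous_row N (partial j Y) p)); last by rewrite divr_gt0 ?absf_gt0.
  by apply: (@Ck_continuous _ 1 U) => //; exact: Ck_partial.
have [r4 r40 h4] := proj1 (nbhs_row N _ _) hC.
pose B := Num.max B1 (Num.max B2 C).
pose r := Num.min (Num.min (Num.min r1 r2) (Num.min r3 r4)) e.
have B0 : 0 < B by rewrite lt_max B10.
have r0 : 0 < r by rewrite !lt_min r10 r20 r30 r40 e0.
have B1B : B1 <= B by rewrite le_max lexx.
have B2B : B2 <= B by rewrite !le_max lexx orbT.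
have CB : C <= B by rewrite !le_max lexx !orbT.
have br1 : box N p r `<=` box N p r1 by apply: box_le; rewrite !ge_min lexx ?orbT.
have br2 : box N p r `<=` box N p r2 by apply: box_le; rewrite !ge_min lexx ?orbT.
have br3 : box N p r `<=` box N p r3 by apply: box_le; rewrite !ge_min lexx ?orbT.
have br4 : box N p r `<=` box N p r4 by apply: box_le; rewrite !ge_min lexx ?orbT.
have X1' v : box N p r v -> forall k,
    has_partial N X k v (partial k X v) /\ N (partial k X v) <= B.
  move=> /br1/h1[Uv b1 _] k; split; last exact: le_trans (b1 k) B1B.
  exact: Ck_has_partial X2 Uv.
have Y1' v : box N p r v -> forall k,
    has_partial N Y k v (partial k Y v) /\ N (partial k Y v) <= B.
  move=> /br2/h2[Uv b1 _] k; split; last exact: le_trans (b1 k) B2B.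
  exact: Ck_has_partial Y2 Uv.
have X2' v : box N p r v -> forall k l,
    has_partial N (partial k X) l v (partial l (partial k X) v) /\
    N (partial l (partial k X) v) <= B.
  move=> /br1/h1[Uv _ b1] k l; split; last exact: le_trans (b1 k l) B1B.
  exact: Ck_has_partial (Ck_partial _ X2) Uv.
have Y2' v : box N p r v -> forall k l,
    has_partial N (partial k Y) l v (partial l (partial k Y) v) /\
    N (partial l (partial k Y) v) <= B.
  move=> /br2/h2[Uv _ b1] k l; split; last exact: le_trans (b1 k l) B2B.
  exact: Ck_has_partial (Ck_partial _ Y2) Uv.
have Yj v : box N p r v -> N (partial j Y v - c) <= N c / 4.
  by move=> /br3/h3 /ltW.
have det v : box N p r v -> N (jacobian X Y v) <= B * N (X v).
  by move=> /br4/h4 /= /le_trans; apply; rewrite ler_wpM2r ?absf_ge0.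
have LT := level_transport B0 r0 c0 X1' Y1' X2' Y2' Yj det.
have LC := level_crossing B0 r0 c0 X1' Y1' X2' Y2' Yj det.
move: LT LC; set r1' := Num.min _ _; set r2' := (r1' / _) => LT LC.
have Nc : 0 < N c by exact: absf_gt0.
have H0 : 0 < 1 + 2 * B / N c by rewrite ltr_wpDr// divr_ge0 ?mulr_ge0// ltW.
have r1'0 : 0 < r1' by rewrite !lt_min !divr_gt0 ?mulr_gt0.
have HH : 1 <= 2 + 2 * (1 + 2 * B / N c) by move: H0; lra.
exists r1'.
  rewrite r1'0 (@le_trans _ _ (r / 6)) ?ge_min ?lexx//.
  have : r <= e by rewrite ge_min lexx orbT.
  by move: r0; lra.
exists r2'.
  rewrite divr_gt0//=; last exact: lt_le_trans HH.
  by rewrite ler_pdivrMr ?ler_peMr// ?(ltW r1'0)//; exact: lt_le_trans HH.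
split => // v hv; have /br1/h1[]// : box N p r v.
by apply: box_le hv; rewrite (@le_trans _ _ (r / 6)) ?ge_min ?lexx//; move: r0; lra.
Qed.

End Levels.

(** * Sard's theorem on the plane *)

(** Lebesgue null sets, [null_dim] being the dimension of K over R. By [null_cover] a set
    is null when, for every [m], it is covered by [O(m^(dim k))] balls of radius
    [O(m^-(k + 1))]: their total volume is [O(m^-dim)]. *)
Record null_ideal (R : realType) (K : numFieldType) (N : abs_field R K) := NullIdeal {
  null :> set K -> Prop ;
  null_dim : nat ;
  nullS : forall A B : set K, A `<=` B -> null B -> null A ;
  null_bigcup : forall A : nat -> set K,
    (forall n, null (A n)) -> null (\bigcup_n A n) ;
  null_cover : forall (A : set K) (B : R) (k : nat),
    (forall m, (0 < m)%N -> exists s : seq K,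
      (size s)%:R <= B * m%:R ^+ (null_dim * k) /\
      forall y, A y -> exists2 w, w \in s & N (y - w) <= B / m%:R ^+ k.+1) ->
    null A ;
  null_nbhs : forall (x : K) (A : set K), nbhs x A -> ~ null A ;
  null_grid : exists c : R, forall m, (0 < m)%N -> exists s : seq K,
    (size s)%:R <= c * m%:R ^+ null_dim /\
    forall z, N z <= 1 -> exists2 w, w \in s & N (z - w) <= m%:R^-1 ;
  null_dense : exists e : nat -> K, forall (x : K) (r : R), 0 < r ->
    exists n, N (e n - x) < r }.

Definition critical (K : numFieldType) (Y : 'rV[K]_2 -> K) : set 'rV[K]_2 :=
  [set u | forall k, partial k Y u = 0].

Section Sard.
Context {R : realType} {K : numFieldType} (N : abs_field R K) (null : null_ideal N).
Implicit Types (x y z t s : K) (u v w p q : 'rV[K]_2) (Y : 'rV[K]_2 -> K).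

Local Notation d := (null_dim null).

Lemma null_setU (A B : set K) : null A -> null B -> null (A `|` B).
Proof.
move=> nA nB; pose AB n := if n is 0%N then A else B.
apply: (@nullS _ _ _ null _ (\bigcup_n AB n)); last by apply: null_bigcup; case.
by move=> y [Ay|By]; [exists 0%N|exists 1%N].
Qed.

Lemma null1 y : null [set y].
Proof.
apply: (@null_cover _ _ _ null _ 1 0) => m m0; exists [:: y]; split.
  by rewrite muln0 expr0 mulr1.
move=> _ ->; exists y; first by rewrite inE.
by rewrite subrr absf0 divr_ge0.
Qed.

Lemma null0 : null set0.
Proof. exact: nullS (sub0set [set (0 : K)]) (null1 0). Qed.

Lemma null_big (T : Type) (A : T -> set K) (I : set T) : countable I ->
  (forall i, I i -> null (A i)) -> null (\bigcup_(i in I) A i).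
Proof.
move=> /countable_injP[f finj] h.
pose B n := \bigcup_(i in [set i | I i /\ f i = n]) A i.
apply: (nullS (B := \bigcup_n B n)).
  by move=> y [i Ii Aiy]; exists (f i) => //; exists i.
apply: null_bigcup => n.
have [[i [Ii fi]]|nI] := pselect (exists i, I i /\ f i = n).
  apply: (nullS _ (h i Ii)) => y [i' [Ii' fi'] Ay].
  suff -> : i = i' by [].
  by apply: finj; rewrite ?inE// fi fi'.
apply: nullS null0 => y [i [Ii fi] _]; apply: nI; by exists i.
Qed.

(** Boxes of radius [1 / n] around points with coordinates in a dense sequence form a
    countable base. *)
Lemma null_locally (Y : 'rV[K]_2 -> K) (A : set 'rV[K]_2) :
  (forall p, A p -> exists2 r : R, 0 < r & null (Y @` (A `&` box N p r))) ->
  null (Y @` A).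
Proof.
move=> h; have [e he] := null_dense null.
pose c (i : nat * nat * nat) : 'rV[K]_2 := \row_k (if k == 0 then e i.1.1 else e i.1.2).
pose b i := box N (c i) i.2.+1%:R^-1.
pose I := [set i | null (Y @` (A `&` b i))].
apply: (nullS (B := \bigcup_(i in I) Y @` (A `&` b i))); last first.
  by apply: null_big => //; exact: countableP.
move=> _ [p Ap <-]; have [r r0 hr] := h p Ap.
have [n n0 hn] := absf_arch 2 r0.
have n1 : (0 : R) < n.-1.+1%:R^-1 by rewrite invr_gt0 ltr0n.
have [n1' h1] := he (p 0 0) _ n1; have [n2' h2] := he (p 0 1) _ n1.
pose i := (n1', n2', n.-1).
have pb : b i p.
  by move=> k; case: (ord2P k) => ->; rewrite /b /c !mxE /= absfBC.
exists i; last by exists p.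
rewrite /I /=; apply: nullS hr => _ [q [Aq qb] <-]; exists q => //; split=> // k.
have := absf_split N (q 0 k) (c i 0 k) (p 0 k); have := qb k; have := pb k.
rewrite (absfBC N (p 0 k)) /i /= prednK// in hn *.
by move: hn; rewrite mulrC; lra.
Qed.

Lemma grid_at (q : K) n : (0 < n)%N -> exists c : R, forall m, (0 < m)%N ->
  exists s : seq K, (size s)%:R <= c * m%:R ^+ d /\
  forall z, N (z - q) < n%:R^-1 -> exists2 w, w \in s & N (z - w) <= m%:R^-1.
Proof.
move=> n0; have [c hc] := null_grid null; exists c => m m0.
have [s [s1 s2]] := hc m m0.
have nR : (0 : R) < n%:R by rewrite ltr0n.
have nK : (n%:R : K) != 0 by rewrite pnatr_eq0 -lt0n.
exists [seq q + t / n%:R | t <- s]; rewrite size_map; split=> // z zq.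
have [|w ws hw] := s2 ((z - q) * n%:R).
  by rewrite absfM absf_nat -ler_pdivlMr// mul1r ltW.
exists (q + w / n%:R); first by apply/mapP; exists w.
have -> : z - (q + w / n%:R) = ((z - q) * n%:R - w) / n%:R by field.
rewrite absfM absfV absf_nat ler_pdivrMr// (le_trans hw)// ler_peMr//.
by rewrite ler1n.
Qed.

Lemma centers (I : eqType) (L : seq I) (P : I -> set 'rV[K]_2) (A : set 'rV[K]_2)
    Y (e : R) :
  (forall a, A a -> exists2 i, i \in L & P i a) ->
  (forall i a a', A a -> A a' -> P i a -> P i a' -> N (Y a - Y a') <= e) ->
  exists2 s : seq K, size s = size L &
    forall y, (Y @` A) y -> exists2 w, w \in s & N (y - w) <= e.
Proof.
move=> h1 h2; exists [seq Y (xget 0 (A `&` P i)) | i <- L]; first by rewrite size_map.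
move=> _ [a Aa <-]; have [i iL Pia] := h1 a Aa.
exists (Y (xget 0 (A `&` P i))); first by apply/mapP; exists i.
have [Ab Pb] : (A `&` P i) (xget 0 (A `&` P i)) by apply: xgetPex; exists a.
exact: h2 Aa Ab Pia Pb.
Qed.

Section Bounds.
Variables (Y : 'rV[K]_2 -> K) (B : R) (u v : 'rV[K]_2).
Hypothesis B0 : 0 <= B.
Hypothesis Y1 : forall w, polydisc N u v w ->
  forall k, has_partial N Y k w (partial k Y w).
Hypothesis cu : critical Y u.

Lemma critical_le2 :
  (forall w, polydisc N u v w -> forall k l,
     has_partial N (partial k Y) l w (partial l (partial k Y) w) /\
     N (partial l (partial k Y) w) <= B) ->
  N (Y v - Y u) <= 4 * B * dist2 N u v ^+ 2.
Proof.
move=> Y2; have := taylor2 B0 Y1 Y2.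
by rewrite big1 ?subr0// => k _; rewrite cu mul0r.
Qed.

(** The partial derivatives are [O(d^2)] by [taylor2]; integrate once more. *)
Lemma critical_le3 :
  (forall k l, partial l (partial k Y) u = 0) ->
  (forall w, polydisc N u v w -> forall k l,
     has_partial N (partial k Y) l w (partial l (partial k Y) w)) ->
  (forall w, polydisc N u v w -> forall k l m,
     has_partial N (partial l (partial k Y)) m w (partial m (partial l (partial k Y)) w)
     /\ N (partial m (partial l (partial k Y)) w) <= B) ->
  N (Y v - Y u) <= 8 * B * dist2 N u v ^+ 3.
Proof.
move=> cu2 Y2 Y3; have dd := dist2_ge0 N u v.
have h w : polydisc N u v w -> forall k, N (partial k Y w) <= 4 * B * dist2 N u v ^+ 2.
  move=> hw k.
  have := @taylor2 _ _ N (partial k Y) (fun l => partial l (partial k Y))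
    (fun l m => partial m (partial l (partial k Y))) B u w B0.
  rewrite cu subr0 big1 ?subr0; last by move=> l _; rewrite cu2 mul0r.
  move=> T; apply: le_trans (T _ _) _.
  - by move=> w' h' l; apply: Y2; exact: polydisc_trans hw h'.
  - by move=> w' h' l m; apply: Y3; exact: polydisc_trans hw h'.
  rewrite ler_wpM2l ?mulr_ge0// lerXn2r ?nnegrE ?dist2_ge0//.
  exact: polydisc_dist.
have := @mvi2 _ _ N Y (fun k => partial k Y) (fun=> 4 * B * dist2 N u v ^+ 2) u v.
rewrite -mulr_sumr -/(dist2 N u v).
have -> : 2 * (4 * B * dist2 N u v ^+ 2 * dist2 N u v) = 8 * B * dist2 N u v ^+ 3.
  by ring.
by apply => w hw k; split; [exact: Y1|exact: h].
Qed.

End Bounds.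

Variables (U : set 'rV[K]_2) (Y : 'rV[K]_2 -> K).
Hypotheses (oU : open U) (Y3 : Ck 3 U Y).

Let Y2 : Ck 2 U Y. Proof. exact: CkW. Qed.

Lemma unit_fraction (r : R) : 0 < r -> exists2 n, (0 < n)%N & n%:R^-1 < r.
Proof. by move=> /(absf_arch 1)[n n0]; rewrite mul1r; exists n. Qed.

(** Where all second derivatives vanish too, [Y] varies by [O(m^-3)] on each of the
    [O(m^(2 dim))] cells of a grid of mesh [1 / m]. *)
Lemma null_degenerate p : U p -> exists2 r : R, 0 < r &
  null (Y @` ([set u | U u /\ critical Y u /\
     forall k, critical (partial k Y) u] `&` box N p r)).
Proof.
move=> Up.
have [B1 B10 [r1 r10 h1]] := Ck2_bounded N oU Up (Ck_partial 0 Y3).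
have [B2 B20 [r2 r20 h2]] := Ck2_bounded N oU Up (Ck_partial 1 Y3).
pose B := Num.max B1 B2.
have B0 : 0 <= B by rewrite le_max (ltW B10).
have r0 : 0 < Num.min r1 r2 / 3 by rewrite divr_gt0// lt_min r10.
have [n n0 hn] := unit_fraction r0.
exists n%:R^-1; first by rewrite invr_gt0 ltr0n.
set A := (X in Y @` X).
have hA u : A u -> box N p (Num.min r1 r2 / 3) u by move=> [_ /(box_le (ltW hn))].
have [c0 hc0] := grid_at (p 0 0) n0; have [c1 hc1] := grid_at (p 0 1) n0.
apply: (@null_cover _ _ _ null _ (Num.max (c0 * c1) (8 * B * 4 ^+ 3)) 2) => m m0.
have [s0 [s0m s0P]] := hc0 m m0; have [s1 [s1m s1P]] := hc1 m m0.
have mR : (0 : R) < m%:R by rewrite ltr0n.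
have [||s sz sP] := @centers _ [seq (a, b) | a <- s0, b <- s1]
  (fun i => [set u | N (u 0 0 - i.1) <= m%:R^-1 /\ N (u 0 1 - i.2) <= m%:R^-1]) A Y
  (8 * B * (4 / m%:R) ^+ 3).
- move=> a [_ ha]; have [w0 w0s h0] := s0P _ (ha 0); have [w1 w1s h1'] := s1P _ (ha 1).
  by exists (w0, w1) => //; apply/allpairsP; exists (w0, w1).
- move=> [i0 i1] a a' Aa Aa' /= [e1 e2] [e3 e4].
  have dd : dist2 N a' a <= 4 / m%:R.
    rewrite /dist2 (sum2 0) /=.
    have := absf_split N (a 0 0) i0 (a' 0 0); have := absf_split N (a 0 1) i1 (a' 0 1).
    by rewrite (absfBC N i0) (absfBC N i1) /swap2 /=; lra.
  have reg w : polydisc N a' a w -> [/\ U w, forall k l, has_partial N (partial k Y) l w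
      (partial l (partial k Y) w) & forall k l m,
     has_partial N (partial l (partial k Y)) m w (partial m (partial l (partial k Y)) w)
     /\ N (partial m (partial l (partial k Y)) w) <= B].
    move=> /(polydisc_box (hA _ Aa') (hA _ Aa)) hw.
    have hw1 : box N p r1 w by apply: box_le hw; rewrite ge_min lexx.
    have hw2 : box N p r2 w by apply: box_le hw; rewrite ge_min lexx orbT.
    have [Uw _ b1] := h1 _ hw1; have [_ _ b2] := h2 _ hw2; split => //.
      by move=> k l; exact: Ck_has_partial (Ck_partial _ Y3) Uw.
    move=> k l l'; split.
      by apply: Ck_has_partial Uw; do 2 apply: Ck_partial; exact: Y3.
    rewrite le_max; apply/orP; case: (ord2P k) => ->; [left|right].
      exact: b1.
    exact: b2.
  have [[Ua' [cr1 cr2]] _] := Aa'.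
  apply: le_trans (@critical_le3 Y B a' a B0 _ cr1 _ _ _) _.
  + by move=> w /reg[Uw _ _] k; exact: Ck_has_partial Y3 Uw.
  + by move=> k l; exact: cr2.
  + by move=> w /reg[].
  + by move=> w /reg[].
  by rewrite ler_wpM2l ?mulr_ge0// lerXn2r ?nnegrE ?dist2_ge0 ?divr_ge0.
exists s; split.
  rewrite sz size_allpairs natrM.
  apply: le_trans (_ : c0 * m%:R ^+ d * (c1 * m%:R ^+ d) <= _).
    by apply: ler_pM.
  rewrite mulrACA -exprD addnn -mul2n mulnC.
  by rewrite ler_wpM2r ?exprn_ge0// le_max lexx.
move=> y /sP[w ws hw]; exists w => //; apply: le_trans hw _.
by rewrite expr_div_n mulrA ler_wpM2r ?invr_ge0 ?exprn_ge0// le_max lexx orbT.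
Qed.

(** The critical points are zeros of [partial i Y], whose derivative in direction [l] is
    nonzero; so they lie on a Lipschitz graph over the other coordinate. Then
    [O(m^dim)] cells suffice, and [Y] varies by [O(m^-2)] on each. *)
Lemma null_nondegenerate p i l : U p -> partial l (partial i Y) p != 0 ->
  exists2 r : R, 0 < r & null (Y @` ([set u | U u /\ critical Y u] `&` box N p r)).
Proof.
move=> Up; set c := partial l (partial i Y) p => c0.
have Nc : 0 < N c by exact: absf_gt0.
have [B B0 [r1 r10 h1]] := Ck2_bounded N oU Up Y2.
have [r2 r20 h2] : exists2 r : R, 0 < r & forall v : 'rV[K]_2,
    (forall k, N (v 0 k - p 0 k) < r) -> N (partial l (partial i Y) v - c) < N c / 4.
  apply: (proj1 (continuous_row N (partial l (partial i Y)) p)); last by rewrite divr_gt0.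
  apply: (@Ck_continuous _ 0 U) => //; do 2 apply: Ck_partial; exact: Y2.
have r0 : 0 < Num.min r1 r2 / 3 by rewrite divr_gt0// lt_min r10.
have [n n0 hn] := unit_fraction r0.
exists n%:R^-1; first by rewrite invr_gt0 ltr0n.
set A := (X in Y @` X); set l' := swap2 l.
have hA u : A u -> box N p (Num.min r1 r2 / 3) u by move=> [_ /(box_le (ltW hn))].
have reg a a' : A a -> A a' -> forall w, polydisc N a' a w -> [/\ U w,
    forall k l, has_partial N (partial k Y) l w (partial l (partial k Y) w)
     /\ N (partial l (partial k Y) w) <= B &
     N (partial l (partial i Y) w - c) <= N c / 4].
  move=> Aa Aa' w /(polydisc_box (hA _ Aa') (hA _ Aa)) hw.
  have hw1 : box N p r1 w by apply: box_le hw; rewrite ge_min lexx.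
  have hw2 : box N p r2 w by apply: box_le hw; rewrite ge_min lexx orbT.
  have [Uw _ b1] := h1 _ hw1; split => //; last by apply: ltW; exact: h2.
  by move=> k m; split => //; exact: Ck_has_partial (Ck_partial _ Y2) Uw.
have lip a a' : A a -> A a' ->
    N (a 0 l - a' 0 l) <= 4 * B / N c * N (a 0 l' - a' 0 l').
  move=> Aa Aa'.
  have := @mvi2 _ _ N (fun w => partial i Y w - \sum_k (if k == l then c else 0) * w 0 k)
    (fun k w => partial k (partial i Y) w - (if k == l then c else 0))
    (fun k => if k == l then N c / 4 else B) a' a.
  rewrite !(sum2 l) /= swap2_neq eqxx !mul0r !addr0 -/l'.
  have [[_ cr] _] := Aa; have [[_ cr'] _] := Aa'.
  rewrite cr cr' (_ : _ - _ - _ = c * (a' 0 l - a 0 l)); last by ring.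
  rewrite absfM => h.
  suff : N c * N (a' 0 l - a 0 l) <=
      2 * (N c / 4 * N (a 0 l - a' 0 l) + B * N (a 0 l' - a' 0 l')).
    move=> h'; rewrite mulrAC ler_pdivlMr//; move: h'.
    by rewrite [X in N c * X]absfBC; lra.
  apply: h => w hw k; have [_ b1 b2] := reg _ _ Aa Aa' _ hw; split.
    have := @has_partial_sublin _ _ N (partial i Y) k w _
      (fun k => if k == l then c else 0) (proj1 (b1 i k)).
    exact.
  have [->|/eq_swap2 ek] := eqVneq k l; first exact: b2.
  by rewrite subr0; exact: (proj2 (b1 i k)).
have [c0' hc0] := grid_at (p 0 l') n0.
pose L := 2 * (4 * B / N c) + 2.
have L0 : 0 <= L by rewrite addr_ge0// mulr_ge0// divr_ge0 ?mulr_ge0 ?(ltW B0) ?(ltW Nc).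
apply: (@null_cover _ _ _ null _ (Num.max c0' (4 * B * L ^+ 2)) 1) => m m0.
have [s0 [s0m s0P]] := hc0 m m0.
have mR : (0 : R) < m%:R by rewrite ltr0n.
have [||s sz sP] := @centers _ s0
  (fun i => [set u | N (u 0 l' - i) <= m%:R^-1]) A Y (4 * B * (L / m%:R) ^+ 2).
- by move=> a [_ ha]; exact: s0P.
- move=> i0 a a' Aa Aa' /= e1 e2.
  have dl' : N (a 0 l' - a' 0 l') <= 2 / m%:R.
    by have := absf_split N (a 0 l') i0 (a' 0 l'); rewrite (absfBC N i0); lra.
  have dd : dist2 N a' a <= L / m%:R.
    rewrite /dist2 (sum2 l) /= -/l'.
    apply: le_trans (_ : 4 * B / N c * (2 / m%:R) + 2 / m%:R <= _).
      rewrite lerD// (le_trans (lip _ _ Aa Aa'))// ler_wpM2l//.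
      by rewrite divr_ge0 ?mulr_ge0 ?(ltW B0) ?(ltW Nc).
    by rewrite /L; lra.
  have [[Ua' cr] _] := Aa'.
  apply: le_trans (@critical_le2 Y B a' a (ltW B0) _ cr _) _.
  + by move=> w /(reg _ _ Aa Aa')[Uw _ _] k; exact: Ck_has_partial Y3 Uw.
  + by move=> w /(reg _ _ Aa Aa')[].
  by rewrite ler_wpM2l ?mulr_ge0 ?(ltW B0)// lerXn2r ?nnegrE ?dist2_ge0 ?divr_ge0.
exists s; split.
  by rewrite sz muln1 (le_trans s0m)// ler_wpM2r ?exprn_ge0// le_max lexx.
move=> y /sP[w ws hw]; exists w => //; apply: le_trans hw _.
by rewrite expr_div_n mulrA ler_wpM2r ?invr_ge0 ?exprn_ge0// le_max lexx orbT.
Qed.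

(** Separate the critical points according to the vanishing of the second derivatives. *)
Theorem sard : null (Y @` [set u | U u /\ critical Y u]).
Proof.
pose D := [set u | U u /\ critical Y u /\ forall k, critical (partial k Y) u].
pose D' := [set u | U u /\ critical Y u /\ exists i l, partial l (partial i Y) u != 0].
apply: (nullS (B := Y @` D `|` Y @` D')).
  move=> _ [u [Uu cu] <-].
  have [h|/existsNP[i /existsNP[l h]]] := pselect (forall k, critical (partial k Y) u).
    by left; exists u.
  by right; exists u => //; split => //; split => //; exists i, l; apply/eqP.
apply: null_setU; apply: null_locally.
  move=> p [Up _]; have [r r0 h] := null_degenerate Up; exists r => //.
move=> p [Up [_ [i [l h]]]]; have [r r0 h'] := null_nondegenerate Up h; exists r => //.
by apply: nullS h'; apply: image_subset => u [[Uu [cu _]] hu].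
Qed.

End Sard.

(** * Zeros of a function along the levels of another one *)

Section Zeros.
Context {R : realType} {K : numFieldType} (N : abs_field R K) (null : null_ideal N).
Implicit Types (x y z t s : K) (u v w p q : 'rV[K]_2) (X Y : 'rV[K]_2 -> K).

Local Notation E i := (delta_mx (0 : 'I_1) (i : 'I_2) : 'rV[K]_2).

(** The part of the identity principle that real analytic and holomorphic functions have
    in common. *)
Definition isolated_zeros (U : set 'rV[K]_2) X := forall u (i : 'I_2), U u ->
  (exists2 r : R, 0 < r & forall t, N t < r -> X (u + t *: E i) = 0) \/
  (exists2 r : R, 0 < r & forall t, N t < r -> t != 0 -> X (u + t *: E i) != 0).

Section Line.
Variables (U : set 'rV[K]_2) (X : 'rV[K]_2 -> K) (IZ : isolated_zeros U X).

(** Zeros accumulate at the last point of the segment up to which [X] vanishes, so [X]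
    vanishes a little further. *)
Lemma zero_on_line (iota : R -> K) u i t :
  iota 0 = 0 -> iota 1 = 1 -> (forall a b, N (iota a - iota b) = `|a - b|) ->
  (forall a, 0 <= a <= 1 -> U (u + (iota a * t) *: E i)) ->
  (exists2 r : R, 0 < r & forall s, N s < r -> X (u + s *: E i) = 0) ->
  X (u + t *: E i) = 0.
Proof.
move=> i0 i1 iN Uline [r r0 rP].
pose g a := u + (iota a * t) *: E i.
pose S := [set a | 0 <= a <= 1 /\ forall b, 0 <= b <= a -> X (g b) = 0].
have S0 : S 0.
  split; first by rewrite lexx ler01.
  move=> b; rewrite -eq_le => /eqP <-; rewrite /g i0 mul0r.
  by apply: rP; rewrite absf0.
have Sup : has_sup S by split; [exists 0|exists 1 => a [/andP[]]].
have ub : ubound S (sup S) by exact: sup_upper_bound.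
set c := sup S in ub.
have c01 : 0 <= c <= 1.
  by rewrite ub//= ge_sup//; [exists 0|move=> a [/andP[]]].
have Nt1 : 0 < N t + 1 by rewrite ltr_wpDl ?absf_ge0.
have gE a b : g a = g b + ((iota a - iota b) * t) *: E i.
  by rewrite /g -addrA -scalerDl mulrBl [_ * t + _]addrC subrK.
have gN a b d : 0 < d -> `|a - b| < d / (N t + 1) -> N ((iota a - iota b) * t) < d.
  move=> d0 h; rewrite absfM iN.
  apply: (@le_lt_trans _ _ (`|a - b| * (N t + 1))); first by rewrite ler_wpM2l// lerDl.
  by rewrite -ltr_pdivlMr.
have below b : 0 <= b -> b < c -> X (g b) = 0.
  move=> b0 bc; have cb : 0 < c - b by rewrite subr_gt0.
  have [a [_ Sa]] := sup_adherent cb Sup.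
  by rewrite -/c subKr => ba; apply: Sa; rewrite b0 ltW.
have [[d d0 dP]|[d d0 dP]] := IZ i (Uline c c01).
  (* zero around [g c]: the set of good times goes beyond [c] *)
  pose e := Num.min 1 (c + d / (N t + 1) / 2).
  have dd : 0 < d / (N t + 1) by rewrite divr_gt0.
  have Se : S e.
    have [c0 c1] := andP c01.
    split; first by rewrite /e ge_min lexx le_min ler01 addr_ge0// divr_ge0// ltW.
    move=> b /andP[b0 be]; have [bc|cb] := ltP b c; first exact: below.
    rewrite (gE b c); apply: dP; apply: gN => //.
    rewrite ger0_norm ?subr_ge0//.
    have : b <= c + d / (N t + 1) / 2 by rewrite (le_trans be)// ge_min lexx orbT.
    by move: dd; lra.
  have ec := ub _ Se.
  have e1 : e = 1.
    have [h|h] := leP 1 (c + d / (N t + 1) / 2); first by rewrite /e min_l.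
    by move: ec; rewrite /e min_r ?(ltW h)//; move: dd; lra.
  by have [_ /(_ 1)] := Se; rewrite e1 /g i1 mul1r; apply; rewrite ler01 lexx.
(* [c] is positive, so that zeros accumulate at [g c] *)
have c0 : 0 < c.
  have rr : 0 < r / (N t + 1) by rewrite divr_gt0.
  pose e := Num.min 1 (r / (N t + 1) / 2).
  apply: (@lt_le_trans _ _ e); first by rewrite lt_min ltr01 divr_gt0.
  apply: ub; split; first by rewrite /e ge_min lexx le_min ler01 divr_ge0// ltW.
  move=> b /andP[b0 be]; rewrite (gE b 0) /g i0 mul0r scale0r addr0; apply: rP.
  rewrite -i0; apply: gN => //; rewrite subr0 ger0_norm//.
  have : b <= r / (N t + 1) / 2 by rewrite (le_trans be)// ge_min lexx orbT.
  by move: rr; lra.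
have [t0|t0] := eqVneq t 0.
  by rewrite t0; apply: rP; rewrite absf0.
pose b := Num.max 0 (c - d / (N t + 1) / 2).
have dd : 0 < d / (N t + 1) by rewrite divr_gt0.
have bc : b < c by rewrite /b gt_max c0 gtrBl divr_gt0.
have b0 : 0 <= b by rewrite le_max lexx.
have Nb : N ((iota b - iota c) * t) < d.
  apply: gN => //; rewrite ltr0_norm ?subr_lt0//.
  have : c - d / (N t + 1) / 2 <= b by rewrite le_max lexx orbT.
  by move: dd; lra.
have bct : (iota b - iota c) * t != 0.
  rewrite mulf_neq0//; apply/eqP => h.
  have := iN b c; rewrite h absf0 => /esym/eqP; rewrite normr_eq0 subr_eq0 => /eqP e.
  by rewrite e ltxx in bc.
have := dP _ Nb bct; rewrite -/(g c) -gE => /eqP; case; exact: below.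
Qed.

(** Go from [q] to [v] along two segments parallel to the axes. *)
Lemma zero_on_box p (r : R) q : box N p r `<=` U -> box N p r q ->
  nbhs q [set v | X v = 0] -> forall v, box N p r v -> X v = 0.
Proof.
move=> rU hq /(nbhs_row N)[d d0 dP] v hv.
have [iota [i0 i1 iN]] := absf_real N.
(* the box is convex *)
have cvx u w i t : box N p r u -> box N p r w -> w = u + t *: E i ->
    forall a, 0 <= a <= 1 -> U (u + (iota a * t) *: E i).
  move=> hu hw ew a /andP[a0 a1]; apply: rU => k.
  have := hu k; have := hw k; rewrite ew !moveE.
  case: (k == i); rewrite ?mulr1n ?mulr0n ?addr0// => h1 h2.
  have -> : u 0 k + iota a * t - p 0 k =
     (iota 1 - iota a) * (u 0 k - p 0 k) + (iota a - iota 0) * (u 0 k + t - p 0 k).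
    by rewrite i0 i1; ring.
  apply: le_lt_trans (absfD _ _ _) _; rewrite !absfM !iN subr0.
  rewrite !ger0_norm ?subr_ge0//.
  have [->|a0'] := eqVneq a 0; first by rewrite mul0r subr0 mul1r addr0.
  have a00 : 0 < a by rewrite lt0r a0'.
  apply: (@lt_le_trans _ _ ((1 - a) * r + a * r)); last by rewrite -mulrDl subrK mul1r.
  apply: ler_ltD; first by rewrite ler_wpM2l ?subr_ge0// ltW.
  by rewrite ltr_pM2l.
have step1 w : box N p r w -> N (w 0 1 - q 0 1) < d -> X w = 0.
  move=> hw hd; pose u := w + (q 0 0 - w 0 0) *: E 0.
  have hu : box N p r u.
    move=> k; rewrite moveE; case: (ord2P k) => -> /=.
      by rewrite mulr1n [w 0 0 + _]addrC subrK; exact: hq.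
    by rewrite addr0; exact: hw.
  have ew : w = u + (w 0 0 - q 0 0) *: E 0.
    by rewrite /u -addrA -scalerDl addrA subrK subrr scale0r addr0.
  rewrite ew; apply: (zero_on_line i0 i1 iN); first exact: cvx hu hw ew.
  exists d => // s sd; apply: dP => k; rewrite !moveE.
  case: (ord2P k) => -> /=; last by rewrite !addr0.
  by rewrite !mulr1n [w 0 0 + _]addrC subrK [_ + s]addrC addrK.
pose u := v + (q 0 1 - v 0 1) *: E 1.
have hu : box N p r u.
  move=> k; rewrite moveE; case: (ord2P k) => -> /=.
    by rewrite addr0; exact: hv.
  by rewrite mulr1n [v 0 1 + _]addrC subrK; exact: hq.
have ev : v = u + (v 0 1 - q 0 1) *: E 1.
  by rewrite /u -addrA -scalerDl addrA subrK subrr scale0r addr0.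
have [d' d'0 d'P] : exists2 d' : R, 0 < d' & forall k, N (u 0 k - p 0 k) + d' <= r.
  pose m := Num.min (r - N (u 0 0 - p 0 0)) (r - N (u 0 1 - p 0 1)).
  exists m; first by rewrite lt_min !subr_gt0 !hu.
  by move=> k; rewrite -lerBrDl ge_min; case: (ord2P k) => ->; rewrite lexx ?orbT.
rewrite ev; apply: (zero_on_line i0 i1 iN); first exact: cvx hu hv ev.
exists (Num.min d d'); first by rewrite lt_min d0.
move=> s; rewrite lt_min => /andP[sd sd']; apply: step1.
  move=> k; rewrite moveE; have := d'P k; have := absfD N (u 0 k - p 0 k) (s *+ (k == 1)).
  rewrite addrAC; case: (k == 1); rewrite ?mulr1n ?mulr0n ?absf0; lra.
by rewrite !moveE /= !mulr1n [v 0 1 + _]addrC subrK [_ + s]addrC addrK.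
Qed.

End Line.

(** Critical points are covered by [sard]. Near a zero [p] of [X] with [dY] nonzero, any
    zero of [X] can be moved along its level of [Y] onto the line through [p] where
    [regular_level] lets the levels cross. Zeros of [X] on this line are isolated, because
    if [X] vanished on it, transport along the levels would make [X] vanish near [p]. So
    [Y p] is the only value of [Y] at zeros of [X] near [p]. *)
Theorem zero_set_null (U : set 'rV[K]_2) X Y : open U -> Ck 2 U X -> Ck 3 U Y ->
  (forall p, U p -> X p = 0 -> exists C : R,
     nbhs p [set v | N (jacobian X Y v) <= C * N (X v)]) ->
  isolated_zeros U X -> (forall p, U p -> ~ nbhs p [set v | X v = 0]) ->
  null (Y @` [set u | U u /\ X u = 0]).
Proof.
move=> oU X2 Y3 hJ IZ nX.
pose D := [set u | (U u /\ X u = 0) /\ exists j, partial j Y u != 0].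
apply: (@nullS _ _ _ null _ (Y @` [set u | U u /\ critical Y u] `|` Y @` D)).
  move=> _ [u [Uu Xu] <-].
  have [h|/existsNP[j h]] := pselect (critical Y u); first by left; exists u.
  by right; exists u => //; split => //; exists j; exact/eqP.
apply: null_setU; first exact: sard.
apply: null_locally => p [[Up Xp] [j Yj]].
have [C hC] := hJ p Up Xp.
have Y2 := CkW Y3.
have [[e e0 eP]|[e e0 eP]] := IZ p j Up.
all: have [r /andP[r0 re] [r' /andP[r'0 r'r] [rU LT LC]]] := regular_level e0 oU Up X2 Y2 Yj hC.
all: have coord q : box N p r q -> q 0 (swap2 j) = p 0 (swap2 j) ->
    exists2 t, N t < e & q = p + t *: E j.
all: try by [move=> hq hi; exists (q 0 j - p 0 j);
    [exact: lt_le_trans (hq j) re|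
     apply: (@row2P _ j); rewrite ?move_swap// move_eq addrC subrK]].
  exfalso; apply: (nX p Up); apply/(nbhs_row N); exists r' => // q hq.
  have [q' [h1 h2 h3]] := LC q hq.
  apply: (LT q' q) => //; first exact: box_le hq.
  by have [t te ->] := coord q' h1 h2; exact: eP.
exists r' => //; apply: nullS (null1 null (Y p)).
move=> _ [q [[[Uq Xq] _] hq] <-]; have [q' [h1 h2 h3]] := LC q hq.
have Xq' : X q' = 0 by apply: (LT q q') => //; exact: box_le hq.
have [t te eq'] := coord q' h1 h2.
rewrite /= -h3 eq'; have [->|t0] := eqVneq t 0; first by rewrite scale0r addr0.
by have := eP t te t0; rewrite -eq' Xq' eqxx.
Qed.

End Zeros.

(** * Charts of a surface *)

(** Otherwise the sets whose complement in [A] satisfies [P] form a proper filter, and its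
    cluster point in [A] contradicts the local hypothesis. *)
Lemma compact_ideal (T : topologicalType) (P : set T -> Prop) (A : set T) :
  P set0 -> (forall B C, P B -> P C -> P (B `|` C)) ->
  (forall B C, B `<=` C -> P C -> P B) -> compact A ->
  (forall p, A p -> exists2 W, nbhs p W & P W) -> P A.
Proof.
move=> P0 PU PS cA loc; apply: contrapT => nPA.
pose F : set_system T := [set B | P (A `\` B)].
have FF : ProperFilter F.
  split; first by rewrite /F /= setD0.
  split.
  - by rewrite /F /= setDT.
  - by move=> B C FB FC; rewrite /F /= setDIr; exact: PU.
  - by move=> B C BC FB; apply: PS FB; exact: setDS.
have FA : F A by rewrite /F /= setDv.
have [p [Ap clp]] := cA F FF FA.
have [W pW PW] := loc p Ap.
have FW : F (~` W) by rewrite /F /=; apply: PS PW => q [_ /contrapT].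
by have [q []] := clp _ _ FW pW.
Qed.

Section Manifold.
Context {R : realType} {K : numFieldType} (N : abs_field R K) (null : null_ideal N).
Variables (C : regularity K) (S : bivector_manifold K 2).
Hypothesis mS : is_manifold C S.
Implicit Types (c : chart K 2 S) (p q : S).

Let paracompactS : paracompact_space S. Proof. by case: mS. Qed.
Let chartS c : atlas c -> is_chart c. Proof. by case: mS => _ _ + _ _; exact. Qed.
Let atlasS p : exists2 c, atlas c & chart_dom c p.
Proof. by case: mS => _ _ _ + _; exact. Qed.

Definition chart_image c := chart_map c @` chart_dom c.

Lemma open_chart_image c : atlas c -> open (chart_image c).
Proof. by move=> /chartS[oc _ _ h]; exact: h. Qed.

Lemma chart_image_nbhs c p (W : set S) : atlas c -> chart_dom c p -> nbhs p W ->
  nbhs (chart_map c p) (chart_map c @` (chart_dom c `&` W)).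
Proof.
move=> /chartS[oc _ _ h] cp pW.
have o1 : open (chart_dom c `&` W^°) by apply: openI => //; exact: open_interior.
apply: (@filterS _ _ _ (chart_map c @` (chart_dom c `&` W^°))).
  by apply: image_subset; apply: setIS; exact: interior_subset.
apply: open_nbhs_nbhs; split; first by apply: h => // q [].
by exists p => //; split => //; exact: pW.
Qed.

Lemma chart_preimage_nbhs c p (V : set 'rV[K]_2) : atlas c -> chart_dom c p ->
  nbhs (chart_map c p) V -> nbhs p [set q | chart_dom c q /\ V (chart_map c q)].
Proof.
move=> /chartS[oc _ cc h] cp hV; apply: filterI; last exact: cc.
by apply: open_nbhs_nbhs.
Qed.

Lemma local_exprE c (F : S -> K) p : atlas c -> chart_dom c p ->
  local_expr c F (chart_map c p) = F p.
Proof.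
move=> /chartS[_ inj _ _] cp; rewrite /local_expr; case: pselect => [ex|[]]; last by exists p.
case: (cid ex) => q [cq e] /=; congr F.
by apply: inj => //; rewrite inE.
Qed.

(** ** Second countability *)

(** The points [e n] may be outside of [A], so that the property passes to subsets. *)
Definition separable (A : set S) := exists e : nat -> S,
  forall V, open V -> V `&` A !=set0 -> exists n, V (e n).

Lemma separable_chart c : atlas c -> chart_dom c !=set0 -> separable (chart_dom c).
Proof.
move=> ac [p0 cp0]; have [d hd] := null_dense null.
pose D (n : nat) : 'rV[K]_2 := if unpickle n is Some (a, b) then
  \row_k (if k == 0 then d a else d b) else 0.
pose e n : S := xget p0 [set q | chart_dom c q /\ chart_map c q = D n].
exists e => V oV [p [Vp cp]].
have /(nbhs_row N)[r r0 rP] := chart_image_nbhs ac cp (open_nbhs_nbhs (conj oV Vp)).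
have [a ha] := hd (chart_map c p 0 0) _ r0.
have [b hb] := hd (chart_map c p 0 1) _ r0.
have [|q [cq Vq] eq] := rP (D (pickle (a, b))).
  by move=> k; rewrite /D pickleK mxE; case: (ord2P k) => ->.
exists (pickle (a, b)).
have [ce ee] : (chart_dom c `&` [set q | chart_map c q = D (pickle (a, b))])
    (e (pickle (a, b))).
  by apply: (@xgetPex _ p0 [set q | chart_dom c q /\ chart_map c q = D _]); exists q.
suff -> : e (pickle (a, b)) = q by [].
by have [_ inj _ _] := chartS ac; apply: inj; rewrite ?inE// ee eq.
Qed.

Lemma separable_sub (A B : set S) : B `<=` A -> separable A -> separable B.
Proof.
move=> BA [e he]; exists e => V oV [p [Vp Bp]]; apply: he => //.
by exists p; split => //; exact: BA.
Qed.

(** Refine the cover by chart domains to a locally finite one. Its nonempty members are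
    separable, so each of them meets countably many others. The members that a chain of
    intersecting ones joins to a given member are therefore countably many; their union is
    open, and closed because the remaining members cover its complement. *)
Lemma countable_charts : connected [set: S] -> exists H : set (set S),
  [/\ countable H, forall p, exists2 B, H B & B p &
      forall B, H B -> exists2 c, atlas c & B `<=` chart_dom c].
Proof.
move=> conS.
have [[p0]|nS] := pselect (exists p : S, True); last first.
  by exists set0; split => // p; case: nS; exists p.
move=> _; pose F := [set A : set S | exists2 c, atlas c & A = chart_dom c].
have [||G [oG covG refG locG]] := paracompactS (F := F).
- by move=> _ [c ac ->]; have [] := chartS ac.
- rewrite eqEsubset; split => // p _; have [c ac cp] := atlasS p.
  by exists (chart_dom c) => //; exists c.
have GS B : G B -> B !=set0 -> separable B.
  move=> /refG[A [c ac ->] Bc] [q Bq]; apply: (separable_sub Bc).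
  by apply: separable_chart => //; exists q; exact: Bc.
pose meets B := [set B' | G B' /\ B' `&` B !=set0].
have meets_countable B : G B -> countable (meets B).
  move=> GB; have [B0|nB] := pselect (B !=set0); last first.
    suff -> : meets B = set0 by exact: countable0.
    by rewrite -subset0 => B' [_ [q [_ Bq]]]; apply: nB; exists q.
  have [e he] := GS _ GB B0.
  apply: (@sub_countable _ _ _ (\bigcup_n [set B' | G B' /\ B' (e n)])).
    apply: subset_card_le => B' [GB' h]; have [n en] := he _ (oG _ GB') h.
    by exists n.
  apply: bigcup_countable => // n _; apply: finite_set_countable.
  have [W pW fW] := locG (e n); apply: sub_finite_set fW => B' [GB' en].
  by split=> //; exists (e n); split => //; exact: nbhs_singleton.
have [B0 GB0 B0p] : exists2 B0, G B0 & B0 p0.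
  by have : (\bigcup_(B in G) B) p0 by rewrite covG.
pose reach := fix reach n : set (set S) :=
  if n is n'.+1 then \bigcup_(B in reach n') meets B else [set B0].
have reachG n : reach n `<=` G.
  by case: n => [|n] B /=; [move=> ->|move=> [B' _ []]].
have reach_countable n : countable (reach n).
  elim: n => [|n IH]; first exact: countable1.
  by apply: bigcup_countable => // B /reachG; exact: meets_countable.
exists (\bigcup_n reach n); split.
- exact: bigcup_countable.
- pose U := \bigcup_(B in \bigcup_n reach n) B.
  suff UT : U = [set: S] by move=> p; have : U p by rewrite UT.
  apply: conS.
  + by exists p0; exists B0 => //; exists 0%N.
  + exists U; last by rewrite setTI.
    by apply: bigcup_open => B [n _ /reachG]; exact: oG.
  exists U; last by rewrite setTI.
  rewrite -(setCK U); apply: open_closedC.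
  suff -> : ~` U = \bigcup_(B in [set B | G B /\ B `&` U = set0]) B.
    by apply: bigcup_open => B [GB _]; exact: oG.
  rewrite eqEsubset; split => [p nUp|p [B [_ BU] Bp] Up]; last first.
    by have : (B `&` U) p by []; rewrite BU.
  have [B GB Bp] : exists2 B, G B & B p.
    by have : (\bigcup_(B in G) B) p by rewrite covG.
  exists B => //; split => //; rewrite -subset0 => q [Bq [B' [n _ rB'] B'q]].
  apply: nUp; exists B => //; exists n.+1 => //; exists B' => //.
  by split => //; exists q.
by move=> B [n _ /reachG/refG[A [c ac ->] Bc]]; exists c.
Qed.

End Manifold.

(** * Resolutions in terms of the two pulled back coordinates *)

(** The target has a single chart [z], with open range. The hypotheses on [C] and [f] are
    those that the smooth, real analytic and holomorphic cases share. *)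
Section Resolution.
Context {R : realType} {K : numFieldType} (N : abs_field R K) (null : null_ideal N).
Variables (C : regularity K) (S : bivector_manifold K 2).
Variables (T : topologicalType) (z : T -> 'rV[K]_2) (f : 'rV[K]_2 -> K).
Variable phi : S -> planar_poisson z f.
Hypothesis res : symplectic_resolution C phi.
Hypothesis open_range : open (range z).
Hypothesis coord_regular : forall (i : 'I_2) F,
  (forall u, range z u -> F u = u 0 i) -> C (range z) F.
Hypothesis C_Ck : forall (U : set 'rV[K]_2) F, open U -> C U F -> Ck 3 U F.
Hypothesis f_vanish : forall q, z q 0 0 = 0 -> exists B : R,
  nbhs (z q) [set v | range z v -> N (f v) <= B * N (v 0 0)].
Implicit Types (c : chart K 2 S) (p : S).

Let mS : is_manifold C S. Proof. by case: res => [[[]]]. Qed.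

Definition pull_coord (i : 'I_2) (p : S) : K := z (phi p) 0 i.
Notation X := (pull_coord 0).
Notation Y := (pull_coord 1).

Notation d := (Chart [set: T] z).

Lemma bracket2 (M : bivector_manifold K 2) (c : chart K 2 M) (F G : M -> K) (p : M) :
  (biv c p)^T = - biv c p ->
  bracket c F G p =
    biv c p 0 1 * jacobian (local_expr c F) (local_expr c G) (chart_map c p).
Proof.
move=> skew.
have b10 : biv c p 1 0 = - biv c p 0 1.
  by have /matrixP/(_ 0 1) := skew; rewrite !mxE.
have b00 i : biv c p i i = 0.
  have /matrixP/(_ i i) := skew; rewrite !mxE => /eqP.
  by rewrite -addr_eq0 -mulr2n mulrn_eq0 /= => /eqP.
rewrite /bracket !(sum2 0) /= b10 !b00 /jacobian /swap2 /= {b10 b00 skew}.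
move: (biv c p 0 1) (partial 0 (local_expr c F) _) (partial 1 (local_expr c F) _)
  (partial 0 (local_expr c G) _) (partial 1 (local_expr c G) _) => *; ring.
Qed.

Lemma coord_partial (q : T) (i j : 'I_2) :
  partial j (local_expr d (fun q : T => z q 0 i)) (z q) = (i == j)%:R.
Proof.
apply: (has_partial_eq (N := N)) => e e0.
have dE u : range z u -> local_expr d (fun q : T => z q 0 i) u = u 0 i.
  move=> [q' _ <-]; rewrite /local_expr; case: pselect => [ex|[]]; last by exists q'.
  by case: (cid ex) => q2 [_ /= ->].
have /(nbhs_row N)[r r0 rP] : nbhs (z q) (range z).
  by apply: open_nbhs_nbhs; split => //; exists q.
exists r => // t tr; rewrite !dE; last 2 first.
- by exists q.
- apply: rP => k; rewrite moveE addrC addKr.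
  by case: (_ == _); rewrite ?mulr0n ?absf0.
rewrite moveE [z q 0 i + _]addrC addrK mulr_natr subrr absf0.
by rewrite mulr_ge0 ?absf_ge0// ltW.
Qed.

(** Compatibility of [phi] with the bracket of the two coordinates, read in a chart. *)
Lemma resolution_bracket c p : atlas c -> chart_dom c p ->
  biv c p 0 1 != 0 /\
  biv c p 0 1 * jacobian (local_expr c X) (local_expr c Y) (chart_map c p) =
    f (z (phi p)).
Proof.
move=> ac cp; have [[[_ skew _ _ _] unit_biv] [_ morph] _] := res.
split.
  have := unit_biv c p ac cp; rewrite unitmxE unitfE; apply: contra => /eqP b01.
  have /matrixP s := skew c p ac cp.
  have b10 : biv c p 1 0 = 0 by have := s 0 1; rewrite !mxE b01 oppr0.
  have b00 : biv c p 0 0 = 0.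
    have := s 0 0; rewrite !mxE => /eqP.
    by rewrite -addr_eq0 -mulr2n mulrn_eq0 /= => /eqP.
  rewrite (expand_det_row _ 0) big1// => k _.
  by case: (ord2P k) => ->; rewrite ?b00 ?b01 mul0r.
have reg i : regular_fun C [set: planar_poisson z f] (fun q : planar_poisson z f => z q 0 i).
  move=> c' ->; rewrite /= setTI; apply: (coord_regular (i := i)) => u [q _ <-].
  rewrite /local_expr; case: pselect => [ex|[]]; last by exists q.
  by case: (cid ex) => q2 [_ /= ->].
have := morph setT _ _ openT (reg 0) (reg 1) c d p ac erefl cp I I.
rewrite bracket2; last exact: skew.
rewrite bracket2 => [->|]; last first.
  by rewrite /= linearZ linearB /= !trmx_delta -scalerN opprB.
rewrite /= !mxE /= subr0 mulr1 /jacobian !coord_partial /=.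
by rewrite mulr1 mul0r subr0 mulr1.
Qed.

Lemma pull_coord_regular c i : atlas c -> C (chart_image c) (local_expr c (pull_coord i)).
Proof.
move=> ac; have [_ [[_ reg] _] _] := res.
by have := reg d i erefl c ac; rewrite /= preimage_setT setIT.
Qed.

Lemma pull_coordE c i p : atlas c -> chart_dom c p ->
  local_expr c (pull_coord i) (chart_map c p) = pull_coord i p.
Proof. by move=> ac cp; rewrite (local_exprE mS). Qed.

(** The coefficient of the bivector is bounded below near [p] by continuity, and [f] is
    [O(|x|)]. *)
Lemma jacobian_small c p : atlas c -> chart_dom c p -> X p = 0 -> exists B : R,
  nbhs (chart_map c p)
    [set v | N (jacobian (local_expr c X) (local_expr c Y) v) <= B * N (local_expr c X v)].
Proof.
move=> ac cp Xp; set u := chart_map c p.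
have oU := open_chart_image mS ac.
have Uu : chart_image c u by exists p.
have [B hB] := f_vanish Xp.
have cont i : {for u, continuous (local_expr c (pull_coord i))}.
  exact: Ck_continuous (C_Ck oU (pull_coord_regular i ac)) Uu.
have [b0 _] := resolution_bracket ac cp.
have contb : {for u, continuous (local_expr c (fun p => biv c p 0 1))}.
  have [[[_ _ reg _ _] _] _ _] := res.
  have := reg c 0 1 ac c ac; rewrite setIid => /(C_Ck oU) h.
  exact: Ck_continuous h Uu.
set m := N (biv c p 0 1).
have m0 : 0 < m by exact: absf_gt0.
have [r1 r10 h1] := proj1 (continuous_row N _ _) contb (m / 2) (divr_gt0 m0 (ltr0Sn _ 1)).
have [r2 r20 h2] := proj1 (nbhs_row N _ _) hB.
have [r3 r30 h3] := proj1 (continuous_row N _ _) (cont 0) r2 r20.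
have [r4 r40 h4] := proj1 (continuous_row N _ _) (cont 1) r2 r20.
exists (2 / m * B).
have hU : nbhs u (chart_image c) by exact: open_nbhs_nbhs.
have hr (r : R) : 0 < r -> nbhs u (box N u r) by exact: nbhs_box.
apply: filterS (nbhsI (nbhsI hU (hr r1 r10)) (nbhsI (hr r3 r30) (hr r4 r40))).
move=> _ [[[q cq <-] /h1 b1] [/h3 b3 /h4 b4]].
rewrite /= !(local_exprE mS)// in b1 b3 b4 *.
have [bq Jq] := resolution_bracket ac cq.
set J := jacobian _ _ _ in Jq *; set b := biv c q 0 1 in b1 bq Jq.
have b1' : m / 2 <= N b.
  by have := absf_dist N (biv c p 0 1) b; rewrite absfBC -/m; move: b1; rewrite -/m; lra.
have hf : N (f (z (phi q))) <= B * N (X q).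
  apply: h2; last by exists (phi q).
  by move=> k; case: (ord2P k) => ->.
have -> : 2 / m * B * N (X q) = 2 * (B * N (X q)) / m by ring.
rewrite ler_pdivlMr//.
rewrite -Jq absfM in hf.
have : m / 2 * N J <= N b * N J by rewrite ler_wpM2r ?absf_ge0.
by lra.
Qed.

(** ** The connected case *)

Section Connected.
Hypothesis C_isolated : forall (U : set 'rV[K]_2) F, open U -> C U F ->
  isolated_zeros N U F.
Hypothesis range0 : range z 0.
Hypothesis conS : connected [set: S].

(** The interior of the zero set of [X] is closed by [zero_on_box]; if it were nonempty, [X]
    would vanish identically, and points of the plane off the axis would not be reached. *)
Lemma zero_locus_thin p : ~ nbhs p [set q | X q = 0].
Proof.
move=> hp; pose D := [set p : S | nbhs p [set q | X q = 0]].
suff DT : D = [set: S].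
  have /(nbhs_row N)[r r0 rP] : nbhs (0 : 'rV[K]_2) (range z) by exact: open_nbhs_nbhs.
  have [t t0 tr] := absf_small N r0.
  have [|q _ zq] := rP (\row_k (if k == 0 then t else 0)).
    by move=> k; rewrite !mxE subr0; case: (k == 0); rewrite ?absf0.
  have [_ _ surj] := res; have [p' ep'] := surj q.
  have : D p' by rewrite DT.
  by move=> /nbhs_singleton/=; rewrite /pull_coord ep' zq mxE /= => /eqP; exact/negP.
apply: conS; first by exists p.
  exists D; last by rewrite setTI.
  by rewrite openE => q /nbhs_interior.
exists D; last by rewrite setTI.
move=> q clq; have [c ac cq] : exists2 c, atlas c & chart_dom c q by case: mS => _ _ _ + _; exact.
have oU := open_chart_image mS ac; have IZ := C_isolated oU (pull_coord_regular 0 ac).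
have [r r0 rU] : exists2 r : R, 0 < r & box N (chart_map c q) r `<=` chart_image c.
  by apply/(nbhs_row N); apply: open_nbhs_nbhs; split => //; exists q.
have hq := chart_preimage_nbhs mS ac cq (nbhs_box N (chart_map c q) r0).
have [q' [Dq' [cq' bq']]] := clq _ hq.
have zero := zero_on_box IZ rU bq'.
have {}zero v : box N (chart_map c q) r v -> local_expr c X v = 0.
  apply: zero; apply: filterS (chart_image_nbhs mS ac cq' Dq').
  by move=> _ [q2 [cq2 Xq2] <-] /=; rewrite pull_coordE.
by apply: filterS hq => q2 [cq2 /zero]; rewrite /= pull_coordE.
Qed.

(** [zero_set_null] in countably many charts shows that [Y] takes a null set of values on
    the zeros of [X], although all points [(0, y)] near the origin are reached. *)
Theorem no_connected_resolution : False.
Proof.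
have [H [cH covH chartH]] := countable_charts null mS conS.
have : null (Y @` [set p | X p = 0]).
  apply: (@nullS _ _ _ null _ (\bigcup_(B in H) Y @` [set p | B p /\ X p = 0])).
    by move=> _ [p Xp <-]; have [B HB Bp] := covH p; exists B => //; exists p.
  apply: null_big => // B /chartH[c ac Bc].
  have oU := open_chart_image mS ac.
  have := @zero_set_null _ _ N null (chart_image c) (local_expr c X) (local_expr c Y) oU
    (CkW (C_Ck oU (pull_coord_regular 0 ac))) (C_Ck oU (pull_coord_regular 1 ac)).
  move=> h; apply: nullS (h _ (C_isolated oU (pull_coord_regular 0 ac)) _).
  - move=> _ [p [/Bc cp Xp] <-]; exists (chart_map c p); last by rewrite pull_coordE.
    by split; [exists p|rewrite pull_coordE].
  - by move=> _ [p cp <-]; rewrite pull_coordE// => Xp; exact: jacobian_small.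
  move=> _ [p cp <-] /(chart_preimage_nbhs mS ac cp) h'.
  apply: (@zero_locus_thin p); apply: filterS h' => q [cq /=].
  by rewrite pull_coordE.
apply: (@null_nbhs _ _ _ null 0).
have /(nbhs_row N)[r r0 rP] : nbhs (0 : 'rV[K]_2) (range z) by exact: open_nbhs_nbhs.
apply/(absf_nbhs N); exists r => // y; rewrite subr0 => yr.
have [|q _ zq] := rP (\row_k (if k == 0 then 0 else y)).
  by move=> k; rewrite !mxE subr0; case: (k == 0); rewrite ?absf0.
have [_ _ surj] := res; have [p ep] := surj q.
by exists p; rewrite /= /pull_coord ep zq !mxE.
Qed.

End Connected.

(** ** The proper case *)

(** Otherwise the points [q] close to [p] would be on the level of [Y] through [p], on which
    [X] vanishes. *)
Lemma critical_cluster c p : atlas c -> chart_dom c p -> X p = 0 ->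
  (forall W, nbhs p W -> exists q, [/\ W q, X q != 0 & Y q = Y p]) ->
  critical (local_expr c Y) (chart_map c p).
Proof.
move=> ac cp Xp h; apply: contrapT => /existsNP[j /eqP Yj].
have oU := open_chart_image mS ac.
have [B hB] := jacobian_small ac cp Xp.
have [|r /andP[r0 _] [_ _ [_ LT _]]] := regular_level ltr01 oU _
  (CkW (C_Ck oU (pull_coord_regular 0 ac))) (CkW (C_Ck oU (pull_coord_regular 1 ac))) Yj hB.
  by exists p.
have hq := chart_preimage_nbhs mS ac cp (nbhs_box N (chart_map c p) r0).
have [q [[cq bq] Xq Yq]] := h _ hq.
move/eqP: Xq; apply.
rewrite -(pull_coordE 0 ac cq); apply: (LT (chart_map c p)) => //.
- exact: box_center.
- by rewrite !pull_coordE.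
- by rewrite pull_coordE.
Qed.

(** All charts at [p] are considered, so that [null_critical] can use any of them. *)
Definition critical_locus : set S := [set p | forall c, atlas c -> chart_dom c p ->
  critical (local_expr c Y) (chart_map c p)].

(** Compactness reduces to the domain of one chart. *)
Lemma null_critical (A : set S) : compact A -> null (Y @` (A `&` critical_locus)).
Proof.
move=> cA; apply: (@compact_ideal _ (fun B => null (Y @` (B `&` critical_locus))) A) => //.
- by rewrite set0I image_set0; exact: null0.
- by move=> B B' nB nB'; rewrite setIUl image_setU; exact: null_setU.
- by move=> B B' BB'; apply: nullS; apply: image_subset; exact: setSI.
move=> p Ap; have [c ac cp] : exists2 c, atlas c & chart_dom c p by case: mS => _ _ _ + _; exact.
exists (chart_dom c).
  by apply: open_nbhs_nbhs; split => //; have [_ _ /(_ c ac)[]] := mS.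
have oU := open_chart_image mS ac.
apply: nullS (sard null oU (C_Ck oU (pull_coord_regular 1 ac))).
move=> _ [q [cq crq] <-]; exists (chart_map c q); last by rewrite pull_coordE.
by split; [exists q|exact: crq].
Qed.

End Resolution.

(** * The real field *)

Section RealAbs.
Context {R : realType}.

Lemma nbhs_real (x : R) (A : set R) : nbhs x A <->
  exists2 r : R, 0 < r & forall y, `|y - x| < r -> A y.
Proof.
split=> [/nbhs_ballP[r r0 rP]|[r r0 rP]].
  by exists r => // y yx; apply: rP; rewrite /ball /= distrC.
by apply/nbhs_ballP; exists r => // y; rewrite /ball /= distrC; exact: rP.
Qed.

Lemma real_complete (u : nat -> R) :
  (forall e : R, 0 < e -> exists n0, forall m n, (n0 <= m)%N -> (n0 <= n)%N ->
     `|u m - u n| < e) ->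
  exists l, forall e : R, 0 < e -> exists n0, forall n, (n0 <= n)%N -> `|u n - l| < e.
Proof.
move=> h.
have /cvg_ex[l hl] : cvg (u @ \oo).
  apply: cauchy_cvg; apply: cauchy_exP => e e0.
  have [n0 hn0] := h e e0; exists (u n0); exists n0 => // n /= nn.
  by rewrite /ball /=; exact: hn0.
exists l => e e0.
have [n0 _ hn0] : \forall n \near \oo, `|l - u n| < e.
  by move/cvgrPdist_lt : hl => /(_ e e0).
by exists n0 => n nn; rewrite distrC; exact: hn0.
Qed.

Lemma real_mvi (h h' : R -> R) (a b B : R) : a <= b ->
  (forall x, a <= x <= b -> has_diff (fun x : R => `|x|) h x (h' x) /\ `|h' x| <= B) ->
  `|h b - h a| <= B * (b - a).
Proof.
move=> ab hh.
have hd x : a <= x <= b -> is_derive x (1 : R) h (h' x).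
  move=> /hh[hx _]; apply: (proj1 (has_diff_derive (@normr_ge0 _ R) (@normr0_eq0 _ R)
    (normr0 R) (@normrM R) nbhs_real _ _ _) hx).
have [||c] := @MVT_segment R h h' a b ab.
- by move=> x; rewrite in_itv /= => /andP[ax xb]; apply: hd; rewrite !ltW.
- apply: continuous_in_subspaceT => x; rewrite inE /= in_itv /= => /hd[dh _].
  by apply/differentiable_continuous/derivable1_diffP.
rewrite in_itv /= => /hh[_ hB] ->.
by rewrite normrM [`|b - a|]ger0_norm ?subr_ge0// ler_wpM2r// subr_ge0.
Qed.

Lemma real_absf_mvi (h h' : R -> R) (a b B : R) :
  (forall z, `|z - a| <= `|b - a| ->
     has_diff (fun x : R => `|x|) h z (h' z) /\ `|h' z| <= B) ->
  `|h b - h a| <= 2 * B * `|b - a|.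
Proof.
move=> hh.
have B0 : 0 <= B.
  by have [|_] := hh a; [rewrite subrr normr0|move/(le_trans _); apply].
have [ab|ba] := leP a b.
  have ab0 : 0 <= b - a by rewrite subr_ge0.
  have := @real_mvi h h' a b B ab; rewrite [`|b - a|]ger0_norm//.
  have : 0 <= B * (b - a) by rewrite mulr_ge0.
  move=> p1 p2; apply: le_trans (p2 _) _; last by move: p1; lra.
  move=> x /andP[ax xb]; apply: hh.
  by rewrite ger0_norm ?subr_ge0// ger0_norm// lerD2r.
have ab0 : 0 <= a - b by rewrite subr_ge0 ltW.
have := @real_mvi h h' b a B (ltW ba); rewrite distrC [`|b - a|]distrC [`|a - b|]ger0_norm//.
have : 0 <= B * (a - b) by rewrite mulr_ge0.
move=> p1 p2; apply: le_trans (p2 _) _; last by move: p1; lra.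
move=> x /andP[ax xb]; apply: hh.
rewrite [`|x - a|]distrC [`|b - a|]distrC ger0_norm ?subr_ge0// ger0_norm//.
by rewrite lerD2l lerN2.
Qed.

(** Transparent, so that [real_abs x] is convertible to the norm of [x]. *)
Definition real_abs : abs_field R R.
Proof.
refine (@AbsField R R (fun x => `|x|) (@normr_ge0 _ _) _ (@normrM _)
  (@ler_normD _ _) (@normr_nat _) nbhs_real real_complete _ real_absf_mvi).
- by move=> x /normr0_eq0.
- by exists id; split.
Defined.

Lemma negligible_small d (T : measurableType d) (mu : {measure set T -> \bar R})
    (A : set T) (B : R) :
  (forall m, (0 < m)%N -> exists2 D, measurable D & A `<=` D /\ (mu D <= (B / m%:R)%:E)%E) ->
  mu.-negligible A.
Proof.
move=> h.
have /choice[D hD] : forall m, exists D, [/\ measurable D, A `<=` D &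
    (mu D <= (B / m.+1%:R)%:E)%E].
  by move=> m; have [D mD [AD muD]] := h m.+1 isT; exists D.
exists (\bigcap_m D m); split.
- by apply: bigcap_measurable => // m _; have [] := hD m.
- apply/eqP; rewrite eq_le measure_ge0 andbT.
  apply/lee_addgt0Pr => e e0; rewrite add0e.
  have [m m0 hm] := absf_arch B e0.
  have [mD _ muD] := hD m.-1; rewrite prednK// in muD.
  apply: (@le_trans _ _ (mu (D m.-1))).
    apply: le_measure; rewrite ?inE//; last exact: bigcap_inf.
    by apply: bigcap_measurable => // k _; have [] := hD k.
  by rewrite (le_trans muD)// lee_fin ltW.
by move=> x Ax m _; have [_ AD _] := hD m; exact: AD.
Qed.

(** [B m^(n k)] balls of measure [O(m^-(n (k + 1)))] have total measure [O(m^-n)]. *)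
Lemma negligible_cover d (T : measurableType d) (mu : {measure set T -> \bar R})
    (K : choiceType) (ball : K -> R -> set T) (A : set T) (c B : R) (n k : nat) :
  0 <= c -> (0 < n)%N ->
  (forall w r, 0 <= r -> measurable (ball w r) /\ (mu (ball w r) <= (c * r ^+ n)%:E)%E) ->
  (forall m, (0 < m)%N -> exists s : seq K,
      (size s)%:R <= B * m%:R ^+ (n * k) /\
      forall y, A y -> exists2 w, w \in s & ball w (B / m%:R ^+ k.+1) y) ->
  mu.-negligible A.
Proof.
move=> c0 n0 hball hcov; apply: (@negligible_small _ _ _ _ (c * B ^+ n.+1)) => m m0.
have mR : (0 : R) < m%:R by rewrite ltr0n.
have [s [sB sA]] := hcov m m0.
have B0 : 0 <= B.
  by rewrite -(@pmulr_lge0 _ (m%:R ^+ (n * k))) ?exprn_gt0// (le_trans _ sB).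
set r := B / m%:R ^+ k.+1 in sA.
have r0 : 0 <= r by rewrite divr_ge0// exprn_ge0// ltW.
exists (\big[setU/set0]_(w <- s) ball w r).
  by apply: bigsetU_measurable => w _; have [] := hball w r r0.
split.
  move=> y /sA[w ws yw]; rewrite -bigcup_seq; exists w => //.
have : (mu (\big[setU/set0]_(w <- s) ball w r) <= ((size s)%:R * (c * r ^+ n))%:E)%E.
  elim: s {sB sA} => [|w s IH]; first by rewrite big_nil measure0 mul0r.
  have [mw muw] := hball w r r0; rewrite big_cons.
  apply: le_trans (measureU2 _ _ _) _ => //.
    by apply: bigsetU_measurable => w' _; have [] := hball w' r r0.
  by rewrite /= -natr1 mulrDl mul1r addrC EFinD leeD.
move=> /le_trans; apply; rewrite lee_fin.
apply: (@le_trans _ _ (B * m%:R ^+ (n * k) * (c * r ^+ n))).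
  by rewrite ler_wpM2r// mulr_ge0// exprn_ge0.
have -> : B * m%:R ^+ (n * k) * (c * r ^+ n) = c * B ^+ n.+1 / m%:R ^+ n.
  rewrite /r expr_div_n -exprM mulSn exprD [(k * n)%N]mulnC exprS.
  by field; rewrite !expf_neq0// lt0r_neq0.
rewrite ler_wpM2l ?mulr_ge0 ?exprn_ge0// lef_pV2 ?posrE ?exprn_gt0//.
by rewrite -[leLHS]expr1 ler_weXn2l// ler1n.
Qed.

Lemma real_grid m : (0 < m)%N -> exists s : seq R,
  (size s)%:R <= 3 * m%:R :> R /\
  forall x : R, `|x| <= 1 -> exists2 w, w \in s & `|x - w| <= m%:R^-1.
Proof.
move=> m0; have mR : (0 : R) < m%:R by rewrite ltr0n.
exists [seq k%:R / m%:R - 1 | k <- iota 0 (2 * m).+1]; split.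
  rewrite size_map size_iota -natr1 natrM.
  have : (1 : R) <= m%:R by rewrite ler1n.
  by lra.
move=> x; rewrite ler_norml => /andP[x1 x2].
have x0 : 0 <= (x + 1) * m%:R by rewrite mulr_ge0 ?ler0n//; move: x1; lra.
have /andP[k1 k2] := truncn_itv x0; set k := Num.truncn _ in k1 k2.
exists (k%:R / m%:R - 1).
  apply/mapP; exists k => //; rewrite mem_iota /= add0n ltnS.
  rewrite -(@ler_nat R) natrM (le_trans k1)// ler_wpM2r ?ler0n//; move: x2; lra.
have -> : x - (k%:R / m%:R - 1) = ((x + 1) * m%:R - k%:R) / m%:R.
  by field; exact: lt0r_neq0.
rewrite ger0_norm; last by rewrite divr_ge0 ?subr_ge0// ltW.
rewrite ler_pdivrMr// mulVf ?lt0r_neq0// lerBlDr.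
by move: k2; rewrite -natr1; lra.
Qed.

Lemma real_dense : exists e : nat -> R, forall (x r : R), 0 < r ->
  exists n, `|e n - x| < r.
Proof.
exists (fun n => if unpickle n is Some q then ratr (q : rat) else 0) => x r r0.
have /rat_in_itvoo[q /itvP qx] : x < x + r by rewrite ltrDl.
exists (pickle q); rewrite pickleK gtr0_norm ?subr_gt0 ?qx//.
by rewrite ltrBlDl qx.
Qed.

Definition real_null : null_ideal real_abs.
Proof.
refine (@NullIdeal R R real_abs (fun A => (@lebesgue_measure R).-negligible A) 1
  _ _ _ _ _ real_dense).
- by move=> A B AB; apply: negligibleS.
- by move=> A; exact: negligible_bigcup.
- move=> A B k h.
  apply: (@negligible_cover _ _ (@lebesgue_measure R) R (fun w r => `[w - r, w + r]%classic)
     A 2 B 1 k) => //.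
    move=> w r r0; split; first exact: measurable_itv.
    rewrite /= lebesgue_measure_itv /= lte_fin; case: ifP => _.
      by rewrite -EFinD lee_fin expr1; lra.
    by rewrite lee_fin mulr_ge0.
  move=> m /h[s [s1 s2]]; exists s; split=> // y /s2[w ws wy]; exists w => //.
  by rewrite /= in_itv /= -ler_distl.
- move=> x A /nbhs_real[r r0 rA] nA.
  have : (@lebesgue_measure R).-negligible `]x - r, x + r[%classic.
    apply: negligibleS nA => y; rewrite /= in_itv /= -ltr_distl; exact: rA.
  move=> nB; have := @measure_negligible _ _ _ (@lebesgue_measure R) _ (measurable_itv `]x - r, x + r[) nB.
  rewrite /= lebesgue_measure_itv /= lte_fin ltrBlDr -addrA ltrDl addr_gt0//.
  rewrite -EFinD => /eqP; rewrite eqe => /eqP; move: r0; lra.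
exists 3 => m /real_grid[s [s1 s2]]; by exists s.
Defined.

End RealAbs.

(** * The complex field *)

Section ComplexAbs.
Import ComplexField.Normc.
Local Open Scope complex_scope.
Context {R : realType}.
Local Notation C := (Cplx R).

(** The modulus as a real number: the norm on [Cplx R] takes its values in [Cplx R]. *)
Definition cabs (z : C) : R := normc (z : R[i]).
Definition cre (z : C) : R := complex.Re (z : R[i]).
Definition cim (z : C) : R := complex.Im (z : R[i]).
Definition cmk (a b : R) : C := (a +i* b : R[i]).

Lemma cabsE z : cabs z = Num.sqrt (cre z ^+ 2 + cim z ^+ 2).
Proof. by rewrite /cabs; case: z. Qed.

Lemma cabsC z : (cabs z)%:C = `|z| :> C.
Proof. by rewrite normc_def cabsE. Qed.

Lemma cre_le z : `|cre z| <= cabs z.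
Proof.
rewrite cabsE -sqrtr_sqr; apply: ler_wsqrtr; rewrite lerDl; exact: sqr_ge0.
Qed.

Lemma cim_le z : `|cim z| <= cabs z.
Proof.
rewrite cabsE -sqrtr_sqr; apply: ler_wsqrtr; rewrite lerDr; exact: sqr_ge0.
Qed.

Lemma cabs_le z : cabs z <= `|cre z| + `|cim z|.
Proof.
rewrite cabsE -[leRHS]ger0_norm ?addr_ge0// -sqrtr_sqr; apply: ler_wsqrtr.
rewrite sqrrD !real_normK ?num_real// -addrA lerD2l lerDr.
by rewrite mulrn_wge0// mulr_ge0.
Qed.

Lemma creB z w : cre (z - w) = cre z - cre w.
Proof. by case: z; case: w. Qed.

Lemma cimB z w : cim (z - w) = cim z - cim w.
Proof. by case: z; case: w. Qed.

Lemma creM z w : cre (z * w) = cre z * cre w - cim z * cim w.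
Proof. by case: z => a b; case: w. Qed.

Lemma cimM z w : cim (z * w) = cre z * cim w + cim z * cre w.
Proof. by case: z => a b; case: w => c d; rewrite /= /cim /=; ring. Qed.

Lemma cabs_ge0 z : 0 <= cabs z.
Proof. by rewrite cabsE sqrtr_ge0. Qed.

Lemma cabs_eq0 z : cabs z = 0 -> z = 0.
Proof. exact: eq0_normc. Qed.

Lemma cabsM z w : cabs (z * w) = cabs z * cabs w.
Proof. exact: normcM. Qed.

Lemma cabsD z w : cabs (z + w) <= cabs z + cabs w.
Proof. exact: le_normcD. Qed.

Lemma cabs_real (a : R) : cabs (cmk a 0) = `|a|.
Proof. by rewrite cabsE /cre /cim /= expr0n addr0 sqrtr_sqr. Qed.

Lemma cmk_nat n : cmk n%:R 0 = n%:R.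
Proof. exact: (rmorph_nat (real_complex R)). Qed.

Lemma cabs_nat (n : nat) : cabs n%:R = n%:R.
Proof. by rewrite -cmk_nat cabs_real normr_nat. Qed.

Lemma nbhs_cplx (z : C) (A : set C) : nbhs z A <->
  exists2 r : R, 0 < r & forall w, cabs (w - z) < r -> A w.
Proof.
split=> [/nbhs_ballP[r r0 rP]|[r r0 rP]].
  have rE : r = (cre r)%:C by apply/esym/RRe_real/gtr0_real.
  have r0' : 0 < cre r by have : 0 < (r : R[i]) := r0; rewrite ltcE /= => /andP[].
  exists (cre r) => // w wz; apply: rP.
  by rewrite /ball /= distrC -cabsC rE ltcR.
apply/nbhs_ballP; exists r%:C; first by rewrite /= ltcE /= eqxx.
by move=> w; rewrite /ball /= distrC -cabsC ltcR; exact: rP.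
Qed.

Lemma cplx_complete (u : nat -> C) :
  (forall e : R, 0 < e -> exists n0, forall m n, (n0 <= m)%N -> (n0 <= n)%N ->
     cabs (u m - u n) < e) ->
  exists l, forall e : R, 0 < e -> exists n0, forall n, (n0 <= n)%N -> cabs (u n - l) < e.
Proof.
move=> h.
have [|a ha] := @real_complete R (cre \o u).
  move=> e e0; have [n0 hn] := h e e0; exists n0 => m n hm hn'.
  by rewrite /= -creB (le_lt_trans (cre_le _))// hn.
have [|b hb] := @real_complete R (cim \o u).
  move=> e e0; have [n0 hn] := h e e0; exists n0 => m n hm hn'.
  by rewrite /= -cimB (le_lt_trans (cim_le _))// hn.
exists (cmk a b) => e e0; have e2 : 0 < e / 2 by rewrite divr_gt0.
have [n1 h1] := ha _ e2; have [n2 h2] := hb _ e2.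
exists (maxn n1 n2) => n; rewrite geq_max => /andP[/h1 k1 /h2 k2].
apply: le_lt_trans (cabs_le _) _; rewrite creB cimB /=.
by move: k1 k2; rewrite /= /cre /cim /=; lra.
Qed.

(** The real inequality on the segment from [a] to [b], for the real and the imaginary part
    of [h]. *)
Lemma cplx_mvi (h h' : C -> C) (a b : C) (B : R) :
  (forall z, cabs (z - a) <= cabs (b - a) -> has_diff cabs h z (h' z) /\ cabs (h' z) <= B) ->
  cabs (h b - h a) <= 2 * B * cabs (b - a).
Proof.
move=> hh.
pose g (s : R) : C := a + cmk s 0 * (b - a).
have gB s t : g (s + t) = g s + cmk t 0 * (b - a).
  rewrite /g -addrA -mulrDl; congr (_ + _ * _).
  by rewrite /cmk; simpc.
have g0 : g 0 = a by rewrite /g mul0r addr0.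
have g1 : g 1 = b by rewrite /g mul1r addrC subrK.
have gin s : 0 <= s <= 1 -> cabs (g s - a) <= cabs (b - a).
  move=> /andP[s0 s1]; rewrite /g addrC addKr cabsM cabs_real ger0_norm//.
  by rewrite ler_piMl// cabs_ge0.
have key (p : C -> R) : (forall z w, p (z - w) = p z - p w) -> (forall z, `|p z| <= cabs z) ->
   (forall s z, p (cmk s 0 * z) = s * p z) -> `|p (h b) - p (h a)| <= B * cabs (b - a).
  move=> pB pN pZ.
  have := @real_mvi R (p \o h \o g) (fun s => p (h' (g s) * (b - a))) 0 1 (B * cabs (b - a)).
  rewrite ler01 /= g0 g1 subr0 mulr1 => /(_ isT); apply => s s01.
  have [hd hB] := hh _ (gin s s01); split; last first.
    by rewrite (le_trans (pN _))// cabsM ler_wpM2r// cabs_ge0.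
  move=> e e0; have e' : 0 < e / (cabs (b - a) + 1) by rewrite divr_gt0// ltr_wpDl// cabs_ge0.
  have [r r0 rP] := hd _ e'.
  have c1 : 0 < cabs (b - a) + 1 by rewrite ltr_wpDl// cabs_ge0.
  exists (r / (cabs (b - a) + 1)); first by rewrite divr_gt0.
  move=> t; rewrite ltr_pdivlMr// => tr.
  have tr' : cabs (cmk t 0 * (b - a)) < r.
    rewrite cabsM cabs_real (le_lt_trans _ tr)// ler_wpM2l// lerDl ler01//.
  have := rP _ tr'; rewrite -gB => hr.
  have -> : p (h (g (s + t))) - p (h (g s)) - t * p (h' (g s) * (b - a)) =
      p (h (g (s + t)) - h (g s) - cmk t 0 * (b - a) * h' (g s)).
    by rewrite !pB -pZ [h' _ * _]mulrC mulrA.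
  rewrite (le_trans (pN _))// (le_trans hr)// cabsM cabs_real.
  have -> : e / (cabs (b - a) + 1) * (`|t| * cabs (b - a)) =
      e * `|t| * (cabs (b - a) / (cabs (b - a) + 1)) by field; exact: lt0r_neq0.
  rewrite ler_piMr//; first by rewrite mulr_ge0 ?(ltW e0).
  by rewrite ler_pdivrMr// mul1r lerDl ler01.
apply: le_trans (cabs_le _) _; rewrite creB cimB.
have k1 : `|cre (h b) - cre (h a)| <= B * cabs (b - a).
  apply: key; [exact: creB|exact: cre_le|].
  by move=> s z; rewrite creM /= /cim /= mul0r subr0.
have k2 : `|cim (h b) - cim (h a)| <= B * cabs (b - a).
  apply: key; [exact: cimB|exact: cim_le|].
  by move=> s z; rewrite cimM /= /cim /= mul0r addr0.
by move: k1 k2; lra.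
Qed.

Definition cplx_abs : abs_field R C.
Proof.
refine (@AbsField R C cabs cabs_ge0 cabs_eq0 cabsM cabsD cabs_nat nbhs_cplx
  cplx_complete _ cplx_mvi).
exists (fun s => cmk s 0); split => // s t.
by rewrite -cabs_real; congr (cabs _); rewrite /cmk; simpc.
Defined.

Let mu := ((@lebesgue_measure R) \x (@lebesgue_measure R))%E.
Let square (w : C) (r : R) : set (R * R) :=
  `[cre w - r, cre w + r]%classic `*` `[cim w - r, cim w + r]%classic.

Lemma square_measure w r : 0 <= r ->
  measurable (square w r) /\ (mu (square w r) <= (4 * r ^+ 2)%:E)%E.
Proof.
move=> r0; split; first by apply: measurableX; exact: measurable_itv.
rewrite /mu /square product_measure1E; [|exact: measurable_itv..].
have itv (a : R) : lebesgue_measure `[a - r, a + r]%classic = (2 * r)%:E.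
  rewrite lebesgue_measure_itv /= lte_fin ltrBlDr -addrA ltrDl.
  case: ifPn => [_|]; first by rewrite -EFinD; congr EFin; ring.
  by rewrite -leNgt => r0'; congr EFin; move: r0 r0'; lra.
rewrite [X in (X * _)%E](itv (cre w)) [X in (_ * X)%E](itv (cim w)) -EFinM lee_fin; lra.
Qed.

Lemma open_square_measure (x y r : R) : 0 < r ->
  ~ mu.-negligible (`]x - r, x + r[%classic `*` `]y - r, y + r[%classic).
Proof.
move=> r0 nA.
set A := `]x - r, x + r[%classic in nA; set B := `]y - r, y + r[%classic in nA.
have mA : measurable A by exact: measurable_itv.
have mB : measurable B by exact: measurable_itv.
have h0 : mu (A `*` B) = 0%E := @measure_negligible _ _ _ mu _ (measurableX mA mB) nA.
have h1 : mu (A `*` B) = (lebesgue_measure A * lebesgue_measure B)%E.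
  exact: product_measure1E.
have := etrans (esym h1) h0; rewrite /A /B.
rewrite /= !lebesgue_measure_itv /= !lte_fin !ltrBlDr -!addrA !ltrDl addr_gt0//.
rewrite -!EFinD -EFinM => /eqP; rewrite eqe => /eqP /esym.
have : 0 < (r + r) * (r + r) by rewrite mulr_gt0// addr_gt0.
by move=> h; move: (h); lra.
Qed.

Definition cplx_null : null_ideal cplx_abs.
Proof.
refine (@NullIdeal R C cplx_abs
  (fun A => mu.-negligible [set x : R * R | A (cmk x.1 x.2)]) 2 _ _ _ _ _ _).
- by move=> A B AB; apply: negligibleS => x; exact: AB.
- move=> A h; apply: negligibleS (negligible_bigcup h).
  by move=> x [n _ Ax]; exists n.
- move=> A B k h.
  apply: (@negligible_cover _ _ _ mu C square _ 4 B 2 k) => //; first exact: square_measure.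
  move=> m /h[s [s1 s2]]; exists s; split=> // x /s2[w ws wx]; exists w => //.
  split; rewrite /= in_itv /= -ler_distl (le_trans _ wx)//.
    by have := cre_le (cmk x.1 x.2 - w); rewrite creB.
  by have := cim_le (cmk x.1 x.2 - w); rewrite cimB.
- move=> z A /nbhs_cplx[r r0 rA] nA.
  have r2 : 0 < r / 2 by rewrite divr_gt0.
  apply: (@open_square_measure (cre z) (cim z) _ r2); apply: negligibleS nA.
  move=> [a b] [] /=; rewrite !in_itv /= -!ltr_distl => h1 h2; apply: rA.
  apply: le_lt_trans (cabs_le _) _; rewrite creB cimB.
  by rewrite /cre /cim /= in h1 h2 *; lra.
(* A grid of mesh [1 / (2 m)] in each real coordinate: at most [6 m] points each. *)
- exists 36 => m m0; have m2 : (0 < 2 * m)%N by rewrite muln_gt0.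
  have mR : (0 : R) < m%:R by rewrite ltr0n.
  have [s [s1 s2]] := @real_grid R _ m2.
  exists [seq cmk a b | a <- s, b <- s]; split.
    rewrite size_allpairs natrM; apply: le_trans (_ : (3 * (2 * m)%:R) * (3 * (2 * m)%:R) <= _).
      by apply: ler_pM.
    rewrite natrM; lra.
  move=> z z1.
  have [a sa ha] := s2 _ (le_trans (cre_le z) z1).
  have [b sb hb] := s2 _ (le_trans (cim_le z) z1).
  exists (cmk a b); first by apply/allpairsP; exists (a, b).
  apply: le_trans (cabs_le _) _; rewrite creB cimB.
  have e : ((2 * m)%:R : R)^-1 = m%:R^-1 / 2.
    by rewrite natrM; field; exact: lt0r_neq0.
  by move: ha hb; rewrite e /cre /cim /=; lra.
have [e he] := @real_dense R.
exists (fun n => if unpickle n is Some (a, b) then cmk (e a) (e b) else 0) => z r r0.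
have r2 : 0 < r / 2 by rewrite divr_gt0.
have [a ha] := he (cre z) _ r2; have [b hb] := he (cim z) _ r2.
exists (pickle (a, b)); rewrite pickleK.
apply: le_lt_trans (cabs_le _) _; rewrite creB cimB.
by move: ha hb; rewrite /cre /cim /=; lra.
Defined.

End ComplexAbs.
(* The modulus is handled through the lemmas above from here on. *)
Opaque cabs.

(** * Integrals over segments *)

Section SegmentIntegral.
Context {R : realType}.
Implicit Types (f g : R -> R) (a b c x y : R).

Definition seg_cont f a b := forall x, a <= x <= b -> forall e : R, 0 < e ->
  exists2 r : R, 0 < r & forall y, a <= y <= b -> `|y - x| < r -> `|f y - f x| < e.

Definition rint f a b : R := \int[@lebesgue_measure R]_(x in `[a, b]) f x.

Lemma seg_cont_integrable f a b : seg_cont f a b ->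
  (@lebesgue_measure R).-integrable `[a, b] (EFin \o f).
Proof.
move=> h; apply: continuous_compact_integrable; first exact: segment_compact.
apply/subspace_continuousP => x /=; rewrite in_itv /= => xab A /nbhs_real[e e0 eA].
have [r r0 rP] := h x xab e e0.
apply/nbhs_real; exists r => // y yx /=; rewrite in_itv /= => yab.
by apply: eA; exact: rP.
Qed.

Lemma rintD f g a b : seg_cont f a b -> seg_cont g a b ->
  rint (fun x => f x + g x) a b = rint f a b + rint g a b.
Proof.
by move=> hf hg; apply: RintegralD => //; exact: seg_cont_integrable.
Qed.

Lemma rintZ k f a b : seg_cont f a b -> rint (fun x => k * f x) a b = k * rint f a b.
Proof.
by move=> hf; apply: RintegralZl => //; exact: seg_cont_integrable.
Qed.

Lemma rint_cst k a b : a <= b -> rint (fun=> k) a b = k * (b - a).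
Proof.
move=> ab; rewrite /rint Rintegral_cst//= lebesgue_measure_itv /= lte_fin.
case: ifPn => //; rewrite -leNgt => ba.
by have -> : b - a = 0 by move: ab ba; lra.
Qed.

Lemma seg_cont_cst k a b : seg_cont (fun=> k) a b.
Proof. by move=> x _ e e0; exists 1 => // y _ _; rewrite subrr normr0. Qed.

Lemma rint_le f g a b : seg_cont f a b -> seg_cont g a b ->
  (forall x, a <= x <= b -> f x <= g x) -> rint f a b <= rint g a b.
Proof.
move=> hf hg h; apply: le_Rintegral => //; try exact: seg_cont_integrable.
Qed.

Lemma rint_bound f a b (M : R) : a <= b -> seg_cont f a b ->
  (forall x, a <= x <= b -> `|f x| <= M) -> `|rint f a b| <= M * (b - a).
Proof.
move=> ab hf h; rewrite ler_norml -mulNr -!rint_cst//; apply/andP; split.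
all: apply: rint_le => //; try exact: seg_cont_cst.
all: by move=> x /h; rewrite ler_norml => /andP[].
Qed.

Lemma rint_split f a b c : a <= b -> b <= c -> seg_cont f a c ->
  rint f a c = rint f a b + rint f b c.
Proof.
move=> ab bc hf; rewrite /rint.
have := @Rintegral_itvB R f (BLeft a) (BRight c) b (seg_cont_integrable hf).
rewrite !bnd_simp => /(_ ab bc) h.
apply/eqP; rewrite addrC -subr_eq; apply/eqP; rewrite h.
apply: Rintegral_itv_obnd_cbnd.
apply: integrableS (seg_cont_integrable hf) => //.
by apply: subset_itv; rewrite bnd_simp.
Qed.

End SegmentIntegral.

(** * Integrals along rectangles *)

Section HasDiff.
Context {R : realType} {K : numFieldType} (N : abs_field R K).

Lemma has_diff_cont (h : K -> K) (z d : K) : has_diff N h z d ->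
  forall e : R, 0 < e -> exists2 r : R, 0 < r &
    forall w, N (w - z) < r -> N (h w - h z) < e.
Proof.
move=> hd e e0; have [r r0 rP] := hd 1 ltr01.
have c0 : 0 < N d + 2 by rewrite ltr_wpDl ?absf_ge0.
exists (Num.min r (e / (N d + 2))); first by rewrite lt_min r0 divr_gt0.
move=> w; rewrite lt_min => /andP[wr we].
have := rP _ wr; rewrite [z + _]addrC subrK mul1r => h1.
have := absfD N (h w - h z - (w - z) * d) ((w - z) * d); rewrite subrK absfM => h2.
move: we; rewrite ltr_pdivlMr//; have := absf_ge0 N (w - z).
by move: h1 h2; lra.
Qed.

End HasDiff.

Section Rectangles.
Context {R : realType}.
Local Notation C := (Cplx R).
Local Notation N := (@cplx_abs R).
Implicit Types (g h : C -> C) (x y a b : R) (z w c d : C).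

Lemma cext z w : cre z = cre w -> cim z = cim w -> z = w.
Proof. by case: z => a b; case: w => c d; rewrite /cre /cim /= => -> ->. Qed.

Lemma creD z w : cre (z + w) = cre z + cre w.
Proof. by case: z; case: w. Qed.

Lemma cimD z w : cim (z + w) = cim z + cim w.
Proof. by case: z; case: w. Qed.

Definition diffable g z := exists d, has_diff N g z d.

Definition cseg (h : R -> C) a b := forall x, a <= x <= b -> forall e : R, 0 < e ->
  exists2 r : R, 0 < r & forall y, a <= y <= b -> `|y - x| < r -> cabs (h y - h x) < e.

Definition cint (h : R -> C) a b : C :=
  cmk (rint (cre \o h) a b) (rint (cim \o h) a b).

Lemma cseg_re (h : R -> C) a b : cseg h a b -> seg_cont (cre \o h) a b.
Proof.
move=> hh x xab e e0; have [r r0 rP] := hh x xab e e0; exists r => // y yab yx.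
by rewrite /= -creB (le_lt_trans (cre_le _))// rP.
Qed.

Lemma cseg_im (h : R -> C) a b : cseg h a b -> seg_cont (cim \o h) a b.
Proof.
move=> hh x xab e e0; have [r r0 rP] := hh x xab e e0; exists r => // y yab yx.
by rewrite /= -cimB (le_lt_trans (cim_le _))// rP.
Qed.

Lemma cintL (c : C) (h1 h2 : R -> C) a b : cseg h1 a b -> cseg h2 a b ->
  cint (fun x => c * h1 x + h2 x) a b = c * cint h1 a b + cint h2 a b.
Proof.
move=> s1 s2; have r1 := cseg_re s1; have i1 := cseg_im s1.
have r2 := cseg_re s2; have i2 := cseg_im s2.
have sZ k (f : R -> R) : seg_cont f a b -> seg_cont (fun x => k * f x) a b.
  move=> hf x xab e e0; have ek : 0 < e / (`|k| + 1) by rewrite divr_gt0// ltr_wpDl.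
  have [r r0 rP] := hf x xab _ ek; exists r => // y yab yx.
  rewrite -mulrBr normrM; have := rP y yab yx; rewrite ltr_pdivlMr ?ltr_wpDl//.
  by have := normr_ge0 (f y - f x); have := normr_ge0 k; nra.
have sD (f f' : R -> R) : seg_cont f a b -> seg_cont f' a b ->
    seg_cont (fun x => f x + f' x) a b.
  move=> hf hf' x xab e e0; have e2 : 0 < e / 2 by rewrite divr_gt0.
  have [r r0 rP] := hf x xab _ e2; have [r' r'0 r'P] := hf' x xab _ e2.
  exists (Num.min r r'); first by rewrite lt_min r0.
  move=> y yab; rewrite lt_min => /andP[/(rP y yab) h1' /(r'P y yab) h2'].
  have -> : f y + f' y - (f x + f' x) = (f y - f x) + (f' y - f' x) by ring.
  by apply: le_lt_trans (ler_normD _ _) _; move: h1' h2'; lra.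
pose p1 := cre \o h1; pose q1 := cim \o h1; pose p2 := cre \o h2; pose q2 := cim \o h2.
apply: cext.
  rewrite creD creM; change (rint (fun x => cre (c * h1 x + h2 x)) a b =
    cre c * rint p1 a b - cim c * rint q1 a b + rint p2 a b).
  have -> : (fun x => cre (c * h1 x + h2 x)) =
      (fun x => (cre c * p1 x + (- cim c) * q1 x) + p2 x).
    by apply/funext => x; rewrite creD creM mulNr.
  rewrite (rintD (sD _ _ (sZ _ _ r1) (sZ _ _ i1)) r2) (rintD (sZ _ _ r1) (sZ _ _ i1)).
  by rewrite (rintZ _ r1) (rintZ _ i1) mulNr.
rewrite cimD cimM; change (rint (fun x => cim (c * h1 x + h2 x)) a b =
  cre c * rint q1 a b + cim c * rint p1 a b + rint q2 a b).
have -> : (fun x => cim (c * h1 x + h2 x)) =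
    (fun x => (cre c * q1 x + cim c * p1 x) + q2 x).
  by apply/funext => x; rewrite cimD cimM.
rewrite (rintD (sD _ _ (sZ _ _ i1) (sZ _ _ r1)) i2) (rintD (sZ _ _ i1) (sZ _ _ r1)).
by rewrite (rintZ _ r1) (rintZ _ i1).
Qed.

(** The two real components are bounded separately, hence the factor 2. *)
Lemma cint_bound (h : R -> C) a b (M : R) : a <= b -> cseg h a b ->
  (forall x, a <= x <= b -> cabs (h x) <= M) -> cabs (cint h a b) <= 2 * M * (b - a).
Proof.
move=> ab hh hM; apply: le_trans (cabs_le _) _.
have h1 : `|rint (cre \o h) a b| <= M * (b - a).
  apply: rint_bound => //; first exact: cseg_re.
  by move=> x /hM; apply: le_trans; exact: cre_le.
have h2 : `|rint (cim \o h) a b| <= M * (b - a).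
  apply: rint_bound => //; first exact: cseg_im.
  by move=> x /hM; apply: le_trans; exact: cim_le.
by rewrite /cint /cre /cim /=; move: h1 h2; lra.
Qed.

Lemma cint_split (h : R -> C) a b (c : R) : a <= b -> b <= c -> cseg h a c ->
  cint h a c = cint h a b + cint h b c.
Proof.
move=> ab bc hh; apply: cext.
  by rewrite creD /cint /cre /= -rint_split//; exact: cseg_re.
by rewrite cimD /cint /cim /= -rint_split//; exact: cseg_im.
Qed.

(** The integral of [g] along the boundary, counterclockwise. *)
Definition rect g x0 x1 y0 y1 : C :=
  cint (fun x => g (cmk x y0)) x0 x1 - cint (fun x => g (cmk x y1)) x0 x1 +
  cmk 0 1 * (cint (fun y => g (cmk x1 y)) y0 y1 - cint (fun y => g (cmk x0 y)) y0 y1).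

Definition in_rect x0 x1 y0 y1 z := x0 <= cre z <= x1 /\ y0 <= cim z <= y1.

Definition boundary x0 x1 y0 y1 z := in_rect x0 x1 y0 y1 z /\
  (cre z = x0 \/ cre z = x1 \/ cim z = y0 \/ cim z = y1).

(** Continuity at the boundary only: the function may be singular inside. *)
Definition bcont g x0 x1 y0 y1 := forall z, boundary x0 x1 y0 y1 z ->
  forall e : R, 0 < e -> exists2 r : R, 0 < r &
    forall w, cabs (w - z) < r -> cabs (g w - g z) < e.

Section Rect.
Variables (x0 x1 y0 y1 : R).
Hypotheses (xx : x0 <= x1) (yy : y0 <= y1).

Let bh x : x0 <= x <= x1 -> boundary x0 x1 y0 y1 (cmk x y0) /\ boundary x0 x1 y0 y1 (cmk x y1).
Proof.
move=> h; split; (split; [split; rewrite /cre /cim /= ?lexx// ?yy|]) => //.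
  by right; right; left.
by right; right; right.
Qed.

Let bv y : y0 <= y <= y1 -> boundary x0 x1 y0 y1 (cmk x0 y) /\ boundary x0 x1 y0 y1 (cmk x1 y).
Proof.
move=> h; split; (split; [split; rewrite /cre /cim /= ?lexx// ?xx|]) => //.
  by left.
by right; left.
Qed.

Let dh x x' y : cabs (cmk x y - cmk x' y) = `|x - x'|.
Proof.
rewrite -cabs_real; congr cabs; apply: cext.
  by rewrite creB.
by rewrite cimB /cim /= subrr.
Qed.

Let dv x y y' : cabs (cmk x y - cmk x y') = `|y - y'|.
Proof.
rewrite cabsE creB cimB /cre /cim /= subrr expr0n add0r sqrtr_sqr//.
Qed.

Lemma bcont_edges g : bcont g x0 x1 y0 y1 ->
  [/\ cseg (fun x => g (cmk x y0)) x0 x1, cseg (fun x => g (cmk x y1)) x0 x1,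
      cseg (fun y => g (cmk x0 y)) y0 y1 & cseg (fun y => g (cmk x1 y)) y0 y1].
Proof.
move=> hg; split=> t tt e e0.
- have [r r0 rP] := hg _ (proj1 (bh tt)) e e0; exists r => // s _ st.
  by apply: rP; rewrite dh.
- have [r r0 rP] := hg _ (proj2 (bh tt)) e e0; exists r => // s _ st.
  by apply: rP; rewrite dh.
- have [r r0 rP] := hg _ (proj1 (bv tt)) e e0; exists r => // s _ st.
  by apply: rP; rewrite dv.
- have [r r0 rP] := hg _ (proj2 (bv tt)) e e0; exists r => // s _ st.
  by apply: rP; rewrite dv.
Qed.

Lemma rectL (c : C) g h : bcont g x0 x1 y0 y1 -> bcont h x0 x1 y0 y1 ->
  rect (fun z => c * g z + h z) x0 x1 y0 y1 =
  c * rect g x0 x1 y0 y1 + rect h x0 x1 y0 y1.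
Proof.
move=> /bcont_edges[g1 g2 g3 g4] /bcont_edges[h1 h2 h3 h4].
rewrite /rect !cintL//; ring.
Qed.

Lemma rect_bound g (M : R) : bcont g x0 x1 y0 y1 ->
  (forall z, boundary x0 x1 y0 y1 z -> cabs (g z) <= M) ->
  cabs (rect g x0 x1 y0 y1) <= 4 * M * ((x1 - x0) + (y1 - y0)).
Proof.
move=> /bcont_edges[g1 g2 g3 g4] gM.
have b1 := cint_bound xx g1 (fun x hx => gM _ (proj1 (bh hx))).
have b2 := cint_bound xx g2 (fun x hx => gM _ (proj2 (bh hx))).
have b3 := cint_bound yy g3 (fun x hx => gM _ (proj1 (bv hx))).
have b4 := cint_bound yy g4 (fun x hx => gM _ (proj2 (bv hx))).
rewrite /rect; set s1 := cint _ _ _ in b1 *; set s2 := cint _ _ _ in b2 *.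
set s4 := cint _ _ _ in b4 *; set s3 := cint _ _ _ in b3 *.
apply: le_trans (cabsD _ _) _; rewrite cabsM.
have -> : cabs (cmk 0 1 : C) = 1.
  by rewrite cabsE /cre /cim /= expr0n add0r expr1n sqrtr1.
rewrite mul1r; have e1 : cabs (s1 - s2) <= cabs s1 + cabs s2 := absfB N s1 s2.
have e2 : cabs (s4 - s3) <= cabs s4 + cabs s3 := absfB N s4 s3.
by move: b1 b2 b3 b4 e1 e2; lra.
Qed.

Lemma bcont_affine c d : bcont (fun z => c + d * z) x0 x1 y0 y1.
Proof.
move=> z _ e e0; have c0 : 0 < cabs d + 1 by rewrite ltr_wpDl// cabs_ge0.
exists (e / (cabs d + 1)); first by rewrite divr_gt0.
move=> w; rewrite ltr_pdivlMr// => h.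
have -> : c + d * w - (c + d * z) = d * (w - z) by ring.
rewrite cabsM; have := cabs_ge0 (w - z); have := cabs_ge0 d; move: h; nra.
Qed.

(** The comparison functions of Goursat's theorem, integrated explicitly. *)
Lemma rect_affine c d : rect (fun z => c + d * z) x0 x1 y0 y1 = 0.
Proof.
have cst_seg (k : C) a b : cseg (fun=> k) a b.
  by move=> x _ e e0; exists 1 => // y _ _; rewrite subrr -[cabs _]/(N 0) absf0.
have id_h y a b : cseg (fun x => cmk x y) a b.
  by move=> x _ e e0; exists e => // x' _; rewrite dh.
have id_v x a b : cseg (fun y => cmk x y) a b.
  by move=> y _ e e0; exists e => // y' _; rewrite dv.
have E (k : C) (u : R -> C) a b : cseg u a b ->
    cint (fun x => c + d * u x) a b = d * cint u a b + cint (fun=> c) a b.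
  move=> hu; rewrite -cintL//; congr cint; apply/funext => x; exact: addrC.
rewrite /rect !E//.
have H y : cint (fun x => cmk x y) x0 x1 = cmk (rint id x0 x1) (y * (x1 - x0)).
  apply: cext; rewrite /cint /cre /cim /=; first by congr rint.
  by rewrite -rint_cst//; congr rint.
have V x : cint (fun y => cmk x y) y0 y1 = cmk (x * (y1 - y0)) (rint id y0 y1).
  apply: cext; rewrite /cint /cre /cim /=; last by congr rint.
  by rewrite -rint_cst//; congr rint.
rewrite !H !V.
set cc := cint _ _ _; set cc' := cint (fun=> c) y0 y1.
have -> : forall A B A' B' : C, d * A + cc - (d * B + cc) +
   cmk 0 1 * (d * A' + cc' - (d * B' + cc')) = d * (A - B + cmk 0 1 * (A' - B')).
  by move=> A B A' B'; ring.
rewrite (_ : _ - _ + _ = 0) ?mulr0//; apply: cext.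
  rewrite creD creM !creB !cimB /cre /cim /=; ring.
rewrite cimD cimM !creB !cimB /cre /cim /=; ring.
Qed.

End Rect.

Lemma rect_splitx g x0 x x1 y0 y1 : x0 <= x -> x <= x1 ->
  cseg (fun x => g (cmk x y0)) x0 x1 -> cseg (fun x => g (cmk x y1)) x0 x1 ->
  rect g x0 x1 y0 y1 = rect g x0 x y0 y1 + rect g x x1 y0 y1.
Proof.
move=> h1 h2 s1 s2; rewrite /rect (cint_split h1 h2 s1) (cint_split h1 h2 s2); ring.
Qed.

Lemma rect_splity g x0 x1 y0 y y1 : y0 <= y -> y <= y1 ->
  cseg (fun y => g (cmk x0 y)) y0 y1 -> cseg (fun y => g (cmk x1 y)) y0 y1 ->
  rect g x0 x1 y0 y1 = rect g x0 x1 y0 y + rect g x0 x1 y y1.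
Proof.
move=> h1 h2 s1 s2; rewrite /rect (cint_split h1 h2 s1) (cint_split h1 h2 s2); ring.
Qed.

End Rectangles.

(** * Goursat's theorem *)

Section Goursat.
Context {R : realType}.
Local Notation C := (Cplx R).
Local Notation N := (@cplx_abs R).
Implicit Types (g h : C -> C) (x y a b : R) (z w c d : C).

Lemma diffable_cont g z : diffable g z -> forall e : R, 0 < e -> exists2 r : R, 0 < r &
  forall w, cabs (w - z) < r -> cabs (g w - g z) < e.
Proof. by move=> [d hd]; exact: (@has_diff_cont _ _ N _ _ _ hd). Qed.

Lemma cseg_h g a b y : (forall x, a <= x <= b -> diffable g (cmk x y)) ->
  cseg (fun x => g (cmk x y)) a b.
Proof.
move=> hg x xab e e0; have [r r0 rP] := diffable_cont (hg x xab) e0.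
exists r => // x' _ xx; apply: rP; apply: le_lt_trans (cabs_le _) _.
by rewrite creB cimB /cre /cim /= subrr normr0 addr0.
Qed.

Lemma cseg_v g a b x : (forall y, a <= y <= b -> diffable g (cmk x y)) ->
  cseg (fun y => g (cmk x y)) a b.
Proof.
move=> hg y yab e e0; have [r r0 rP] := diffable_cont (hg y yab) e0.
exists r => // y' _ yy; apply: rP; apply: le_lt_trans (cabs_le _) _.
by rewrite creB cimB /cre /cim /= subrr normr0 add0r.
Qed.

Lemma bcont_diffable g x0 x1 y0 y1 : (forall z, boundary x0 x1 y0 y1 z -> diffable g z) ->
  bcont g x0 x1 y0 y1.
Proof. by move=> hg z hz; apply: diffable_cont; exact: hg. Qed.

Lemma half_pow (w : R) n : w / 2 ^+ n.+1 + w / 2 ^+ n.+1 = w / 2 ^+ n.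
Proof. by rewrite exprS; field; rewrite expf_neq0. Qed.

Lemma le_quarter (t u u' b1 b2 b3 b4 : R) :
  t <= u + u' -> u <= b1 + b2 -> u' <= b3 + b4 ->
  t <= 4 * b1 \/ t <= 4 * b2 \/ t <= 4 * b3 \/ t <= 4 * b4.
Proof.
move=> h1 h2 h3; case: (leP t (4 * b1)) => [|k1]; first by left.
case: (leP t (4 * b2)) => [|k2]; first by right; left.
case: (leP t (4 * b3)) => [|k3]; first by right; right; left.
by right; right; right; lra.
Qed.

Lemma half_interval (x u l a : R) : 0 <= l -> x + u = x + l + l -> a = x \/ a = x + l ->
  x <= a /\ a + l <= x + u.
Proof. by move=> l0 e [->|->]; split; lra. Qed.

Lemma abs_sub_itv (u x v l : R) : u <= x <= u + l -> u <= v -> v <= u + l -> `|v - x| <= l.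
Proof. by move=> /andP[h1 h2] h3 h4; rewrite ler_norml; apply/andP; split; lra. Qed.

Section Bisection.
Variables (g : C -> C) (x0 y0 w h : R).
Hypotheses (w0 : 0 <= w) (h0 : 0 <= h).
Hypothesis hg : forall z, in_rect x0 (x0 + w) y0 (y0 + h) z -> diffable g z.

Let W n := w / 2 ^+ n.
Let H n := h / 2 ^+ n.
Let W0 n : 0 <= W n. Proof. by rewrite divr_ge0// exprn_ge0. Qed.
Let H0 n : 0 <= H n. Proof. by rewrite divr_ge0// exprn_ge0. Qed.
Let RE n (p : R * R) := rect g p.1 (p.1 + W n) p.2 (p.2 + H n).
Let inQ n (p : R * R) := [/\ x0 <= p.1, p.1 + W n <= x0 + w, y0 <= p.2 & p.2 + H n <= y0 + h].

(* One of the four quarters carries at least a quarter of the integral. *)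
Let quarter n p : inQ n p -> exists p', [/\ inQ n.+1 p',
  p.1 <= p'.1 /\ p'.1 + W n.+1 <= p.1 + W n, p.2 <= p'.2 /\ p'.2 + H n.+1 <= p.2 + H n &
  cabs (RE n p) <= 4 * cabs (RE n.+1 p')].
Proof.
case: p => x y [/= x1 x2 y1 y2]; have Wn := half_pow w n; have Hn := half_pow h n.
rewrite -/(W _) -/(W _) in Wn; rewrite -/(H _) -/(H _) in Hn.
have w1 := W0 n.+1; have h1 := H0 n.+1.
have sh a b t : x0 <= a -> b <= x0 + w -> y0 <= t -> t <= y0 + h ->
    cseg (fun x => g (cmk x t)) a b.
  move=> xa bx ty yt; apply: cseg_h => s /andP[s1 s2]; apply: hg.
  by split; rewrite /cre /cim /= ?(le_trans xa s1) ?(le_trans s2 bx)// ty.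
have sv a b t : y0 <= a -> b <= y0 + h -> x0 <= t -> t <= x0 + w ->
    cseg (fun y => g (cmk t y)) a b.
  move=> ya b_y tx xt; apply: cseg_v => s /andP[s1 s2]; apply: hg.
  by split; rewrite /cre /cim /= ?(le_trans ya s1) ?(le_trans s2 b_y)// tx.
set x' := x + W n.+1; set y' := y + H n.+1.
have ex : x + W n = x' + W n.+1 by rewrite /x' -addrA Wn.
have ey : y + H n = y' + H n.+1 by rewrite /y' -addrA Hn.
have split4 : RE n (x, y) = (RE n.+1 (x, y) + RE n.+1 (x, y')) +
    (RE n.+1 (x', y) + RE n.+1 (x', y')).
  rewrite /RE /= ex ey -/x' -/y'.
  rewrite (@rect_splitx _ _ x x' (x' + W n.+1)).
  - by rewrite (@rect_splity _ _ x x' y y') 1?(@rect_splity _ _ x' _ y y')//;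
       rewrite ?lerDl//; apply: sv; rewrite /x' /y' in ex ey *; move: ex ey x1 x2 y1 y2 w1 h1; lra.
  - by rewrite lerDl.
  - by rewrite lerDl.
  - by apply: sh; rewrite /x' /y' in ex ey *; move: ex ey x1 x2 y1 y2 w1 h1; lra.
  - by apply: sh; rewrite /x' /y' in ex ey *; move: ex ey x1 x2 y1 y2 w1 h1; lra.
have big := le_quarter (cabsD _ _) (cabsD (RE n.+1 (x, y)) (RE n.+1 (x, y')))
  (cabsD (RE n.+1 (x', y)) (RE n.+1 (x', y'))).
rewrite -split4 in big.
have {}big : exists2 p, (p.1 = x \/ p.1 = x') /\ (p.2 = y \/ p.2 = y') &
    cabs (RE n (x, y)) <= 4 * cabs (RE n.+1 p).
  case: big => [b|[b|[b|b]]].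
  - by exists (x, y) => //=; split; left.
  - by exists (x, y') => //=; split; [left|right].
  - by exists (x', y) => //=; split; [right|left].
  - by exists (x', y') => //=; split; right.
case: big => -[a b] /= [ha hb] hRE.
have [a1 a2] := half_interval w1 ex ha; have [b1 b2] := half_interval h1 ey hb.
exists (a, b); split=> //=; split=> /=.
- exact: le_trans x1 a1.
- exact: le_trans a2 x2.
- exact: le_trans y1 b1.
- exact: le_trans b2 y2.
Qed.

(** The rectangles chosen by bisection shrink to a point [z], near which [g] is an affine
    function up to [e |v - z|]. So the integral along the [n]-th rectangle is
    [O(e / 4^n)], while it is at least [1 / 4^n] times the original one. *)
Lemma goursat_size : rect g x0 (x0 + w) y0 (y0 + h) = 0.
Proof.
have /choice[F FP] : forall np : nat * (R * R), exists p', inQ np.1 np.2 ->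
   [/\ inQ np.1.+1 p',
  np.2.1 <= p'.1 /\ p'.1 + W np.1.+1 <= np.2.1 + W np.1,
  np.2.2 <= p'.2 /\ p'.2 + H np.1.+1 <= np.2.2 + H np.1 &
  cabs (RE np.1 np.2) <= 4 * cabs (RE np.1.+1 p')].
  move=> [n p]; have [hp|nhp] := pselect (inQ n p); last by exists p => /nhp.
  by have [p' hp'] := quarter hp; exists p'.
pose p := fix p n := if n is m.+1 then F (m, p m) else (x0, y0).
have pQ n : inQ n (p n).
  elim: n => [|n IH]; last by have [] := FP (n, p n) IH.
  by split; rewrite /= ?lexx// /W /H expr0 divr1.
have pS n : [/\ (p n).1 <= (p n.+1).1 /\ (p n.+1).1 + W n.+1 <= (p n).1 + W n,
  (p n).2 <= (p n.+1).2 /\ (p n.+1).2 + H n.+1 <= (p n).2 + H n &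
  cabs (RE n (p n)) <= 4 * cabs (RE n.+1 (p n.+1))] by have [] := FP (n, p n) (pQ n).
have REn n : cabs (rect g x0 (x0 + w) y0 (y0 + h)) <= 4 ^+ n * cabs (RE n (p n)).
  elim: n => [|n IH]; first by rewrite expr0 mul1r /RE /= /W /H expr0 !divr1.
  apply: le_trans IH _; rewrite exprSr -mulrA ler_wpM2l ?exprn_ge0//.
  by have [_ _] := pS n.
have nest (u : nat -> R) (L : nat -> R) : (forall n, 0 <= L n) ->
    (forall n, u n <= u n.+1 /\ u n.+1 + L n.+1 <= u n + L n) ->
    exists l, forall n, u n <= l <= u n + L n.
  move=> L0 uL.
  have mono n k : u n <= u (n + k)%N /\ u (n + k)%N + L (n + k)%N <= u n + L n.
    elim: k => [|k [IH1 IH2]]; first by rewrite addn0.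
    have [s1 s2] := uL (n + k)%N; rewrite addnS; split; last exact: le_trans s2 IH2.
    exact: le_trans IH1 s1.
  have cross m n : u m <= u n + L n.
    have [a1 _] := mono m n; have [_ a2] := mono n m; rewrite addnC in a2.
    by rewrite (le_trans a1)// (le_trans _ a2)// lerDl.
  exists (sup (range u)) => n; apply/andP; split.
    apply: sup_upper_bound; last by exists n.
    split; first by exists (u 0%N), 0%N.
    by exists (u 0%N + L 0%N) => _ [m _ <-].
  apply: ge_sup; first by exists (u 0%N), 0%N.
  by move=> _ [m _ <-].
have [lx hx] := nest (fun n => (p n).1) W W0 (fun n => let: And3 a _ _ := pS n in a).
have [ly hy] := nest (fun n => (p n).2) H H0 (fun n => let: And3 _ a _ := pS n in a).
pose z := cmk lx ly.
have [d hd] : diffable g z.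
  apply: hg; have := hx 0%N; have := hy 0%N.
  by rewrite /= /W /H expr0 !divr1.
apply: (absf_le0 (N := N)) => e e0.
pose L := w + h; have L0 : 0 <= L by exact: addr_ge0.
have e' : 0 < e / (4 * L ^+ 2 + 1) by rewrite divr_gt0// ltr_wpDl// mulr_ge0// exprn_ge0.
set e1 := e / _ in e'.
have [r r0 rP] := hd _ e'.
have [n n0 hn] := absf_arch L r0.
have Ln : W n + H n = L / 2 ^+ n by rewrite /W /H /L mulrDl.
have Lr : L / 2 ^+ n < r.
  apply: le_lt_trans hn; rewrite ler_wpM2l// lef_pV2 ?posrE ?exprn_gt0 ?ltr0n//.
  by rewrite -natrX ler_nat ltnW// ltn_expl.
have [Q1 Q2 Q3 Q4] := pQ n.
have bsub v : boundary (p n).1 ((p n).1 + W n) (p n).2 ((p n).2 + H n) v ->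
    diffable g v /\ cabs (v - z) <= L / 2 ^+ n.
  move=> [[/andP[v1 v2] /andP[v3 v4]] _]; split.
    apply: hg; split; first by rewrite (le_trans Q1 v1) (le_trans v2 Q2).
    by rewrite (le_trans Q3 v3) (le_trans v4 Q4).
  apply: le_trans (cabs_le _) _; rewrite creB cimB -Ln.
  by apply: lerD; [exact: abs_sub_itv (hx n) v1 v2|exact: abs_sub_itv (hy n) v3 v4].
pose k (v : C) := (g z - d * z) + d * v.
pose q (v : C) := -1 * k v + g v.
have cq : bcont q (p n).1 ((p n).1 + W n) (p n).2 ((p n).2 + H n).
  move=> v hv f f0; have [gv _] := bsub v hv.
  have f2 : 0 < f / 2 by rewrite divr_gt0.
  have [r1 r10 h1] := diffable_cont gv f2.
  have [r2 r20 h2] := bcont_affine (g z - d * z) d hv f2.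
  exists (Num.min r1 r2); first by rewrite lt_min r10.
  move=> v'; rewrite lt_min => /andP[/h1 a1 /h2 a2].
  have -> : q v' - q v = (g v' - g v) - (k v' - k v) by rewrite /q; ring.
  have := absfB N (g v' - g v) (k v' - k v).
  move: a1 a2; rewrite -/(k v') -/(k v); set A := cabs _; set B := cabs (k _ - _).
  by rewrite -[N (g v' - g v)]/A -[N (k v' - k v)]/B -[N _]/(cabs _); lra.
have wn : (p n).1 <= (p n).1 + W n by rewrite lerDl.
have hn' : (p n).2 <= (p n).2 + H n by rewrite lerDl.
have eRE : RE n (p n) = rect q (p n).1 ((p n).1 + W n) (p n).2 ((p n).2 + H n).
  rewrite /q rectL//; last 2 first.
  - exact: bcont_affine.
  - by apply: bcont_diffable => v /bsub[].
  by rewrite rect_affine// mulr0 add0r.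
have bd : cabs (RE n (p n)) <= 4 * (e1 * (L / 2 ^+ n)) * (L / 2 ^+ n).
  rewrite eRE; apply: le_trans (rect_bound wn hn' cq (M := e1 * (L / 2 ^+ n)) _) _.
    move=> v /bsub[_ hv]; have := rP (v - z); rewrite -[N _]/(cabs _) => /(_ (le_lt_trans hv Lr)).
    rewrite [z + _]addrC subrK.
    have -> : g v - g z - (v - z) * d = q v by rewrite /q /k; ring.
    move=> hq; apply: le_trans hq _; rewrite ler_wpM2l//; exact: ltW.
  have -> : (p n).1 + W n - (p n).1 + ((p n).2 + H n - (p n).2) = L / 2 ^+ n.
    by rewrite -Ln; ring.
  by [].
apply: le_trans (REn n) _.
apply: (@le_trans _ _ (4 ^+ n * (4 * (e1 * (L / 2 ^+ n)) * (L / 2 ^+ n)))).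
  by rewrite ler_wpM2l// exprn_ge0.
have -> : 4 ^+ n * (4 * (e1 * (L / 2 ^+ n)) * (L / 2 ^+ n)) = 4 * L ^+ 2 * e1.
  rewrite (_ : 4 = 2 * 2 :> R) ?exprMn; last by ring.
  by field; rewrite expf_neq0.
rewrite /e1 mulrCA ler_piMr ?(ltW e0)// ler_pdivrMr ?mul1r ?lerDl//.
by rewrite ltr_wpDl// mulr_ge0// exprn_ge0.
Qed.

End Bisection.

Theorem goursat g x0 x1 y0 y1 : x0 <= x1 -> y0 <= y1 ->
  (forall z, in_rect x0 x1 y0 y1 z -> diffable g z) -> rect g x0 x1 y0 y1 = 0.
Proof.
move=> xx yy; have := @goursat_size g x0 y0 (x1 - x0) (y1 - y0).
rewrite !subr_ge0 [x0 + _]addrC [y0 + _]addrC !subrK; exact.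
Qed.

(** Around the small rectangle there are four rectangles without singularity, to which
    [goursat] applies. *)
Lemma rect_deform g x0 x1 y0 y1 a b a' b' :
  x0 <= a -> a <= b -> b <= x1 -> y0 <= a' -> a' <= b' -> b' <= y1 ->
  (forall z, in_rect x0 x1 y0 y1 z ->
     ~ (a < cre z < b /\ a' < cim z < b') -> diffable g z) ->
  rect g x0 x1 y0 y1 = rect g a b a' b'.
Proof.
move=> h1 h2 h3 h4 h5 h6 hg.
have sh u v t : x0 <= u -> v <= x1 -> y0 <= t <= y1 -> ~ (a' < t < b') ->
    cseg (fun x => g (cmk x t)) u v.
  move=> xu vx /andP[t1 t2] nt; apply: cseg_h => s /andP[s1 s2]; apply: hg.
    by split; rewrite /cre /cim /= ?(le_trans xu s1) ?(le_trans s2 vx)// t1.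
  by move=> [_ /nt].
have sv u v t : y0 <= u -> v <= y1 -> x0 <= t <= x1 -> ~ (a < t < b) ->
    cseg (fun y => g (cmk t y)) u v.
  move=> yu vy /andP[t1 t2] nt; apply: cseg_v => s /andP[s1 s2]; apply: hg.
    by split; rewrite /cre /cim /= ?(le_trans yu s1) ?(le_trans s2 vy)// t1.
  by move=> [/nt].
have lxx (t t' : R) : ~ (t < t < t') /\ ~ (t' < t < t).
  by rewrite !ltxx andbF; split.
have yy0 : y0 <= y0 <= y1 by rewrite lexx (le_trans h4)// (le_trans h5).
have yy1 : y0 <= y1 <= y1 by rewrite lexx (le_trans h4)// (le_trans h5).
have ny0 : ~ (a' < y0 < b') by rewrite ltNge h4.
have ny1 : ~ (a' < y1 < b') by rewrite andbC ltNge h6.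
rewrite (@rect_splitx _ _ x0 a x1) ?(le_trans h2)//; [|exact: sh..].
rewrite [rect g a x1 _ _](@rect_splitx _ _ a b x1)//; [|exact: sh..].
have xa : x0 <= a <= x1 by rewrite h1 (le_trans h2).
have xb : x0 <= b <= x1 by rewrite h3 (le_trans h1).
have na : ~ (a < a < b) by have [] := lxx a b.
have nb : ~ (a < b < b) by have [] := lxx b a.
rewrite [rect g a b y0 y1](@rect_splity _ _ a b y0 a' y1) ?(le_trans h5)//; [|exact: sv..].
rewrite [rect g a b a' y1](@rect_splity _ _ a b a' b' y1)//; [|exact: sv..].
rewrite (goursat (x0 := x0) (x1 := a)) ?(le_trans h4) ?(le_trans h5)//; last first.
  move=> z [/andP[z1 z2] z3]; apply: hg; first by split; rewrite ?z1 ?(le_trans z2)// (le_trans h2).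
  by move=> [/andP[]]; rewrite ltNge z2.
rewrite (goursat (x0 := b) (x1 := x1)) ?(le_trans h4) ?(le_trans h5)//; last first.
  move=> z [/andP[z1 z2] z3]; apply: hg; first by split; rewrite ?z2 ?(le_trans _ z1)// (le_trans h1).
  by move=> [/andP[_]]; rewrite ltNge z1.
rewrite (goursat (y0 := y0) (y1 := a'))//; last first.
  move=> z [/andP[z1 z2] /andP[z3 z4]]; apply: hg.
    by split; rewrite ?(le_trans h1 z1) ?(le_trans z2 h3) ?z3 ?(le_trans z4)// (le_trans h5).
  by move=> [_ /andP[]]; rewrite ltNge z4.
rewrite (goursat (y0 := b') (y1 := y1))//; last first.
  move=> z [/andP[z1 z2] /andP[z3 z4]]; apply: hg.
    by split; rewrite ?(le_trans h1 z1) ?(le_trans z2 h3) ?z4 ?(le_trans _ z3)// (le_trans h4).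
  by move=> [_ /andP[_]]; rewrite ltNge z3.
by rewrite !add0r !addr0.
Qed.

End Goursat.

(** * Cauchy's formula on a square *)

Section Cauchy.
Context {R : realType}.
Local Notation C := (Cplx R).
Local Notation N := (@cplx_abs R).
Implicit Types (g h : C -> C) (x y b : R) (a z w c d : C).

Lemma diffableP g z : diffable g z <-> derivable g z (1 : C).
Proof.
split=> [[d /has_diffP[]]//|hg].
by exists ('D_1 g z); apply/has_diffP/derivableP.
Qed.

Lemma diffableM g h z : diffable g z -> diffable h z -> diffable (fun z => g z * h z) z.
Proof. by move=> /diffableP hg /diffableP hh; apply/diffableP; exact: derivableM. Qed.

Lemma diffableV g z : g z != 0 -> diffable g z -> diffable (fun z => (g z)^-1) z.
Proof. by move=> g0 /diffableP hg; apply/diffableP; exact: derivableV. Qed.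

Lemma diffable_cst c z : diffable (fun=> c) z.
Proof. by apply/diffableP; exact: derivable_cst. Qed.

Lemma diffable_subr a z : diffable (fun z => z - a) z.
Proof.
exists 1 => e e0; exists 1 => // t _.
have -> : z + t - a - (z - a) - t * 1 = 0 :> C by ring.
by rewrite absf0 mulr_ge0 ?absf_ge0// ltW.
Qed.

Lemma diffable_inv a z : z != a -> diffable (fun z => (z - a)^-1) z.
Proof. by move=> za; apply: diffableV; [rewrite subr_eq0|exact: diffable_subr]. Qed.

Lemma diffableX g z k : diffable g z -> diffable (fun z => g z ^+ k) z.
Proof.
move=> hg; elim: k => [|k IH]; first exact: diffable_cst.
by have := diffableM hg IH; under [X in diffable X]eq_fun do rewrite -exprS.
Qed.

Lemma diffable_inv0 z : z != 0 -> diffable (fun z => z^-1) z.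
Proof.
move=> z0; have := @diffable_inv 0 z z0.
by under [X in diffable X]eq_fun do rewrite subr0.
Qed.

Lemma diffableL c g h z : diffable g z -> diffable h z -> diffable (fun z => c * g z + h z) z.
Proof.
move=> hg hh; have /diffableP h1 := diffableM (diffable_cst c z) hg.
by move/diffableP: hh => h2; apply/diffableP; exact: (derivableD h1 h2).
Qed.

Lemma rect_ext g h x0 x1 y0 y1 : x0 <= x1 -> y0 <= y1 ->
  (forall z, boundary x0 x1 y0 y1 z -> g z = h z) ->
  rect g x0 x1 y0 y1 = rect h x0 x1 y0 y1.
Proof.
move=> xx yy gh.
have E (u v : R -> C) (a b : R) : (forall x, a <= x <= b -> u x = v x) -> cint u a b = cint v a b.
  move=> uv; rewrite /cint; congr cmk; apply: eq_Rintegral => x; rewrite inE /= in_itv /=.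
    by move=> /uv; rewrite /= => ->.
  by move=> /uv; rewrite /= => ->.
rewrite /rect; congr (_ - _ + _ * (_ - _)); apply: E => t tt; apply: gh.
all: split; first by split; rewrite /cre /cim /= ?lexx ?xx ?yy.
- by right; right; left.
- by right; right; right.
- by right; left.
- by left.
Qed.

Variables (f : C -> C) (r M : R).
Hypotheses (r0 : 0 < r) (M0 : 0 < M).

Let rr : - r <= r. Proof. by have := r0; lra. Qed.

Definition oint g := rect g (- r) r (- r) r.

Let bnd := boundary (- r) r (- r) r.

Let bnd_le z : in_rect (- r) r (- r) r z -> cabs z <= 2 * r.
Proof.
move=> [z1 z2]; rewrite -!ler_norml in z1 z2; apply: le_trans (cabs_le _) _.
by move: z1 z2; lra.
Qed.

Let bnd_ge z : bnd z -> r <= cabs z.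
Proof.
move=> [_ [h|[h|[h|h]]]].
- by rewrite (le_trans _ (cre_le z))// h normrN ler_norm.
- by rewrite (le_trans _ (cre_le z))// h ler_norm.
- by rewrite (le_trans _ (cim_le z))// h normrN ler_norm.
- by rewrite (le_trans _ (cim_le z))// h ler_norm.
Qed.

Let bnd_neq0 z : bnd z -> z != 0.
Proof.
by move=> /bnd_ge; apply: contraTneq => ->; rewrite -[cabs 0]/(N 0) absf0 -ltNge.
Qed.

Let bnd_sub a z : cabs a <= r / 2 -> bnd z -> r / 2 <= cabs (z - a).
Proof.
move=> ha /bnd_ge hz; have : cabs z - cabs a <= cabs (z - a) := absf_dist N z a.
by move: ha hz; lra.
Qed.

Let bnd_neq a z : cabs a <= r / 2 -> bnd z -> z != a.
Proof.
move=> ha /(bnd_sub ha); apply: contraTneq => ->.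
by rewrite subrr -[cabs 0]/(N 0) absf0 -ltNge divr_gt0.
Qed.

Lemma oint_bound g (B : R) : (forall z, bnd z -> diffable g z) ->
  (forall z, bnd z -> cabs (g z) <= B) -> cabs (oint g) <= 16 * B * r.
Proof.
move=> dg gB; apply: le_trans (rect_bound rr rr (bcont_diffable dg) gB) _.
by rewrite le_eqVlt; apply/orP; left; apply/eqP; ring.
Qed.

Lemma ointL c g h : (forall z, bnd z -> diffable g z) -> (forall z, bnd z -> diffable h z) ->
  oint (fun z => c * g z + h z) = c * oint g + oint h.
Proof. by move=> dg dh; apply: rectL => //; exact: bcont_diffable. Qed.

Lemma oint_ext g h : (forall z, bnd z -> g z = h z) -> oint g = oint h.
Proof. by move=> gh; exact: rect_ext. Qed.

Hypothesis fM : forall z, cabs z <= 2 * r -> diffable f z /\ cabs (f z) <= M.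

(** This is [2 i pi] for [a] inside the square; it enters as a divisor, bounded below by
    [winding0_ge]. *)
Definition winding a := oint (fun z => (z - a)^-1).
Definition coef j := oint (fun z => f z * z^-1 ^+ j.+1).

Let df z : in_rect (- r) r (- r) r z -> diffable f z.
Proof. by move=> /bnd_le/fM[]. Qed.

(** The quotient [(f z - f a) / (z - a)] is bounded near [a], so its integral along small
    squares around [a] tends to 0; by [rect_deform] all these integrals are equal. *)
Lemma cauchy_formula a : cabs a <= r / 2 ->
  oint (fun z => f z * (z - a)^-1) = f a * winding a.
Proof.
move=> ha; apply/eqP; rewrite -subr_eq0 addrC -mulNr -ointL; last 2 first.
- by move=> z hz; apply: diffable_inv; exact: bnd_neq.
- move=> z hz; apply: diffableM; first by apply: df; case: hz.
  by apply: diffable_inv; exact: bnd_neq.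
set g := (fun z => _).
have dg z : in_rect (- r) r (- r) r z -> z != a -> diffable g z.
  move=> hz za; apply: diffableL; first exact: diffable_inv.
  by apply: diffableM; [exact: df|exact: diffable_inv].
have ha1 := le_trans (cre_le a) ha; have ha2 := le_trans (cim_le a) ha.
rewrite !ler_norml in ha1 ha2.
have [d hd] : diffable f a.
  by have [] := fM (z := a); first by move: ha r0; lra.
have [s s0 sP] := hd 1 ltr01.
apply/eqP/(absf_le0 (N := N)) => e e0; rewrite -[N _]/(cabs _).
have d1 : 0 < cabs d + 1 by rewrite ltr_wpDl// cabs_ge0.
pose t := Num.min (r / 2) (Num.min (s / 4) (e / (16 * (cabs d + 1)))).
have t0 : 0 < t by rewrite !lt_min !divr_gt0// mulr_gt0.
have tr : t <= r / 2 by rewrite ge_min lexx.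
have ts : t <= s / 4 by rewrite !ge_min lexx orbT.
have te : t <= e / (16 * (cabs d + 1)) by rewrite !ge_min lexx !orbT.
rewrite /oint (@rect_deform _ g _ _ _ _ (cre a - t) (cre a + t) (cim a - t) (cim a + t)).
- have tt (x : R) : x - t <= x + t by move: t0; lra.
  have small z : boundary (cre a - t) (cre a + t) (cim a - t) (cim a + t) z ->
      z != a /\ cabs (z - a) <= 2 * t.
    move=> [[/andP[z1 z2] /andP[z3 z4]] hb]; split.
      apply/eqP => za; move: hb; rewrite za; move: t0 => t0'.
      by case=> [|[|[|]]]; lra.
    apply: le_trans (cabs_le _) _; rewrite creB cimB.
    have : `|cre z - cre a| <= t by rewrite ler_norml; apply/andP; split; lra.
    have : `|cim z - cim a| <= t by rewrite ler_norml; apply/andP; split; lra.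
    by lra.
  apply: le_trans (rect_bound (M := cabs d + 1) (tt _) (tt _) _ _) _.
  + apply: bcont_diffable => z hz; apply: dg; last by have [] := small z hz.
    case: hz => -[/andP[z1 z2] /andP[z3 z4]] _.
    by split; apply/andP; split; move: ha1 ha2 => /andP[? ?] /andP[? ?]; lra.
  + move=> z /small[za zs]; have := sP (z - a).
    rewrite -[N (z - a)]/(cabs _) mul1r [a + _]addrC subrK => /(_ _) h.
    have Nz : 0 < cabs (z - a) by apply: (@absf_gt0 _ _ N); rewrite subr_eq0.
    have -> : g z = (f z - f a - (z - a) * d) / (z - a) + d.
      by rewrite /g; field; rewrite subr_eq0.
    apply: le_trans (cabsD _ _) _; rewrite addrC lerD2l cabsM.
    rewrite -[cabs (_^-1)]/(N _) absfV ler_pdivrMr// mul1r; apply: h.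
    by move: zs ts s0; lra.
  have -> : cre a + t - (cre a - t) + (cim a + t - (cim a - t)) = 4 * t by ring.
  rewrite ler_pdivlMr ?mulr_gt0// in te; move: te; lra.
- by move: ha1 tr => /andP[]; lra.
- by move: t0; lra.
- by move: ha1 tr => /andP[]; lra.
- by move: ha2 tr => /andP[]; lra.
- by move: t0; lra.
- by move: ha2 tr => /andP[]; lra.
move=> z hz nz; apply: dg => //; apply/eqP => za; apply: nz; rewrite za.
by split; rewrite gtrBl ltrDl t0.
Qed.

Let kernel a k := oint (fun z => f z * z^-1 ^+ k * (z - a)^-1).

Let dker a k : cabs a <= r / 2 ->
  forall z, bnd z -> diffable (fun z => f z * z^-1 ^+ k * (z - a)^-1) z.
Proof.
move=> ha z hz; apply: diffableM; last by apply: diffable_inv; exact: bnd_neq.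
apply: diffableM; first by apply: df; case: hz.
by apply: diffableX; apply: diffable_inv0; exact: bnd_neq0.
Qed.

Let dcoef j z : bnd z -> diffable (fun z => f z * z^-1 ^+ j.+1) z.
Proof.
move=> hz; apply: diffableM; first by apply: df; case: hz.
by apply: diffableX; apply: diffable_inv0; exact: bnd_neq0.
Qed.

Let kernelS a k : cabs a <= r / 2 -> kernel a k = a * kernel a k.+1 + coef k.
Proof.
move=> ha; rewrite -ointL; [|exact: dker|exact: dcoef].
apply: oint_ext => z hz; rewrite exprSr; field.
by rewrite (bnd_neq0 hz) subr_eq0 (bnd_neq ha hz).
Qed.

Let inv_le z k : bnd z -> cabs (f z * z^-1 ^+ k) <= M / r ^+ k.
Proof.
move=> hz; have hr := bnd_ge hz; have z0 := bnd_neq0 hz.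
have [_ fz] := fM (bnd_le (proj1 hz)).
have e : cabs (z^-1 ^+ k) = (cabs z)^-1 ^+ k.
  elim: k => [|k IH]; first by rewrite !expr0 -[cabs 1]/(N 1) absf1.
  by rewrite !exprS cabsM IH -[cabs z^-1]/(N _) absfV.
rewrite cabsM e; apply: ler_pM => //; first exact: cabs_ge0.
  by rewrite exprn_ge0// invr_ge0 cabs_ge0.
rewrite -exprVn lerXn2r ?nnegrE ?invr_ge0 ?cabs_ge0 ?(ltW r0)//.
by rewrite lef_pV2 ?posrE//; exact: lt_le_trans hr.
Qed.

Lemma coef_le j : cabs (coef j) <= 16 * M / r ^+ j.
Proof.
apply: le_trans (oint_bound (B := M / r ^+ j.+1) _ _) _.
- exact: dcoef.
- by move=> z; exact: inv_le.
by rewrite exprS le_eqVlt; apply/orP; left; apply/eqP; field; rewrite expf_neq0 ?lt0r_neq0.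
Qed.

(** Expand [1 / (z - a)] as a geometric sum in [a / z]; the remainder is bounded because
    [r <= |z|] and [r / 2 <= |z - a|] on the contour. *)
Lemma cauchy_expansion a k : cabs a <= r / 2 ->
  cabs (f a * winding a - \sum_(j < k) a ^+ j * coef j) <= 32 * M * (cabs a / r) ^+ k.
Proof.
move=> ha.
have -> : f a * winding a = \sum_(j < k) a ^+ j * coef j + a ^+ k * kernel a k.
  rewrite -cauchy_formula//; elim: k => [|k IH].
    rewrite big_ord0 add0r expr0 mul1r; apply: oint_ext => z _.
    by rewrite expr0 mulr1.
  by rewrite big_ord_recr /= IH kernelS// -addrA exprSr; congr (_ + _); ring.
rewrite addrC addKr cabsM.
have -> : cabs (a ^+ k) = cabs a ^+ k.
  elim: k => [|k IH]; first by rewrite !expr0 -[cabs 1]/(N 1) absf1.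
  by rewrite !exprS cabsM IH.
have hk : cabs (kernel a k) <= 32 * M / r ^+ k.
  apply: le_trans (oint_bound (B := M / r ^+ k * (2 / r)) _ _) _.
  - exact: dker.
  - move=> z hz; rewrite cabsM ler_pM ?cabs_ge0//; first exact: inv_le.
    rewrite -[cabs (_^-1)]/(N _) absfV -[2 / r]invrK lef_pV2 ?posrE.
    - by rewrite invf_div; exact: bnd_sub.
    - by apply: absf_gt0; rewrite subr_eq0 (bnd_neq ha hz).
    by rewrite invr_gt0 divr_gt0.
  by rewrite le_eqVlt; apply/orP; left; apply/eqP; field; rewrite expf_neq0 ?lt0r_neq0.
apply: (@le_trans _ _ (cabs a ^+ k * (32 * M / r ^+ k))).
  by rewrite ler_wpM2l// exprn_ge0// cabs_ge0.
by rewrite expr_div_n le_eqVlt; apply/orP; left; apply/eqP; ring.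
Qed.

End Cauchy.

(** * Taylor expansions and zeros of holomorphic functions of one variable *)

Section Taylor.
Context {R : realType}.
Local Notation C := (Cplx R).
Local Notation N := (@cplx_abs R).
Implicit Types (x y b r : R) (a z w c d : C).

Lemma cre_inv z : cre z^-1 = cre z / (cre z ^+ 2 + cim z ^+ 2).
Proof. by case: z. Qed.

Lemma cim_inv z : cim z^-1 = - cim z / (cre z ^+ 2 + cim z ^+ 2).
Proof. by case: z => a b; rewrite /cim /= mulNr. Qed.

Lemma cim_rect (g : C -> C) x0 x1 y0 y1 : cim (rect g x0 x1 y0 y1) =
  (rint (fun x => cim (g (cmk x y0))) x0 x1 - rint (fun x => cim (g (cmk x y1))) x0 x1) +
  (rint (fun y => cre (g (cmk x1 y))) y0 y1 - rint (fun y => cre (g (cmk x0 y))) y0 y1).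
Proof. by rewrite /rect cimD cimM !cimB !creB /cre /cim /= mul0r mul1r add0r. Qed.

(** On each side of the square the relevant component of [1 / z] has constant sign and
    absolute value at least [1 / (2 r)], over a length [2 r]. *)
Lemma winding0_ge r : 0 < r -> 4 <= cabs (winding r 0).
Proof.
move=> r0; have rr : - r <= r by move: r0; lra.
apply: le_trans (cim_le _); apply: le_trans (ler_norm _).
have bc : bcont (fun z => (z - 0)^-1 : C) (- r) r (- r) r.
  apply: bcont_diffable => z [[z1 z2] hz]; apply: diffable_inv; apply/eqP => z0.
  by move: hz; rewrite z0 /cre /cim /=; case=> [|[|[|]]]; move: r0; lra.
have [e1 e2 e3 e4] := bcont_edges rr rr bc.
rewrite /winding /oint cim_rect.
have sq x : - r <= x <= r -> 1 / (2 * r) <= r / (x ^+ 2 + r ^+ 2).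
  move=> /andP[x1 x2]; have p : 0 < x ^+ 2 + r ^+ 2 by rewrite ltr_wpDl ?sqr_ge0// exprn_gt0.
  rewrite ler_pdivrMr ?mulr_gt0// mulrAC ler_pdivlMr// mul1r; nra.
have int1 (h : R -> R) : seg_cont h (- r) r ->
    (forall x, - r <= x <= r -> 1 / (2 * r) <= h x) -> 1 <= rint h (- r) r.
  move=> sh hh; have e : rint (fun=> 1 / (2 * r)) (- r) r = 1.
    by rewrite rint_cst//; field; exact: lt0r_neq0.
  by rewrite -e; apply: rint_le => //; exact: seg_cont_cst.
have int2 (h : R -> R) : seg_cont h (- r) r ->
    (forall x, - r <= x <= r -> h x <= - (1 / (2 * r))) -> rint h (- r) r <= - 1.
  move=> sh hh; have e : rint (fun=> - (1 / (2 * r))) (- r) r = - 1.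
    by rewrite rint_cst//; field; exact: lt0r_neq0.
  by rewrite -e; apply: rint_le => //; exact: seg_cont_cst.
have i1 := int1 _ (cseg_im e1); have i2 := int2 _ (cseg_im e2).
have i3 := int2 _ (cseg_re e3); have i4 := int1 _ (cseg_re e4).
have j1 : 1 <= rint (fun x => cim ((cmk x (- r) - 0)^-1)) (- r) r.
  apply: i1 => x hx; rewrite /comp subr0 cim_inv /cre /cim /= sqrrN opprK; exact: sq.
have j2 : rint (fun x => cim ((cmk x r - 0)^-1)) (- r) r <= - 1.
  by apply: i2 => x hx; rewrite /comp subr0 cim_inv /cre /cim /= mulNr lerN2; exact: sq.
have j3 : rint (fun x => cre ((cmk (- r) x - 0)^-1)) (- r) r <= - 1.
  apply: i3 => x hx; rewrite /comp subr0 cre_inv /cre /cim /= sqrrN mulNr lerN2.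
  by rewrite addrC; exact: sq.
have j4 : 1 <= rint (fun x => cre ((cmk r x - 0)^-1)) (- r) r.
  by apply: i4 => x hx; rewrite /comp subr0 cre_inv /cre /cim /= addrC; exact: sq.
by move: j1 j2 j3 j4; lra.
Qed.

Section One.
Variables (f : C -> C) (r M : R).
Hypotheses (r0 : 0 < r) (M0 : 0 < M).
Hypothesis fM : forall z, cabs z <= 2 * r -> diffable f z /\ cabs (f z) <= M.

Let oneM z : cabs z <= 2 * r -> diffable (fun=> 1 : C) z /\ cabs (1 : C) <= 1.
Proof. by split; [exact: diffable_cst|rewrite -[cabs 1]/(N 1) absf1]. Qed.

Local Notation c j := (coef f r j).
Local Notation d j := (coef (fun=> 1) r j).

Let cabs0 : cabs (0 : C) = 0. Proof. by rewrite -[cabs 0]/(N 0) absf0. Qed.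

Let windingE a k : cabs a <= r / 2 ->
  cabs (winding r a - \sum_(j < k) a ^+ j * d j) <= 32 * (cabs a / r) ^+ k.
Proof.
by move=> ha; have := cauchy_expansion r0 oneM k ha; rewrite mul1r mulr1.
Qed.

Let zero_half : cabs (0 : C) <= r / 2.
Proof. by rewrite cabs0 divr_ge0// ltW. Qed.

Let d0E : d 0%N = winding r 0.
Proof.
have := windingE 1 zero_half; rewrite big_ord1 -[nat_of_ord ord0]/0%N expr0 mul1r cabs0 mul0r expr1 mulr0.
move=> h; apply/eqP; rewrite eq_sym -subr_eq0; apply/eqP/cabs_eq0/eqP.
by rewrite eq_le h cabs_ge0.
Qed.

Let c0E : c 0%N = f 0 * d 0%N.
Proof.
have := cauchy_expansion r0 fM 1 zero_half.
rewrite big_ord1 -[nat_of_ord ord0]/0%N expr0 mul1r cabs0 mul0r expr1 mulr0 d0E.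
move=> h; apply/eqP; rewrite eq_sym -subr_eq0; apply/eqP/cabs_eq0/eqP.
by rewrite eq_le h cabs_ge0.
Qed.

Let winding_near a : cabs a <= r / 16 ->
  cabs (winding r a - d 0%N) <= 32 * (cabs a / r) /\ 2 <= cabs (winding r a).
Proof.
move=> ha; have ha2 : cabs a <= r / 2 by move: ha r0; lra.
have h1 := windingE 1 ha2; rewrite big_ord1 -[nat_of_ord ord0]/0%N expr0 mul1r expr1 in h1; split=> //.
have h2 := winding0_ge r0; rewrite -d0E in h2.
have : cabs (d 0%N) - cabs (winding r a) <= cabs (d 0%N - winding r a) := absf_dist N (d 0%N) (winding r a).
have -> : cabs (d 0%N - winding r a) = cabs (winding r a - d 0%N) := absfBC N (d 0%N) (winding r a).
have : cabs a / r <= 1 / 16 by rewrite ler_pdivrMr//; move: ha; lra.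
by move: h1 h2; lra.
Qed.

(** [cauchy_expansion] of order 2 for [f] and for the constant 1 gives the expansions of
    [f w] and of [w], the winding integral; then divide by [w], which stays away from 0. The
    constants are explicit so as to be uniform in [f]. *)
Lemma taylor_holo : exists2 e : C, cabs e <= 8 * M / r & forall a, cabs a <= r / 16 ->
  cabs (f (0 + a) - f 0 - e * a) <= 160 * M * (cabs a / r) ^+ 2.
Proof.
have d04 := winding0_ge r0; rewrite -d0E in d04.
have d0n : d 0%N != 0.
  by apply/eqP => h; move: d04; rewrite h cabs0; lra.
have fz : cabs (f 0) <= M by have [] := fM (z := 0); rewrite ?cabs0 ?mulr_ge0 ?(ltW r0).
have c1 := coef_le r0 fM 1; have d1 := coef_le r0 oneM 1.
rewrite !expr1 in c1 d1.
pose e := (c 1%N - f 0 * d 1%N) / d 0%N.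
have eM : cabs e <= 8 * M / r.
  rewrite /e cabsM -[cabs (_^-1)]/(N _) absfV -[N _]/(cabs _).
  rewrite ler_pdivrMr; last by move: d04; lra.
  have h1 : cabs (c 1%N - f 0 * d 1%N) <= cabs (c 1%N) + cabs (f 0 * d 1%N) := absfB N (c 1%N) (f 0 * d 1%N).
  have h2 : cabs (f 0 * d 1%N) <= M * (16 / r).
    by rewrite cabsM ler_pM ?cabs_ge0//; move: d1; rewrite mulr1.
  have h3 : 8 * M / r * 4 <= 8 * M / r * cabs (d 0%N).
    by rewrite ler_wpM2l// divr_ge0 ?mulr_ge0 ?(ltW M0) ?(ltW r0).
  by move: h1 h2 h3 c1; lra.
exists e => // a ha; rewrite add0r; have ha2 : cabs a <= r / 2 by move: ha r0; lra.
have [w1 w2] := winding_near ha.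
have F2 := cauchy_expansion r0 fM 2 ha2.
have W2 := windingE 2 ha2.
rewrite !big_ord_recr !big_ord0 /= !add0r expr0 !mul1r expr1 in F2 W2.
set q := cabs a / r in w1 F2 W2 *.
have q0 : 0 <= q by rewrite divr_ge0 ?cabs_ge0 ?(ltW r0).
have aq : cabs a = q * r by rewrite /q mulfVK// lt0r_neq0.
suff H : cabs ((f a - f 0 - e * a) * winding r a) <= 320 * M * q ^+ 2.
  rewrite cabsM in H; have := cabs_ge0 (f a - f 0 - e * a).
  by move=> u0; move: (ler_wpM2l u0 w2) H; lra.
have -> : (f a - f 0 - e * a) * winding r a =
   (f a * winding r a - (c 0%N + a * c 1%N)) - f 0 * (winding r a - (d 0%N + a * d 1%N)) -
   e * a * (winding r a - d 0%N).
  have ed : e * d 0%N = c 1%N - f 0 * d 1%N by rewrite /e mulfVK.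
  rewrite c0E; have -> : c 1%N = e * d 0%N + f 0 * d 1%N by rewrite ed subrK.
  by ring.
set A := _ - (c 0%N + _) in F2 *; set B := _ - (d 0%N + _) in W2 *.
have h1 : cabs (A - f 0 * B - e * a * (winding r a - d 0%N)) <=
   cabs (A - f 0 * B) + cabs (e * a * (winding r a - d 0%N)) :=
   absfB N (A - f 0 * B) (e * a * (winding r a - d 0%N)).
have h2 : cabs (A - f 0 * B) <= cabs A + cabs (f 0 * B) := absfB N A (f 0 * B).
have h3 : cabs (f 0 * B) <= M * (32 * q ^+ 2) by rewrite cabsM ler_pM ?cabs_ge0.
have h4 : cabs (e * a * (winding r a - d 0%N)) <= 8 * M * q * (32 * q).
  rewrite [cabs (e * a * _)]cabsM [cabs (e * a)]cabsM.
  apply: ler_pM; rewrite ?mulr_ge0 ?cabs_ge0//.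
  rewrite aq; have : cabs e * (q * r) <= 8 * M / r * (q * r).
    by rewrite ler_wpM2r// mulr_ge0// ltW.
  have -> : 8 * M / r * (q * r) = 8 * M * q by field; exact: lt0r_neq0.
  by [].
by move: h1 h2 h3 h4 F2; rewrite expr2; lra.
Qed.

(** If all coefficients vanish, [f w] is smaller than every power of [|a| / r]; otherwise
    the first nonzero term dominates near 0. *)
Lemma isolated_holo : (forall a, cabs a <= r / 16 -> f a = 0) \/
  (exists2 s : R, 0 < s & forall a, cabs a < s -> a != 0 -> f a != 0).
Proof.
have [allz|] := pselect (forall j, c j = 0).
  left=> a ha; have ha2 : cabs a <= r / 2 by move: ha r0; lra.
  have [_ w2] := winding_near ha.
  apply: cabs_eq0; apply/eqP; rewrite eq_le cabs_ge0 andbT leNgt; apply/negP => fa.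
  have q16 : cabs a / r <= 1 / 16 by rewrite ler_pdivrMr//; move: ha; lra.
  have q0 : 0 <= cabs a / r by rewrite divr_ge0 ?cabs_ge0 ?(ltW r0).
  have [k k0 hk] := absf_arch (32 * M) fa.
  have := cauchy_expansion r0 fM k ha2.
  rewrite big1 ?subr0; last by move=> j _; rewrite allz mulr0.
  rewrite cabsM.
  have : (cabs a / r) ^+ k <= k%:R^-1.
    apply: (@le_trans _ _ (2 ^- k)).
      rewrite -exprVn lerXn2r ?nnegrE//; move: q16; lra.
    by rewrite lef_pV2 ?posrE ?exprn_gt0 ?ltr0n// -natrX ler_nat ltnW// ltn_expl.
  move=> h; have : 32 * M * (cabs a / r) ^+ k <= 32 * M / k%:R.
    by rewrite ler_wpM2l// mulr_ge0// ltW.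
  by move: hk fa w2; nra.
move=> /existsNP nz; right.
have ex : exists j, c j != 0 by have [j /eqP] := nz; exists j.
have cj := ex_minnP ex; case: cj => j cj jmin.
have cj0 : 0 < cabs (c j) := @absf_gt0 _ _ N _ cj.
have B0 : 0 < 32 * M / r ^+ j.+1 by rewrite divr_gt0 ?mulr_gt0// exprn_gt0.
exists (Num.min (r / 2) (cabs (c j) / (32 * M / r ^+ j.+1))).
  by rewrite lt_min (divr_gt0 r0)//= (divr_gt0 cj0 B0).
move=> a; rewrite lt_min => /andP[a1 a2] a0; apply/eqP => fa.
have := cauchy_expansion r0 fM j.+1 (ltW a1).
rewrite fa mul0r sub0r big_ord_recr /= big1 ?add0r; last first.
  move=> i _; have [->|ci] := eqVneq (c i) 0; first by rewrite mulr0.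
  by have := jmin _ ci; rewrite leqNgt ltn_ord.
have aX : cabs (a ^+ j) = cabs a ^+ j.
  elim: (j) => [|k IH]; first by rewrite !expr0 -[cabs 1]/(N 1) absf1.
  by rewrite !exprS cabsM IH.
rewrite -[cabs (- _)]/(N _) absfN -[N _]/(cabs _) cabsM aX expr_div_n exprS.
have ca : 0 < cabs a := @absf_gt0 _ _ N _ a0.
have caj : 0 < cabs a ^+ j by exact: exprn_gt0.
move: a2; rewrite ltr_pdivlMr// => a2.
have -> : 32 * M * (cabs a * cabs a ^+ j / r ^+ j.+1) =
   cabs a ^+ j * (cabs a * (32 * M / r ^+ j.+1)) by ring.
by rewrite ler_pM2l// leNgt a2.
Qed.

End One.

Section Shift.
Variables (f : C -> C) (z0 : C) (r M : R).
Hypotheses (r0 : 0 < r) (M0 : 0 < M).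
Hypothesis fM : forall z, cabs (z - z0) <= 2 * r -> diffable f z /\ cabs (f z) <= M.

Let fM' z : cabs z <= 2 * r -> diffable (fun z => f (z0 + z)) z /\ cabs (f (z0 + z)) <= M.
Proof.
move=> hz; have [|[d hd] h] := fM (z := z0 + z); first by rewrite addrC addKr.
split=> //; exists d => e /hd[s s0 sP]; exists s => // t /sP.
by rewrite addrA.
Qed.

Lemma taylor_holo_at : exists2 e : C, cabs e <= 8 * M / r & forall a, cabs a <= r / 16 ->
  cabs (f (z0 + a) - f z0 - e * a) <= 160 * M * (cabs a / r) ^+ 2.
Proof.
have [e e1 e2] := taylor_holo r0 M0 fM'; exists e => // a /e2.
by rewrite add0r addr0.
Qed.

Lemma isolated_holo_at : (forall a, cabs a <= r / 16 -> f (z0 + a) = 0) \/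
  (exists2 s : R, 0 < s & forall a, cabs a < s -> a != 0 -> f (z0 + a) != 0).
Proof. exact: isolated_holo r0 M0 fM'. Qed.

End Shift.

End Taylor.

(** * Holomorphic functions of two variables *)

Section Holomorphic.
Context {R : realType}.
Local Notation C := (Cplx R).
Local Notation N := (@cplx_abs R).
Implicit Types (x y b r : R) (a z w c d t : C) (u v p q : 'rV[C]_2) (U : set 'rV[C]_2)
  (F : 'rV[C]_2 -> C).
Local Notation E i := (delta_mx (0 : 'I_1) (i : 'I_2) : 'rV[C]_2).

(** The form of holomorphy that is easily seen to pass to partial derivatives. *)
Definition sep_holo U F := forall u, U u ->
  {for u, continuous F} /\ forall i : 'I_2, derivable F u (E i).

Lemma holomorphic_sep U F : holomorphic_on U F -> sep_holo U F.
Proof.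
move=> h u Uu; have d := h u Uu; split; first exact: differentiable_continuous.
by move=> i; exact: diff_derivable.
Qed.

Lemma line_diffable F u (i : 'I_2) z : derivable F (u + z *: E i) (E i) ->
  diffable (fun z => F (u + z *: E i)) z.
Proof.
move=> /(derivable_partial N) h; eexists => e /h[r r0 rP]; exists r => // t /rP.
by rewrite scalerDl addrA; exact.
Qed.

Lemma box_move p (r s : R) u t (i : 'I_2) : box N p r u -> N t <= s ->
  box N p (r + s) (u + t *: E i).
Proof.
move=> hu ts k; rewrite moveE addrAC; apply: le_lt_trans (absfD N _ _) _.
apply: ltr_leD; first exact: hu.
by case: (k == i); rewrite ?mulr1n// mulr0n absf0 (le_trans (absf_ge0 N t)).
Qed.

Lemma sep_holo_box U F p : open U -> U p -> sep_holo U F ->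
  exists r M : R, [/\ 0 < r, 0 < M & forall u, box N p r u -> U u /\ N (F u) <= M].
Proof.
move=> oU Up hF.
have [B hB] := nbhs_bounded N (proj1 (hF p Up)).
have hU : nbhs p U by exact: open_nbhs_nbhs.
have /(nbhs_row N)[r r0 rP] := nbhsI hU hB.
exists r, (`|B| + 1); split=> //.
move=> u /rP[Uu FB]; split=> //; rewrite (le_trans FB)//.
by rewrite (le_trans (ler_norm B))// lerDl.
Qed.

(** [taylor_holo_at] on the lines through the points of a box, with common constants. *)
Lemma sep_holo_taylor U F p : open U -> U p -> sep_holo U F ->
  exists r s B T : R, [/\ 0 < r, 0 < s, 0 < B, 0 < T & box N p (r + s) `<=` U /\
    forall u, box N p r u -> forall i : 'I_2, N (partial i F u) <= B /\
      forall t, N t <= s -> N (F (u + t *: E i) - F u - t * partial i F u) <= T * N t ^+ 2].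
Proof.
move=> oU Up hF; have [r [M [r0 M0 rP]]] := sep_holo_box oU Up hF.
have r8 : 0 < r / 8 by rewrite divr_gt0.
exists (r / 2), (r / 8 / 16), (8 * M / (r / 8)), (160 * M / (r / 8) ^+ 2).
have s0 : 0 < r / 8 / 16 by rewrite divr_gt0.
split=> //; try by rewrite ?divr_gt0 ?mulr_gt0 ?exprn_gt0.
split; first by move=> u hu; apply: (proj1 (rP u _)); apply: box_le hu; move: r0; lra.
move=> u hu i.
have hline z : cabs (z - 0) <= 2 * (r / 8) ->
    diffable (fun z => F (u + z *: E i)) z /\ cabs (F (u + z *: E i)) <= M.
  rewrite subr0 => hz.
  have /rP[Uz Fz] : box N p r (u + z *: E i).
    by apply: box_le (box_move i hu hz); move: r0; lra.
  by split=> //; apply: line_diffable; have [_] := hF _ Uz; apply.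
have [e e1 e2] := taylor_holo_at r8 M0 hline.
have tay t : N t <= r / 8 / 16 ->
    N (F (u + t *: E i) - F u - t * e) <= 160 * M / (r / 8) ^+ 2 * N t ^+ 2.
  move=> ht; have := e2 t ht; rewrite add0r scale0r addr0 [e * t]mulrC.
  by rewrite expr_div_n -[cabs t]/(N t) [_ / (r / 8) ^+ 2 * _]mulrAC mulrA.
suff -> : partial i F u = e by split.
apply: (has_partial_eq (N := N)) => f f0.
have T0 : 0 < 160 * M / (r / 8) ^+ 2 by rewrite divr_gt0 ?mulr_gt0 ?exprn_gt0.
exists (Num.min (r / 8 / 16) (f / (160 * M / (r / 8) ^+ 2))).
  by rewrite lt_min s0 (divr_gt0 f0 T0).
move=> t; rewrite lt_min => /andP[t1 t2]; apply: le_trans (tay t (ltW t1)) _.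
rewrite [N t ^+ 2]expr2 mulrA ler_wpM2r ?absf_ge0//.
by rewrite ltr_pdivlMr// mulrC in t2; exact: ltW.
Qed.

(** Error terms of [partial_continuous]; the next two lemmas are for
    [partial_derivable]. *)
Lemma three_errors (e x y w x1 x2 : R) :
  0 < e -> x <= y -> w < e / 4 -> x1 <= y -> y <= e / 8 -> x2 <= w + x1 -> x + x2 < e.
Proof. lra. Qed.

Lemma quotient_errors (e T2 a b T y k1 k2 k3 k4 k5 : R) :
  k1 <= T2 * a ^+ 2 -> k2 <= T * y -> k3 <= T * y -> k4 <= k1 + k5 -> k5 <= k2 + k3 ->
  y * (4 * T) < e * a -> k4 <= (T2 * a + e / 2) * a.
Proof. rewrite expr2; lra. Qed.

Lemma quotient_split (g g0 y y0 f c : C) : c != 0 ->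
  (y - y0) / c - f = ((g - g0 - f * c) - ((g - y) - (g0 - y0))) / c.
Proof. by move=> c0; field. Qed.

(** The difference quotients [G n] are holomorphic along lines and converge uniformly to
    [partial i F], by the Taylor estimate [tay]. *)
Section Derivative.
Variables (U : set 'rV[C]_2) (F : 'rV[C]_2 -> C) (p : 'rV[C]_2) (i : 'I_2).
Hypotheses (oU : open U) (hF : sep_holo U F).
Variables (r s B T : R).
Hypotheses (r0 : 0 < r) (s0 : 0 < s) (B0 : 0 < B) (T0 : 0 < T).
Hypothesis boxU : box N p (r + s) `<=` U.
Hypothesis tay : forall u, box N p r u -> N (partial i F u) <= B /\
  forall t, N t <= s -> N (F (u + t *: E i) - F u - t * partial i F u) <= T * N t ^+ 2.

Let h n : C := n.+1%:R^-1.
Let G n u : C := (F (u + h n *: E i) - F u) * n.+1%:R.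

Let Nh n : N (h n) = n.+1%:R^-1. Proof. by rewrite /h absfV absf_nat. Qed.

Let G_close n u : n.+1%:R^-1 <= s -> box N p r u ->
  N (G n u - partial i F u) <= T * n.+1%:R^-1.
Proof.
move=> hn hu; have [_ /(_ (h n))] := tay hu; rewrite Nh => /(_ hn) h1.
have nn : (n.+1%:R : C) != 0 by rewrite pnatr_eq0.
have -> : G n u - partial i F u =
    (F (u + h n *: E i) - F u - h n * partial i F u) * n.+1%:R.
  by rewrite /G /h; field.
rewrite absfM absf_nat -ler_pdivlMr ?ltr0n// -mulrA -expr2.
exact: h1.
Qed.

Let small (e : R) : 0 < e -> exists n0, forall n, (n0 <= n)%N -> n.+1%:R^-1 < e.
Proof.
move=> e0; have [n n0 hn] := absf_arch 1 e0; exists n => m nm.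
apply: le_lt_trans hn; rewrite mul1r lef_pV2 ?posrE ?ltr0n// ler_nat.
by rewrite leqW.
Qed.

Lemma partial_continuous : {for p, continuous (partial i F)}.
Proof.
apply/(continuous_row N) => e e0.
have e8 : 0 < Num.min s (e / (8 * T)) by rewrite lt_min s0 divr_gt0// mulr_gt0.
have [n hn] := small e8; have {}hn := hn n (leqnn n).
rewrite lt_min in hn; have /andP[hs he] := hn.
have nT : T * n.+1%:R^-1 <= e / 8.
  rewrite ltr_pdivlMr ?mulr_gt0// in he; move: he; set x := n.+1%:R^-1; lra.
have nR : (0 : R) < n.+1%:R by rewrite ltr0n.
have pp : box N p r p by exact: box_center.
have hbox : box N p (r + s) (p + h n *: E i).
  by apply: box_move => //; rewrite Nh ltW.
have pU : U p by apply: boxU; apply: box_center; exact: addr_gt0.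
have e4 : 0 < e / 8 / n.+1%:R by rewrite !divr_gt0.
have [r1 r10 h1] := proj1 (continuous_row N _ _) (proj1 (hF (boxU hbox))) _ e4.
have [r2 r20 h2] := proj1 (continuous_row N _ _) (proj1 (hF pU)) _ e4.
exists (Num.min r (Num.min r1 r2)); first by rewrite !lt_min r0 r10.
move=> v hv.
have vr : box N p r v by move=> k; have := hv k; rewrite !lt_min => /andP[].
have c1 := G_close (ltW hs) vr; have c2 := G_close (ltW hs) pp.
have hG : N (G n v - G n p) < e / 4.
  have -> : G n v - G n p = ((F (v + h n *: E i) - F (p + h n *: E i)) - (F v - F p)) * n.+1%:R.
    by rewrite /G; ring.
  rewrite absfM absf_nat -ltr_pdivlMr//; apply: le_lt_trans (absfB N _ _) _.
  have a1 : N (F (v + h n *: E i) - F (p + h n *: E i)) < e / 8 / n.+1%:R.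
    apply: h1 => k; rewrite !moveE opprD addrACA subrr addr0.
    by have := hv k; rewrite !lt_min => /and3P[].
  have a2 : N (F v - F p) < e / 8 / n.+1%:R.
    by apply: h2 => k; have := hv k; rewrite !lt_min => /and3P[].
  have -> : e / 4 / n.+1%:R = e / 8 / n.+1%:R + e / 8 / n.+1%:R by field; exact: lt0r_neq0.
  exact: ltrD.
apply: le_lt_trans (absf_split N (partial i F v) (G n v) (partial i F p)) _.
rewrite (absfBC N (partial i F v)).
exact: three_errors e0 c1 hG c2 nT (absf_split N (G n v) (G n p) (partial i F p)).
Qed.

(** The functions [G n] satisfy Taylor estimates on the line of direction [j] with the same
    constant [T2]. So the difference quotients [Q a] of the limit are within [O(|a|)] of a
    common value, and form a Cauchy family as [a] tends to 0. *)
Lemma partial_derivable (j : 'I_2) : derivable (partial i F) p (E j).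
Proof.
pose D z := partial i F (p + z *: E j).
have r4 : 0 < r / 4 by rewrite divr_gt0.
have M0 : 0 < B + T * s by rewrite addr_gt0// mulr_gt0.
pose T2 := 160 * (B + T * s) / (r / 4) ^+ 2.
have T20 : 0 < T2 by rewrite /T2 divr_gt0 ?mulr_gt0 ?exprn_gt0.
have inbox z : N z <= r / 2 -> box N p r (p + z *: E j).
  move=> hz; have := box_move j (box_center N p r4) hz.
  by apply: box_le; move: r0; lra.
have tayG n : n.+1%:R^-1 <= s -> exists e : C, forall a, N a <= r / 64 ->
    N (G n (p + a *: E j) - G n p - e * a) <= T2 * N a ^+ 2.
  move=> hn.
  have line z : cabs (z - 0) <= 2 * (r / 4) ->
      diffable (fun z => G n (p + z *: E j)) z /\ cabs (G n (p + z *: E j)) <= B + T * s.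
    rewrite subr0 => hz; have hz2 : N z <= r / 2 by move: hz; rewrite -[cabs z]/(N z); lra.
    have bz := inbox z hz2; split; last first.
      have := G_close hn bz; have [hB _] := tay bz.
      have := absfD N (G n (p + z *: E j) - partial i F (p + z *: E j)) (partial i F (p + z *: E j)).
      rewrite subrK -[N (G n _)]/(cabs _) => k1 k2; apply: le_trans k1 _.
      have : T * n.+1%:R^-1 <= T * s by rewrite ler_wpM2l// ltW.
      by move: k2; set x := T * n.+1%:R^-1; move: hB; lra.
    have d1 : diffable (fun z => F ((p + h n *: E i) + z *: E j)) z.
      apply: line_diffable; apply: (proj2 (hF (boxU _))).
      by rewrite addrAC; apply: box_move => //; rewrite Nh.
    have d2 : diffable (fun z => F (p + z *: E j)) z.
      apply: line_diffable; apply: (proj2 (hF (boxU _))).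
      by apply: box_le bz; rewrite lerDl ltW.
    have d3 := diffableL (-1) d2 d1.
    have := diffableL n.+1%:R d3 (diffable_cst 0 z).
    congr diffable; apply/funext => y; rewrite /G addrAC addr0; ring.
  have [e _ he] := taylor_holo_at r4 M0 line; exists e => a ha.
  have := he a; rewrite -[cabs a]/(N a) add0r scale0r addr0.
  rewrite /T2 expr_div_n [_ / (r / 4) ^+ 2 * _]mulrAC mulrA; apply.
  by move: ha; lra.
clearbody T2.
pose Q a := (D a - D 0) / a.
have D0 : D 0 = partial i F p by rewrite /D scale0r addr0.
have QQ (a b : C) : a != 0 -> b != 0 -> N a <= r / 64 -> N b <= r / 64 ->
    N (Q a - Q b) <= T2 * (N a + N b).
  move=> a0 b0 ha hb; apply/ler_addgt0Pr => e e0.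
  have Na := absf_gt0 N a0; have Nb := absf_gt0 N b0.
  pose w := Num.min s (Num.min (e * N a / (4 * T)) (e * N b / (4 * T))).
  have w0 : 0 < w by rewrite !lt_min s0 !divr_gt0 ?mulr_gt0.
  have [n hn] := small w0; have {hn} := hn n (leqnn n).
  rewrite !lt_min => /and3P[n1 n2 n3].
  have [f hf] := tayG n (ltW n1).
  have part c : c != 0 -> N c <= r / 64 -> n.+1%:R^-1 < e * N c / (4 * T) ->
      N (Q c - f) <= T2 * N c + e / 2.
    move=> c0 hc nc; have Nc := absf_gt0 N c0.
    have -> : Q c - f = ((G n (p + c *: E j) - G n p - f * c) -
       ((G n (p + c *: E j) - D c) - (G n p - D 0))) / c by exact: quotient_split.
    rewrite absfM absfV ler_pdivrMr//.
    have k1 := hf c hc.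
    have k2 : N (G n (p + c *: E j) - D c) <= T * n.+1%:R^-1.
      by apply: G_close (ltW n1) (inbox c _); move: hc r0; lra.
    have k3 : N (G n p - D 0) <= T * n.+1%:R^-1.
      by rewrite D0; apply: G_close (ltW n1) (box_center N p r0).
    have k4 := absfB N (G n (p + c *: E j) - G n p - f * c)
       ((G n (p + c *: E j) - D c) - (G n p - D 0)).
    have k5 := absfB N (G n (p + c *: E j) - D c) (G n p - D 0).
    rewrite ltr_pdivlMr ?mulr_gt0// in nc.
    exact: quotient_errors k1 k2 k3 k4 k5 nc.
  have := absf_split N (Q a) f (Q b); rewrite (absfBC N f).
  by have := part a a0 ha n2; have := part b b0 hb n3; lra.
have hn0 n : h n != 0 by rewrite invr_eq0 pnatr_eq0.
have r64 : 0 < r / 64 by rewrite divr_gt0.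
have [n1 hn1] := small r64.
have [l hl] : exists l, forall e : R, 0 < e -> exists n0, forall n, (n0 <= n)%N ->
    N (Q (h n) - l) < e.
  apply: absf_complete => e e0.
  have e1 : 0 < e / (2 * T2) by rewrite divr_gt0// mulr_gt0.
  have [n2 hn2] := small e1; exists (maxn n1 n2) => m n.
  rewrite !geq_max => /andP[m1 m2] /andP[k1 k2].
  apply: le_lt_trans (QQ _ _ (hn0 m) (hn0 n) _ _) _; rewrite ?Nh ?ltW ?hn1//.
  have := hn2 m m2; have := hn2 n k2; rewrite !ltr_pdivlMr ?mulr_gt0//.
  by set x := m.+1%:R^-1; set y := n.+1%:R^-1; lra.
have Ql (b : C) : b != 0 -> N b <= r / 64 -> N (Q b - l) <= T2 * N b.
  move=> b0 hb; apply/ler_addgt0Pr => e e0.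
  have e2 : 0 < e / 2 by rewrite divr_gt0.
  have [n2 hn2] := hl _ e2.
  have e1 : 0 < e / (2 * T2) by rewrite divr_gt0// mulr_gt0.
  have [n3 hn3] := small e1.
  pose n := maxn n1 (maxn n2 n3).
  have m1 : (n1 <= n)%N by rewrite leq_maxl.
  have m2 : (n2 <= n)%N by rewrite leq_max leq_maxl orbT.
  have m3 : (n3 <= n)%N by rewrite !leq_max leqnn !orbT.
  have k1 := QQ b (h n) b0 (hn0 n) hb; rewrite Nh in k1.
  have {}k1 := k1 (ltW (hn1 n m1)).
  have := absf_split N (Q b) (Q (h n)) l; have := hn2 n m2.
  have := hn3 n m3; rewrite ltr_pdivlMr ?mulr_gt0//; move: k1.
  by set x := n.+1%:R^-1; lra.
apply: (@has_partial_derivable _ _ N _ _ _ _ l) => e e0.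
exists (Num.min (r / 64) (e / T2)); first by rewrite lt_min r64 divr_gt0.
move=> t; rewrite lt_min => /andP[t1 t2].
have [->|tn] := eqVneq t 0.
  by rewrite scale0r addr0 mul0r subrr subr0 absf0 mulr0.
have := Ql t tn (ltW t1).
have -> : partial i F (p + t *: E j) - partial i F p - t * l = (Q t - l) * t.
  by rewrite /Q D0 [RHS]mulrBl divfK// [l * t]mulrC.
rewrite absfM => k; rewrite ler_wpM2r ?absf_ge0// (le_trans k)//.
by rewrite mulrC -ler_pdivlMr// ltW.
Qed.

End Derivative.

Lemma sep_holo_partial U F i : open U -> sep_holo U F -> sep_holo U (partial i F).
Proof.
move=> oU hF p Up.
have [r [s [B [T [r0 s0 B0 T0 [bU tay]]]]]] := sep_holo_taylor oU Up hF.
have tay' u (hu : box N p r u) := tay u hu i.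
split; first exact: (partial_continuous hF r0 s0 T0 bU tay').
by move=> j; exact: (partial_derivable hF r0 s0 B0 T0 bU tay').
Qed.

Theorem holomorphic_Ck k U F : open U -> holomorphic_on U F -> Ck k U F.
Proof.
move=> oU /holomorphic_sep; elim: k F => [|k IH] F hF.
  by split=> // u /hF[].
split=> [u Uu|i]; first exact: (proj1 (hF u Uu)).
split=> [u Uu|]; first exact: (proj2 (hF u Uu) i).
exact: IH (sep_holo_partial i oU hF).
Qed.

Theorem holomorphic_isolated U F : open U -> holomorphic_on U F -> isolated_zeros N U F.
Proof.
move=> oU /holomorphic_sep hF p i Up.
have [r [M [r0 M0 rP]]] := sep_holo_box oU Up hF.
have r4 : 0 < r / 4 by rewrite divr_gt0.
have line z : cabs (z - 0) <= 2 * (r / 4) ->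
    diffable (fun z => F (p + z *: E i)) z /\ cabs (F (p + z *: E i)) <= M.
  rewrite subr0 => hz; have r40 : box N p (r / 4) p by exact: box_center.
  have /rP[Uz Fz] : box N p r (p + z *: E i).
    by apply: box_le (box_move i r40 hz); move: r0; lra.
  by split=> //; apply: line_diffable; have [_] := hF _ Uz; apply.
have [h|[s s0 h]] := isolated_holo_at r4 M0 line; [left|right].
  exists (r / 4 / 16); first by rewrite divr_gt0.
  by move=> t /ltW/h; rewrite add0r.
by exists s => // t /h; rewrite add0r.
Qed.

End Holomorphic.

(** * Local properties and uniform limits *)

Section Local.
Context {R : realType} {K : numFieldType} (N : abs_field R K).
Implicit Types (u v w p : 'rV[K]_2) (U V : set 'rV[K]_2) (F G : 'rV[K]_2 -> K) (i j : 'I_2).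
Local Notation E i := (delta_mx (0 : 'I_1) (i : 'I_2) : 'rV[K]_2).

Lemma has_partial_ext U F G i u d : open U -> U u -> (forall v, U v -> F v = G v) ->
  has_partial N F i u d -> has_partial N G i u d.
Proof.
move=> oU Uu FG h e e0; have [r r0 rP] := h e e0.
have /(nbhs_row N)[s s0 sP] : nbhs u U by exact: open_nbhs_nbhs.
exists (Num.min r s); first by rewrite lt_min r0.
move=> t; rewrite lt_min => /andP[tr ts]; rewrite -!FG//; first exact: rP.
apply: sP => k; rewrite moveE addrC addKr.
by case: (k == i); rewrite ?mulr1n// mulr0n absf0.
Qed.

Lemma continuous_ext U F G u : open U -> U u -> (forall v, U v -> F v = G v) ->
  {for u, continuous F} -> {for u, continuous G}.
Proof.
move=> oU Uu FG h; apply/(continuous_row N) => e e0.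
have [r r0 rP] := proj1 (continuous_row N F u) h e e0.
have /(nbhs_row N)[s s0 sP] : nbhs u U by exact: open_nbhs_nbhs.
exists (Num.min r s); first by rewrite lt_min r0.
move=> v hv; rewrite -!FG//.
  by apply: rP => k; have := hv k; rewrite lt_min => /andP[].
by apply: sP => k; have := hv k; rewrite lt_min => /andP[].
Qed.

Lemma Ck_ext k U F G : open U -> (forall v, U v -> F v = G v) -> Ck k U F -> Ck k U G.
Proof.
move=> oU; elim: k F G => [|k IH] F G FG [h1 h2].
  by split=> // u Uu; apply: (continuous_ext oU Uu FG); exact: h1.
split=> [u Uu|i]; first by apply: (continuous_ext oU Uu FG); exact: h1.
have [d1 d2] := h2 i.
have hp u : U u -> has_partial N G i u (partial i F u).
  by move=> Uu; apply: (has_partial_ext oU Uu FG); apply/derivable_partial/d1.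
split; first by move=> u /hp; exact: has_partial_derivable.
by apply: IH d2 => u /hp/has_partial_eq ->.
Qed.

Lemma Ck_local k U F :
  (forall u, U u -> exists2 V, V u & Ck k V F) -> Ck k U F.
Proof.
elim: k F => [|k IH] F h; split=> //.
- by move=> u /h[V Vu [+ _]]; exact.
- by move=> u /h[V Vu [+ _]]; exact.
move=> i; split; first by move=> u /h[V Vu [_ /(_ i)[+ _]]]; exact.
by apply: IH => u /h[V Vu [_ /(_ i)[_ hV]]]; exists V.
Qed.

Lemma uniform_limit_continuous (p : 'rV[K]_2) (r : R) (F : nat -> 'rV[K]_2 -> K) G
    (eps : nat -> R) :
  (forall e : R, 0 < e -> exists n, eps n < e) ->
  (forall n v, box N p r v -> N (G v - F n v) <= eps n) ->
  (forall n, {for p, continuous (F n)}) -> 0 < r -> {for p, continuous G}.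
Proof.
move=> epsP FG cF r0; apply/(continuous_row N) => e e0.
have e3 : 0 < e / 3 by rewrite divr_gt0.
have [n hn] := epsP _ e3.
have [s s0 sP] := proj1 (continuous_row N _ _) (cF n) _ e3.
exists (Num.min r s); first by rewrite lt_min r0.
move=> v hv; have vr : box N p r v by move=> k; have := hv k; rewrite lt_min => /andP[].
have a1 := FG n v vr; have a2 := FG n p (box_center N p r0).
have a3 : N (F n v - F n p) < e / 3.
  by apply: sP => k; have := hv k; rewrite lt_min => /andP[].
have := absf_split N (G v) (F n v) (G p).
have := absf_split N (F n v) (F n p) (G p).
rewrite (absfBC N (F n p)).
by move: a1 a2 a3 hn; lra.
Qed.

(** The mean value inequality for [F m - F n], with [m] tending to infinity, bounds the
    difference quotients of [G - F n]. *)
Lemma uniform_limit_partial (p : 'rV[K]_2) (r : R) (F D : nat -> 'rV[K]_2 -> K) G DG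
    (eps : nat -> R) i :
  0 < r ->
  (forall e : R, 0 < e -> exists n0, forall n, (n0 <= n)%N -> eps n < e) ->
  (forall n v, box N p r v -> has_partial N (F n) i v (D n v)) ->
  (forall n v, box N p r v -> N (G v - F n v) <= eps n) ->
  (forall n v, box N p r v -> N (DG v - D n v) <= eps n) ->
  has_partial N G i p (DG p).
Proof.
move=> r0 epsP FD FG DD e e0.
have e4 : 0 < e / 8 by rewrite divr_gt0.
have [n hn] := epsP _ e4; have {}hn := hn n (leqnn n).
have pp : box N p r p by exact: box_center.
have [s s0 sP] := FD n p pp (e / 4) ltac:(by rewrite divr_gt0).
exists (Num.min r s); first by rewrite lt_min r0.
move=> t; rewrite lt_min => /andP[tr ts].
have bx x : N x <= N t -> box N p r (p + x *: E i).
  move=> xt k; rewrite moveE addrC addKr.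
  by case: (k == i); rewrite ?mulr1n ?mulr0n ?absf0//; exact: le_lt_trans tr.
have key m : N ((F m (p + t *: E i) - F n (p + t *: E i)) - (F m p - F n p)) <=
    2 * (eps m + eps n) * N t.
  apply: (@mvi_coord _ _ N (fun v => F m v - F n v) (fun v => D m v - D n v)) => x xt.
  have hx := bx x xt; split.
    move=> e' e'0; have e2 : 0 < e' / 2 by rewrite divr_gt0.
    have [s1 s10 s1P] := FD m _ hx _ e2; have [s2 s20 s2P] := FD n _ hx _ e2.
    exists (Num.min s1 s2); first by rewrite lt_min s10.
    move=> y; rewrite lt_min => /andP[/s1P k1 /s2P k2]; set q := p + x *: _ in k1 k2 *.
    have -> : F m (q + y *: E i) - F n (q + y *: E i) - (F m q - F n q) - y * (D m q - D n q) =
      (F m (q + y *: E i) - F m q - y * D m q) - (F n (q + y *: E i) - F n q - y * D n q).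
      by ring.
    by apply: le_trans (absfB N _ _) _; move: k1 k2; lra.
  have := absf_split N (D m (p + x *: E i)) (DG (p + x *: E i)) (D n (p + x *: E i)).
  rewrite (absfBC N (D m (p + x *: E i)) (DG _)).
  by have := DD m _ hx; have := DD n _ hx; lra.
have lim : N ((G (p + t *: E i) - F n (p + t *: E i)) - (G p - F n p)) <= 2 * eps n * N t.
  apply/ler_addgt0Pr => f f0.
  have c0 : 0 < 2 + 2 * N t by rewrite ltr_wpDr// mulr_ge0// absf_ge0.
  have [m0 hm0] := epsP (f / (2 + 2 * N t)) (divr_gt0 f0 c0).
  have {}hm := hm0 m0 (leqnn m0); rewrite ltr_pdivlMr// in hm.
  have k1 := key m0; have k2 := FG m0 _ (bx t (lexx _)); have k3 := FG m0 p pp.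
  have -> : (G (p + t *: E i) - F n (p + t *: E i)) - (G p - F n p) =
    ((F m0 (p + t *: E i) - F n (p + t *: E i)) - (F m0 p - F n p)) +
    ((G (p + t *: E i) - F m0 (p + t *: E i)) - (G p - F m0 p)) by ring.
  apply: le_trans (absfD N _ _) _; have := absfB N (G (p + t *: E i) - F m0 (p + t *: E i)) (G p - F m0 p).
  by move: k1 k2 k3 hm; lra.
have d1 := sP t ts; have d2 := DD n p pp.
have -> : G (p + t *: E i) - G p - t * DG p =
  ((G (p + t *: E i) - F n (p + t *: E i)) - (G p - F n p)) +
  ((F n (p + t *: E i) - F n p - t * D n p) - t * (DG p - D n p)) by ring.
apply: le_trans (absfD N _ _) _.
have := absfB N (F n (p + t *: E i) - F n p - t * D n p) (t * (DG p - D n p)).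
rewrite absfM => d3.
have d4 : N t * N (DG p - D n p) <= N t * eps n by rewrite ler_wpM2l ?absf_ge0.
have d5 : N t * eps n <= N t * (e / 8) by rewrite ler_wpM2l ?absf_ge0// ltW.
have : 0 <= e * N t by rewrite mulr_ge0 ?absf_ge0 ?(ltW e0).
by move: lim d1 d3 d4 d5; lra.
Qed.

(** The mean value inequality on the horizontal segment from the line [x = 0] to [v]. *)
Lemma Ck_vanish_bound U F p : open U -> U p -> Ck 2 U F ->
  (forall v, U v -> v 0 0 = 0 -> F v = 0) -> p 0 0 = 0 ->
  exists B : R, nbhs p [set v | N (F v) <= B * N (v 0 0)].
Proof.
move=> oU Up F2 F0 p0; have [B B0 [r r0 rP]] := Ck2_bounded N oU Up F2.
exists (2 * B); apply/(nbhs_row N); exists r => // v hv /=.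
pose u := v + (- v 0 0) *: E 0.
have bx s : N s <= N (v 0 0) -> box N p r (u + s *: E 0).
  move=> hs k; rewrite /u !moveE; case: (ord2P k) => -> /=.
    rewrite !mulr1n subrr add0r p0 subr0; apply: le_lt_trans hs _.
    by have := hv 0; rewrite p0 subr0.
  by rewrite !addr0; exact: hv.
have Uu : U u by have [] := rP _ (bx 0 _); rewrite ?scale0r ?addr0// absf0 absf_ge0.
have u0 : u 0 0 = 0 by rewrite /u move_eq subrr.
have ev : v = u + v 0 0 *: E 0 by rewrite /u -addrA -scalerDl addNr scale0r addr0.
rewrite -[F v]subr0 -(F0 u Uu u0) [in F v]ev.
apply: (@mvi_coord _ _ N F (partial 0 F)) => s /bx/rP[Us h _]; split; last exact: h.
exact: Ck_has_partial F2 Us.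
Qed.

End Local.

(** * Double power series *)

Lemma bin_le_exp2 m p : ('C(m, p) <= 2 ^ m)%N.
Proof.
elim: m p => [|m IH] [|p]; rewrite ?bin0 ?expn_gt0//.
by rewrite binS expnS mul2n -addnn leq_add.
Qed.

Section PowerSeries.
Context {R : realType}.
Local Notation N := (@real_abs R).
Implicit Types (x y t r : R) (u v : 'rV[R]_2).
Local Notation E i := (delta_mx (0 : 'I_1) (i : 'I_2) : 'rV[R]_2).

Lemma sum_geometric k : \sum_(n < k) (4^-1 : R) ^+ n <= 2.
Proof.
suff : \sum_(n < k) (4^-1 : R) ^+ n <= 2 - 2 * 4^-1 ^+ k.
  by move=> /le_trans; apply; rewrite lerBlDr lerDl mulr_ge0// exprn_ge0.
elim: k => [|k IH]; first by rewrite big_ord0 expr0 mulr1 subrr.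
rewrite big_ord_recr /= exprS; have : 0 <= (4^-1 : R) ^+ k by rewrite exprn_ge0.
by move: IH; lra.
Qed.

Lemma geometric_limit (a : nat -> R) (c : R) : 0 <= c ->
  (forall n, `|a n.+1 - a n| <= c / 2 ^+ n) ->
  exists l, forall n, `|l - a n| <= 2 * c / 2 ^+ n.
Proof.
move=> c0 h.
have step n k : `|a (n + k)%N - a n| <= 2 * c / 2 ^+ n - 2 * c / 2 ^+ (n + k).
  elim: k => [|k IH]; first by rewrite addn0 !subrr normr0.
  rewrite addnS; have := ler_normD (a (n + k).+1 - a (n + k)%N) (a (n + k)%N - a n).
  rewrite addrA subrK; have := h (n + k)%N; rewrite exprS.
  have -> : 2 * c / (2 * 2 ^+ (n + k)) = c / 2 ^+ (n + k) by field; rewrite expf_neq0.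
  by rewrite -[2 * c / 2 ^+ (n + k)]mulrA in IH *; move: IH; lra.
have b n k : `|a (n + k)%N - a n| <= 2 * c / 2 ^+ n.
  apply: le_trans (step n k) _; rewrite lerBlDr lerDl.
  by rewrite divr_ge0 ?mulr_ge0// exprn_ge0.
have [l hl] : exists l, forall e : R, 0 < e -> exists n0, forall n, (n0 <= n)%N ->
    `|a n - l| < e.
  apply: real_complete => e e0; have [n n0 hn] := absf_arch (4 * c) e0.
  have hn' : 4 * c / 2 ^+ n < e.
    apply: le_lt_trans hn; rewrite ler_wpM2l ?mulr_ge0// lef_pV2 ?posrE ?exprn_gt0 ?ltr0n//.
    by rewrite -natrX ler_nat ltnW// ltn_expl.
  exists n => m k nm nk; have := b n (m - n)%N; have := b n (k - n)%N.
  rewrite !subnKC// => h1 h2; rewrite distrC in h1.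
  have := ler_normD (a m - a n) (a n - a k); rewrite addrA subrK.
  have e4 : 4 * c / 2 ^+ n = 2 * c / 2 ^+ n + 2 * c / 2 ^+ n by ring.
  by rewrite e4 in hn'; move: hn' h1 h2; lra.
exists l => n; apply/ler_addgt0Pr => e e0; have [n0 hn] := hl e e0.
have := hn (n + n0)%N (leq_addl _ _); rewrite distrC.
have := b n n0; have := ler_normD (l - a (n + n0)%N) (a (n + n0)%N - a n).
by rewrite addrA subrK; lra.
Qed.

(** The [p]-th derivative of the monomial [x^m]. *)
Definition dmono p m x : R := (m ^_ p)%:R * x ^+ (m - p).

Lemma exp_is_derive n x : is_derive x (1 : R) (fun x : R => x ^+ n) (n%:R * x ^+ n.-1).
Proof.
elim: n => [|n IH].
  by rewrite mul0r; exact: is_derive_cst.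
have -> : (fun x : R => x ^+ n.+1) = (id : R -> R) * (fun x : R => x ^+ n).
  by apply/funext => y; rewrite exprS.
apply: (is_derive_eq (is_deriveM (is_derive_id x (1 : R)) IH)).
rewrite /GRing.scale /= mulr1 -natr1 mulrDl mul1r; congr (_ + _).
by case: n {IH} => [|n]; [rewrite !mul0r mulr0|rewrite /= exprS mulrCA].
Qed.

Lemma dmono_diff p m x : has_diff N (dmono p m) x (dmono p.+1 m x).
Proof.
apply/has_diffP.
have := is_deriveZ (m ^_ p)%:R (exp_is_derive (m - p) x).
rewrite /GRing.scale /= mulrA -natrM -ffactnSr -subnS; exact.
Qed.

(** The falling factorial is at most [2^m p!], so that derivatives of any order cost the
    same factor 2 in the radius. *)
Lemma dmono_le p m x r : 0 < r -> `|x| <= r ->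
  `|dmono p m x| <= p`!%:R / r ^+ p * (2 * r) ^+ m.
Proof.
move=> r0 xr; rewrite /dmono normrM normr_nat normrX.
have [mp|pm] := ltnP m p.
  rewrite ffact_small// mul0r mulr_ge0 ?divr_ge0 ?exprn_ge0 ?mulr_ge0// ?ltW//.
apply: (@le_trans _ _ ((2 ^ m * p`!)%:R * r ^+ (m - p))).
  apply: ler_pM; rewrite ?exprn_ge0//; last by rewrite lerXn2r ?nnegrE// ltW.
  by rewrite ler_nat -bin_ffact leq_mul2r bin_le_exp2 orbT.
rewrite natrM natrX exprMn le_eqVlt; apply/orP; left; apply/eqP.
have -> : r ^+ m = r ^+ (m - p) * r ^+ p by rewrite -exprD subnK.
by field; rewrite expf_neq0// lt0r_neq0.
Qed.

(** Partial sums over the exponents below [k] of the termwise derivatives, of order [p] and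
    [q] in the two variables, of a power series centred at [p0]. On the box of radius
    [rho / 8] the terms are [O(4^-(m + n))]. *)
Section Sums.
Variables (A : nat -> nat -> R) (rho S : R).
Hypotheses (rho0 : 0 < rho) (S0 : 0 <= S).
Hypothesis A_le : forall m n, `|A m n| * rho ^+ (m + n) <= S.
Variable p0 : 'rV[R]_2.

Definition dterm p q m n u : R :=
  A m n * (dmono p m (u 0 0 - p0 0 0) * dmono q n (u 0 1 - p0 0 1)).
Definition dsum p q k u : R := \sum_(m < k) \sum_(n < k) dterm p q m n u.

Variable r : R.
Hypothesis r_def : rho = 8 * r.
Let r0 : 0 < r. Proof. by move: rho0; rewrite r_def; lra. Qed.

Definition dbound p q : R := S * (p`!%:R / r ^+ p) * (q`!%:R / r ^+ q).
Local Notation c0 := dbound.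

Let c0_ge0 p q : 0 <= c0 p q.
Proof. by rewrite !mulr_ge0// invr_ge0 exprn_ge0// ltW. Qed.

Lemma dterm_le p q m n u : box N p0 r u ->
  `|dterm p q m n u| <= c0 p q * (4^-1 ^+ m * 4^-1 ^+ n).
Proof.
move=> hu; rewrite /dterm normrM [`|dmono _ _ _ * _|]normrM.
have h1 := dmono_le p m r0 (ltW (hu 0)); have h2 := dmono_le q n r0 (ltW (hu 1)).
apply: (@le_trans _ _ (`|A m n| * ((p`!%:R / r ^+ p * (2 * r) ^+ m) *
   (q`!%:R / r ^+ q * (2 * r) ^+ n)))).
  apply: ler_wpM2l; first exact: normr_ge0.
  by apply: ler_pM; [exact: normr_ge0|exact: normr_ge0|exact: h1|exact: h2].
have -> : 2 * r = rho / 4 by rewrite r_def; field.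
rewrite !expr_div_n.
have -> : `|A m n| * (p`!%:R / r ^+ p * (rho ^+ m / 4 ^+ m) *
   (q`!%:R / r ^+ q * (rho ^+ n / 4 ^+ n))) =
   (`|A m n| * rho ^+ (m + n)) * ((p`!%:R / r ^+ p) * (q`!%:R / r ^+ q) *
     (4 ^- m * 4 ^- n)) by rewrite exprD; ring.
have -> : c0 p q * (4^-1 ^+ m * 4^-1 ^+ n) =
   S * ((p`!%:R / r ^+ p) * (q`!%:R / r ^+ q) * (4 ^- m * 4 ^- n)).
  by rewrite /c0 !exprVn; ring.
rewrite ler_wpM2r// !mulr_ge0// ?invr_ge0 ?exprn_ge0// ltW//.
Qed.

Lemma dsum_step p q k u : box N p0 r u ->
  `|dsum p q k.+1 u - dsum p q k u| <= 4 * c0 p q / 2 ^+ k.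
Proof.
move=> hu.
have -> : dsum p q k.+1 u - dsum p q k u =
   \sum_(m < k) dterm p q m k u + \sum_(n < k.+1) dterm p q k n u.
  rewrite /dsum big_ord_recr /=; under eq_bigr do rewrite big_ord_recr /=.
  by rewrite big_split /=; ring.
have b1 : `|\sum_(m < k) dterm p q m k u| <= c0 p q * 4^-1 ^+ k * 2.
  apply: le_trans (ler_norm_sum _ _ _) _.
  apply: le_trans (ler_sum _ (fun (m : 'I_k) _ => dterm_le p q m k hu)) _.
  under eq_bigr do rewrite mulrA [_ * 4^-1 ^+ k]mulrC mulrA.
  rewrite -mulr_sumr [4^-1 ^+ k * _]mulrC ler_wpM2l ?sum_geometric//.
  by rewrite mulr_ge0// exprn_ge0.
have b2 : `|\sum_(n < k.+1) dterm p q k n u| <= c0 p q * 4^-1 ^+ k * 2.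
  apply: le_trans (ler_norm_sum _ _ _) _.
  apply: le_trans (ler_sum _ (fun (n : 'I_k.+1) _ => dterm_le p q k n hu)) _.
  under eq_bigr do rewrite mulrA.
  by rewrite -mulr_sumr ler_wpM2l ?sum_geometric// mulr_ge0// exprn_ge0.
apply: le_trans (ler_normD _ _) _.
apply: (@le_trans _ _ (4 * c0 p q * 4^-1 ^+ k)); first by move: b1 b2; lra.
apply: ler_wpM2l; first by rewrite mulr_ge0.
by rewrite exprVn lef_pV2 ?posrE ?exprn_gt0// lerXn2r ?nnegrE ?ler_nat.
Qed.

Lemma dsum_partial0 p q k u : has_partial N (dsum p q k) 0 u (dsum p.+1 q k u).
Proof.
have : has_diff N (fun x => \sum_(m < k) \sum_(n < k)
    A m n * (dmono p m x * dmono q n (u 0 1 - p0 0 1))) (u 0 0 - p0 0 0) (dsum p.+1 q k u).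
  apply/has_diffP.
  have -> : (fun x => \sum_(m < k) \sum_(n < k) A m n * (dmono p m x * dmono q n (u 0 1 - p0 0 1)))
     = \sum_(m < k) \sum_(n < k) ((A m n * dmono q n (u 0 1 - p0 0 1)) \*: dmono p m).
    apply/funext => x; rewrite fct_sumE; apply: eq_bigr => m _; rewrite fct_sumE.
    by apply: eq_bigr => n _; rewrite /GRing.scale /= mulrA mulrAC.
  rewrite /dsum; apply: is_derive_sum => m; apply: is_derive_sum => n.
  apply: (is_derive_eq (is_deriveZ _ (proj1 (has_diffP N _ _ _) (dmono_diff p m _)))).
  by rewrite /dterm /GRing.scale /= mulrA mulrAC.
move=> h e e0; have [s s0 sP] := h e e0; exists s => // t /sP.
set w := u + t *: E 0.
have w1 : w 0 1 = u 0 1 := move_swap u t 0.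
have w0 : w 0 0 - p0 0 0 = u 0 0 - p0 0 0 + t by rewrite /w move_eq addrAC.
have <- : dsum p q k w = \sum_(m < k) \sum_(n < k)
    A m n * (dmono p m (u 0 0 - p0 0 0 + t) * dmono q n (u 0 1 - p0 0 1)) by rewrite /dsum /dterm w0 w1.
exact.
Qed.

Lemma dsum_partial1 p q k u : has_partial N (dsum p q k) 1 u (dsum p q.+1 k u).
Proof.
have : has_diff N (fun x => \sum_(m < k) \sum_(n < k)
    A m n * (dmono p m (u 0 0 - p0 0 0) * dmono q n x)) (u 0 1 - p0 0 1) (dsum p q.+1 k u).
  apply/has_diffP.
  have -> : (fun x => \sum_(m < k) \sum_(n < k) A m n * (dmono p m (u 0 0 - p0 0 0) * dmono q n x))
     = \sum_(m < k) \sum_(n < k) ((A m n * dmono p m (u 0 0 - p0 0 0)) \*: dmono q n).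
    apply/funext => x; rewrite fct_sumE; apply: eq_bigr => m _; rewrite fct_sumE.
    by apply: eq_bigr => n _; rewrite /GRing.scale /= mulrA.
  rewrite /dsum; apply: is_derive_sum => m; apply: is_derive_sum => n.
  apply: (is_derive_eq (is_deriveZ _ (proj1 (has_diffP N _ _ _) (dmono_diff q n _)))).
  by rewrite /dterm /GRing.scale /= mulrA.
move=> h e e0; have [s s0 sP] := h e e0; exists s => // t /sP.
set w := u + t *: E 1.
have w0 : w 0 0 = u 0 0 := move_swap u t 1.
have w1 : w 0 1 - p0 0 1 = u 0 1 - p0 0 1 + t by rewrite /w move_eq addrAC.
have <- : dsum p q k w = \sum_(m < k) \sum_(n < k)
    A m n * (dmono p m (u 0 0 - p0 0 0) * dmono q n (u 0 1 - p0 0 1 + t)) by rewrite /dsum /dterm w0 w1.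
exact.
Qed.

(** The sums [g p q] of the termwise derivatives are uniform limits, so that the partial
    derivatives of [g p q] are [g p.+1 q] and [g p q.+1]. *)
Lemma power_series_Ck (f : 'rV[R]_2 -> R) k :
  (forall u, box N p0 r u -> (fun k => dsum 0 0 k u) @ \oo --> f u) ->
  Ck k (box N p0 r) f.
Proof.
move=> fP.
have /choice[G GP] : forall pqu : nat * nat * 'rV[R]_2, exists l, box N p0 r pqu.2 ->
    forall n, `|l - dsum pqu.1.1 pqu.1.2 n pqu.2| <= 2 * (4 * c0 pqu.1.1 pqu.1.2) / 2 ^+ n.
  move=> [[p q] u]; have [hu|hu] := pselect (box N p0 r u); last by exists 0 => /hu.
  have [l hl] := geometric_limit (mulr_ge0 (ler0n _ 4) (c0_ge0 p q))
    (fun n => dsum_step p q n hu).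
  by exists l.
pose g p q u := G (p, q, u).
have gP p q n u : box N p0 r u -> N (g p q u - dsum p q n u) <= 2 * (4 * c0 p q) / 2 ^+ n.
  by move=> hu; exact: (GP (p, q, u) hu n).
have eps (c : R) : 0 <= c -> forall e : R, 0 < e ->
    exists n0, forall n, (n0 <= n)%N -> c / 2 ^+ n < e.
  move=> cc e e0; have [n n0 hn] := absf_arch c e0; exists n => m nm.
  apply: le_lt_trans hn; rewrite ler_wpM2l// lef_pV2 ?posrE ?exprn_gt0 ?ltr0n//.
  by rewrite -natrX ler_nat (leq_trans nm)// ltnW// ltn_expl.
have cpos p q : 0 <= 2 * (4 * c0 p q).
  by have := c0_ge0 p q; set c := c0 p q => ?; lra.
have obox : open (box N p0 r).
  rewrite openE => u hu; apply/(nbhs_row N).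
  pose d := Num.min (r - N (u 0 0 - p0 0 0)) (r - N (u 0 1 - p0 0 1)).
  exists d; first by rewrite lt_min !subr_gt0 !hu.
  move=> v hv k'; have := absf_split N (v 0 k') (u 0 k') (p0 0 k'); have := hv k'.
  by rewrite lt_min => /andP[]; case: (ord2P k') => ->; lra.
have sub u : box N p0 r u -> exists2 s : R, 0 < s & box N u s `<=` box N p0 r.
  by move=> hu; apply/(nbhs_row N); apply: open_nbhs_nbhs.
have parts p q u : box N p0 r u -> has_partial N (g p q) 0 u (g p.+1 q u) /\
    has_partial N (g p q) 1 u (g p q.+1 u).
  move=> hu; have [s s0 sP] := sub u hu; split.
    pose c := Num.max (2 * (4 * c0 p q)) (2 * (4 * c0 p.+1 q)).
    apply: (@uniform_limit_partial _ _ N u s (dsum p q) (dsum p.+1 q) _ (g p.+1 q)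
      (fun n => c / 2 ^+ n)) => //.
    - by apply: eps; rewrite le_max cpos.
    - by move=> n v _; exact: dsum_partial0.
    - move=> n v /sP hv; apply: le_trans (gP p q n v hv) _.
      by rewrite ler_wpM2r ?invr_ge0 ?exprn_ge0// le_max lexx.
    - move=> n v /sP hv; apply: le_trans (gP p.+1 q n v hv) _.
      by rewrite ler_wpM2r ?invr_ge0 ?exprn_ge0// le_max lexx orbT.
  pose c := Num.max (2 * (4 * c0 p q)) (2 * (4 * c0 p q.+1)).
  apply: (@uniform_limit_partial _ _ N u s (dsum p q) (dsum p q.+1) _ (g p q.+1)
    (fun n => c / 2 ^+ n)) => //.
  - by apply: eps; rewrite le_max cpos.
  - by move=> n v _; exact: dsum_partial1.
  - move=> n v /sP hv; apply: le_trans (gP p q n v hv) _.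
    by rewrite ler_wpM2r ?invr_ge0 ?exprn_ge0// le_max lexx.
  - move=> n v /sP hv; apply: le_trans (gP p q.+1 n v hv) _.
    by rewrite ler_wpM2r ?invr_ge0 ?exprn_ge0// le_max lexx orbT.
have cont_dsum p q n u : {for u, continuous (dsum p q n)}.
  have cmono (i l : nat) j (a : R) : {for u, continuous (fun v : 'rV[R]_2 => dmono i l (v 0 j - a))}.
    have hd : continuous (dmono i l).
      by move=> x; apply/differentiable_continuous/derivable1_diffP; have [] := proj1 (has_diffP N _ _ _) (dmono_diff i l x).
    apply: (continuous_comp (f := fun v : 'rV[R]_2 => v 0 j - a)); last exact: hd.
    have cj : {for u, continuous (fun v : 'rV[R]_2 => v 0 j)} by exact: coord_continuous.
    exact: cvgB cj (cvg_cst _).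
  apply: (@cvg_big _ _ _ _ _ _ _ (nbhs u)) => [|m _]; first exact: add_continuous.
  apply: (@cvg_big _ _ _ _ _ _ _ (nbhs u)) => [|m' _]; first exact: add_continuous.
  have c1 := cmono p m 0 (p0 0 0); have c2 := cmono q m' 1 (p0 0 1).
  have c3 : {for u, continuous (fun _ : 'rV[R]_2 => A m m')} by exact: cst_continuous.
  exact: (continuousM c3 (continuousM c1 c2)).
have cont p q u : box N p0 r u -> {for u, continuous (g p q)}.
  move=> hu; have [s s0 sP] := sub u hu.
  apply: (@uniform_limit_continuous _ _ N u s (dsum p q) _
    (fun n => 2 * (4 * c0 p q) / 2 ^+ n)) => //.
  - by move=> e e0; have [n hn] := eps _ (cpos p q) e e0; exists n; exact: hn.
  - by move=> n v /sP; exact: gP.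
have gC p q : Ck k (box N p0 r) (g p q).
  elim: k p q => [|k IH] p q; first by split=> // u hu; exact: cont.
  split=> [u hu|i]; first exact: cont.
  have [g' hg' Cg'] : exists2 g', (forall u, box N p0 r u -> has_partial N (g p q) i u (g' u)) &
      Ck k (box N p0 r) g'.
    case: (ord2P i) => ->.
      by exists (g p.+1 q) => // u /(parts p q)[].
    by exists (g p q.+1) => // u /(parts p q)[].
  split=> [u /hg' hp|]; first exact: has_partial_derivable hp.
  by apply: (Ck_ext N obox _ Cg') => u /hg' hp; rewrite (has_partial_eq hp).
apply: (Ck_ext N obox _ (gC 0 0)) => u hu.
apply/eqP; rewrite -subr_eq0 -normr_le0; apply/ler_addgt0Pr => e e0; rewrite add0r.
have e2 : 0 < e / 2 by rewrite divr_gt0.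
have /cvgrPdist_lt/(_ _ e2)[n0 _ hn0] := fP u hu.
have [n1 hn1] := eps _ (cpos 0 0) _ e2.
have h1 := hn0 (n0 + n1)%N (leq_addr _ _); have h2 := hn1 (n0 + n1)%N (leq_addl _ _).
have h3 := gP 0 0 (n0 + n1)%N u hu; rewrite distrC in h1.
have := absf_split N (g 0 0 u) (dsum 0 0 (n0 + n1)%N u) (f u).
by move: h1 (le_lt_trans h3 h2); rewrite /=; lra.
Qed.

End Sums.

End PowerSeries.

(** * Real analytic functions of two variables *)

Section Analytic.
Context {R : realType}.
Local Notation N := (@real_abs R).
Implicit Types (x y t r : R) (u v p : 'rV[R]_2) (U : set 'rV[R]_2) (f : 'rV[R]_2 -> R).
Local Notation E i := (delta_mx (0 : 'I_1) (i : 'I_2) : 'rV[R]_2).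

Lemma cvg_seq_ext (s s' : nat -> R) (l : R) :
  (forall k, s k = s' k) -> s @ \oo --> l -> s' @ \oo --> l.
Proof. by move=> /funext ->. Qed.

Definition exponent2 (m n : nat) : {ffun 'I_2 -> nat} := [ffun k => if k == 0 then m else n].

Lemma monomial2 v m n : monomial v (exponent2 m n) = v 0 0 ^+ m * v 0 1 ^+ n.
Proof.
rewrite /monomial big_ord_recl big_ord1 !ffunE /=.
by congr (_ * v 0 _ ^+ _); apply/val_inj.
Qed.

Lemma box_sum2 (a : {ffun 'I_2 -> nat} -> R) v k :
  \sum_(beta : {ffun 'I_2 -> 'I_k})
    (let alpha := [ffun i => nat_of_ord (beta i)] in a alpha * monomial v alpha) =
  \sum_(m < k) \sum_(n < k) a (exponent2 m n) * (v 0 0 ^+ m * v 0 1 ^+ n).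
Proof.
rewrite pair_bigA /= (reindex (fun b : {ffun 'I_2 -> 'I_k} => (b 0, b 1))) /=; last first.
  exists (fun mn : 'I_k * 'I_k => [ffun i => if i == 0 then mn.1 else mn.2]).
    by move=> b _; apply/ffunP => i; rewrite ffunE; case: (ord2P i) => ->.
  by move=> [m n] _; rewrite !ffunE.
apply: eq_bigr => b _; rewrite -monomial2.
suff -> : [ffun i => nat_of_ord (b i)] = exponent2 (b 0) (b 1) by [].
by apply/ffunP => i; rewrite !ffunE; case: (ord2P i) => ->.
Qed.

Lemma summable_bounded (T : choiceType) (a : T -> R) :
  summable setT (fun i => (a i)%:E) -> exists2 S : R, 0 <= S & forall i, `|a i| <= S.
Proof.
rewrite summableE => fin; exists (fine (\esum_(i in setT) `|(a i)%:E|%E)).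
  by apply: fine_ge0; exact: esum_ge0.
move=> i; rewrite -lee_fin fineK//; apply: esum_ge; exists [set i]; last first.
  by rewrite fsbig_set1.
by split.
Qed.

(** Absolute summability at the point [p + (rho, rho)] bounds the coefficients. *)
Lemma analytic_expansion U f p : real_analytic_on U f -> U p ->
  exists A (rho S : R), [/\ 0 < rho, 0 <= S,
    forall m n, `|A m n| * rho ^+ (m + n) <= S
    & forall u, box N p rho u -> (fun k => dsum A p 0 0 k u) @ \oo --> f u].
Proof.
move=> fA Up; have [a /(nbhs_row N)[r r0 rP]] := fA p Up.
pose rho := r / 2; have rho0 : 0 < rho by rewrite divr_gt0.
have rhor : rho < r by rewrite /rho; lra.
pose d : 'rV[R]_2 := \row_k rho.
have [|/summable_bounded[S S0 SP] _] := rP (p + d).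
  by move=> k; rewrite /d !mxE [_ + rho]addrC addrK /= ger0_norm ?(ltW rho0).
exists (fun m n => a (exponent2 m n)), rho, S; split=> //.
  move=> m n; have := SP (exponent2 m n).
  rewrite addrC addKr monomial2 !mxE -exprD normrM; congr (_ * _ <= _).
  by rewrite ger0_norm// exprn_ge0// ltW.
move=> u hu; have [|_] := rP u; first by move=> k; exact: lt_trans (hu k) rhor.
apply: cvg_seq_ext => k; rewrite box_sum2.
apply: eq_bigr => m _; apply: eq_bigr => n _.
by rewrite /dterm /dmono !ffactn0 !mul1r !subn0 !mxE.
Qed.

Lemma analytic_Ck k U f : real_analytic_on U f -> Ck k U f.
Proof.
move=> fA; apply: Ck_local => p Up.
have [A [rho [S [rho0 S0 AS fP]]]] := analytic_expansion fA Up.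
have r0 : 0 < rho / 8 by rewrite divr_gt0.
exists (box N p (rho / 8)); first exact: box_center.
apply: (power_series_Ck rho0 S0 AS) => [|u hu]; first by field.
apply: fP => i; apply: lt_trans (hu i) _.
by move: rho0; lra.
Qed.

Lemma limit_dist_le (s : nat -> R) (l c B : R) : s @ \oo --> l ->
  (exists n0, forall n, (n0 <= n)%N -> `|s n - c| <= B) -> `|l - c| <= B.
Proof.
move=> sl [n0 h]; apply/ler_addgt0Pr => e e0.
have /cvgrPdist_lt/(_ _ e0)[n1 _ hn1] := sl.
have h1 := hn1 (n0 + n1)%N (leq_addl _ _); have h2 := h _ (leq_addr n1 n0).
have := ler_normD (l - s (n0 + n1)%N) (s (n0 + n1)%N - c); rewrite addrA subrK.
by move: h1 h2; rewrite /=; lra.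
Qed.

(** The first nonzero term dominates the following ones near 0. *)
Lemma power_series_isolated (b : nat -> R) (rho S : R) (h : R -> R) :
  0 < rho -> 0 <= S -> (forall k, `|b k| * rho ^+ k <= S) ->
  (forall t, `|t| < rho -> (fun n => \sum_(k < n) b k * t ^+ k) @ \oo --> h t) ->
  (forall t, `|t| < rho -> h t = 0) \/
  (exists2 r : R, 0 < r & forall t, `|t| < r -> t != 0 -> h t != 0).
Proof.
move=> rho0 S0 bS hP.
have [ex|nex] := pselect (exists j, b j != 0); last first.
  left=> t /hP ht; apply/eqP; rewrite -normr_le0 -[h t]subr0.
  apply: (limit_dist_le ht); exists 0 => n _.
  rewrite big1 ?subrr ?normr0// => k _.
  by have [->|b0] := eqVneq (b k) 0; [rewrite mul0r|case: nex; exists k].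
right; have [j bj jmin] := ex_minnP ex.
have small k : (k < j)%N -> b k = 0.
  by move=> kj; apply/eqP; apply: contraTT kj => /jmin; rewrite -leqNgt.
have tail t n : `|t| <= rho / 2 ->
    `|\sum_(k < j.+1 + n) b k * t ^+ k - b j * t ^+ j| <=
      S * (`|t| / rho) ^+ j.+1 * (2 - 2 / 2 ^+ n).
  move=> tr; set q := `|t| / rho.
  have q0 : 0 <= q by rewrite divr_ge0// ltW.
  have q2 : q <= 2^-1 by rewrite ler_pdivrMr// mulrC.
  elim: n => [|n IH].
    rewrite addn0 big_ord_recr /= big1 ?add0r ?subrr ?normr0; last first.
      by move=> k _; rewrite small ?mul0r.
    by rewrite expr0 divr1 subrr mulr0.
  rewrite addnS big_ord_recr /=.
  have bt : `|b (j.+1 + n)%N * t ^+ (j.+1 + n)| <= S * q ^+ j.+1 / 2 ^+ n.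
    have -> : `|b (j.+1 + n)%N * t ^+ (j.+1 + n)| =
        `|b (j.+1 + n)%N| * rho ^+ (j.+1 + n) * q ^+ (j.+1 + n).
      by rewrite normrM normrX -mulrA -exprMn /q mulrCA mulfV ?mulr1// lt0r_neq0.
    apply: le_trans (ler_wpM2r (exprn_ge0 _ q0) (bS _)) _.
    rewrite exprD mulrA; apply: ler_wpM2l; first by rewrite mulr_ge0// exprn_ge0.
    by rewrite -exprVn lerXn2r ?nnegrE ?invr_ge0.
  rewrite addrAC; apply: le_trans (ler_normD _ _) _.
  have e2 : S * q ^+ j.+1 * (2 - 2 / 2 ^+ n.+1) =
      S * q ^+ j.+1 * (2 - 2 / 2 ^+ n) + S * q ^+ j.+1 / 2 ^+ n.
    have num (a c : R) : c != 0 -> a * (2 - 2 / (2 * c)) = a * (2 - 2 / c) + a / c.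
      by move=> c0; field.
    by rewrite [2 ^+ n.+1]exprS num// expf_neq0.
  by rewrite e2 lerD.
pose r := Num.min (rho / 2) (`|b j| * rho ^+ j.+1 / (2 * S + 1)).
have S1 : 0 < 2 * S + 1 by rewrite ltr_wpDl// mulr_ge0.
exists r.
  by rewrite lt_min !divr_gt0// mulr_gt0 ?normr_gt0// exprn_gt0.
move=> t; rewrite lt_min => /andP[t1 t2] t0; apply/eqP => ht.
have : `|h t - b j * t ^+ j| <= S * (`|t| / rho) ^+ j.+1 * 2.
  apply: (limit_dist_le (hP t _)); first by apply: lt_trans t1 _; lra.
  exists j.+1 => n jn; rewrite -(subnKC jn); apply: le_trans (tail t _ (ltW t1)) _.
  apply: ler_wpM2l; first by rewrite mulr_ge0// exprn_ge0// divr_ge0// ltW.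
  by rewrite lerBlDr lerDl divr_ge0// exprn_ge0.
rewrite ht sub0r normrN normrM normrX expr_div_n exprS.
have tj : 0 < `|t| ^+ j by rewrite exprn_gt0// normr_gt0.
have -> : S * (`|t| * `|t| ^+ j / rho ^+ j.+1) * 2 = (2 * S * `|t| / rho ^+ j.+1) * `|t| ^+ j.
  by ring.
rewrite ler_pM2r// ler_pdivlMr ?exprn_gt0// => k1.
rewrite ltr_pdivlMr// in t2.
have : 0 <= `|t| by [].
by move: k1 t2; lra.
Qed.

Lemma analytic_isolated U f : real_analytic_on U f -> isolated_zeros N U f.
Proof.
move=> fA p i Up.
have [A [rho [S [rho0 S0 AS fP]]]] := analytic_expansion fA Up.
have bx t : `|t| < rho -> box N p rho (p + t *: E i).
  move=> tr k; rewrite moveE addrC addKr.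
  by case: (k == i); rewrite ?mulr1n// mulr0n absf0.
have dmono0 m x : dmono 0 m x = x ^+ m by rewrite /dmono ffactn0 mul1r subn0.
have [] // := @power_series_isolated (fun k => if i == 0 then A k 0 else A 0 k) rho S
  (fun t => f (p + t *: E i)) rho0 S0.
- by move=> k; case: (i == 0); [have := AS k 0; rewrite addn0|exact: AS].
- move=> t tr; have := fP _ (bx t tr); apply: cvg_seq_ext => n.
  case: n => [|n]; first by rewrite /dsum !big_ord0.
  case: (ord2P i) => ->; rewrite /dsum /dterm /=.
    apply: eq_bigr => m _; rewrite big_ord_recl big1 => [|k _]; rewrite !dmono0 move_eq.
      by rewrite [p 0 0 + t]addrC addrK (move_swap p t 0) subrr expr0 mulr1 addr0.
    by rewrite (move_swap p t 0) subrr exprS !(mul0r, mulr0).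
  rewrite big_ord_recl [X in _ + X]big1 => [|m _].
    rewrite addr0; apply: eq_bigr => k _; rewrite !dmono0 move_eq.
    by rewrite (move_swap p t 1) subrr expr0 mul1r [p 0 1 + t]addrC addrK.
  by rewrite big1// => k _; rewrite !dmono0 (move_swap p t 1) subrr exprS !(mul0r, mulr0).
- by move=> h; left; exists rho.
by move=> h; right.
Qed.

End Analytic.

(** * Regularity of the coordinates *)

Lemma differentiable_near0 (K : numFieldType) (V W : normedModType K) (D : V -> W) x :
  (\forall y \near x, D y = 0) -> differentiable D x.
Proof.
move=> h; have [] : continuous (0 : V -> W) /\ D \o shift x = cst (D x) + 0 +o_ 0 id.
  split; first exact: cst_continuous.
  apply/eqaddoP => e e0; have /nbhs0P := h.
  apply: filterS => y hy; rewrite !fctE /= [y + x]addrC hy (nbhs_singleton h) ?addr0 ?oppr0 ?addr0 normr0.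
  by rewrite mulr_ge0// ltW.
move=> c d; apply/diff_locallyP.
by rewrite (@diff_unique _ _ _ D \0 x c d).
Qed.

Lemma coord_holomorphic (R : realType) (U : set 'rV[Cplx R]_2) F (i : 'I_2) : open U ->
  (forall u, U u -> F u = u 0 i) -> holomorphic_on U F.
Proof.
move=> oU FE u Uu.
have -> : F = (fun v : 'rV[Cplx R]_2 => v 0 i) + (fun v => F v - v 0 i).
  by apply/funext => v; rewrite !fctE addrC subrK.
apply: differentiableD; first exact: differentiable_coord.
apply: differentiable_near0; have : nbhs u U by exact: open_nbhs_nbhs.
by apply: filterS => v /FE ->; rewrite subrr.
Qed.

Section RealCoord.
Context {R : realType}.
Implicit Types (u v : 'rV[R]_2).

(** The coefficients of the power series [a + b x + c y]. *)
Definition affine_coef (a b c : R) (m n : nat) : R :=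
  match m, n with 0, 0 => a | 1, 0 => b | 0, 1 => c | _, _ => 0 end.

Lemma affine_power_series (a b c : R) v :
  power_series_sum (fun alpha => affine_coef a b c (alpha 0) (alpha 1)) v
    (a + b * v 0 0 + c * v 0 1).
Proof.
set A := (fun alpha : {ffun 'I_2 -> nat} => affine_coef a b c (alpha 0) (alpha 1)).
have coefE m n : A (exponent2 m n) = affine_coef a b c m n by rewrite /A !ffunE.
split.
  pose D := [set exponent2 0 0; exponent2 1 0; exponent2 0 1].
  have fD : finite_set D by rewrite /D !finite_setU.
  have off alpha : ~ D alpha -> A alpha = 0.
    have -> : alpha = exponent2 (alpha 0) (alpha 1).
      by apply/ffunP => i; rewrite ffunE; case: (ord2P i) => ->.
    rewrite coefE; case: (alpha 0) => [|[|m]]; case: (alpha 1) => [|[|n]] //= [].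
    - by left; left.
    - by right.
    - by left; right.
  rewrite summableE.
  have -> : \esum_(alpha in setT) `|(A alpha * monomial v alpha)%:E|%E =
     \esum_(alpha in D) `|(A alpha * monomial v alpha)%:E|%E.
    rewrite [RHS]esum_mkcond; apply: eq_esum => alpha _; case: ifPn => // hD.
    by rewrite off ?mul0r ?abse0//; move: hD; rewrite notin_setE.
  rewrite esum_fset// fsbig_finite//=.
  by apply/sum_fin_numP.
apply/cvgrPdist_lt => e e0; exists 2%N => // n /=; rewrite box_sum2.
case: n => [|[|n]]// _.
have -> : \sum_(m < n.+2) \sum_(k < n.+2) A (exponent2 m k) * (v 0 0 ^+ m * v 0 1 ^+ k) =
    a + b * v 0 0 + c * v 0 1.
  under eq_bigr do under eq_bigr do rewrite coefE.
  rewrite 2!big_ord_recl [X in _ + (_ + X)]big1 ?addr0 => [|m _]; last first.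
    by rewrite big1// => k _; exact: mul0r.
  rewrite 2!big_ord_recl [X in _ + (_ + X) + _]big1 ?addr0 => [|k _]; last exact: mul0r.
  rewrite big_ord_recl [X in _ + (_ + X)]big1 ?addr0 => [|k _]; last exact: mul0r.
  by rewrite /= /bump /= !(expr0, expr1, mulr1, mul1r) addrAC.
by rewrite subrr normr0.
Qed.

Lemma coord_analytic (U : set 'rV[R]_2) F (i : 'I_2) : open U ->
  (forall u, U u -> F u = u 0 i) -> real_analytic_on U F.
Proof.
move=> oU FE p Up.
exists (fun alpha => affine_coef (p 0 i) (i == 0)%:R (i == 1)%:R (alpha 0) (alpha 1)).
have : nbhs p U by exact: open_nbhs_nbhs.
apply: filterS => u /FE ->; have := affine_power_series (p 0 i) (i == 0)%:R (i == 1)%:R (u - p).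
congr (power_series_sum _ _ _); rewrite !mxE.
by case: (ord2P i) => ->; rewrite ?eqxx /= ?mulr1n ?mulr0n; ring.
Qed.

Lemma Ck_onE k (U : set 'rV[R]_2) F : Ck_on k U F <-> Ck k U F.
Proof.
elim: k F => [|k IH] F; first by [].
by split=> -[h1 h2]; split=> // i; have [d /IH h] := h2 i; split.
Qed.

Lemma coord_smooth (U : set 'rV[R]_2) F (i : 'I_2) : open U ->
  (forall u, U u -> F u = u 0 i) -> smooth_on U F.
Proof. by move=> oU /(coord_analytic oU) h k; apply/Ck_onE; exact: analytic_Ck. Qed.

End RealCoord.

(** * The smooth proper case, and conclusion *)

Section Proper.
Context {R : realType}.
Local Notation N := (@real_abs R).
Variables (C : regularity R) (S : bivector_manifold R 2) (f : 'rV[R]_2 -> R).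
Variable phi : S -> planar_poisson (@id 'rV[R]_2) f.
Hypothesis res : symplectic_resolution C phi.
Hypothesis coord_regular : forall (i : 'I_2) F,
  (forall u : 'rV[R]_2, range id u -> F u = u 0 i) -> C (range id) F.
Hypothesis C_Ck : forall (U : set 'rV[R]_2) F, open U -> C U F -> Ck 3 U F.
Hypothesis f_vanish : forall q : 'rV[R]_2, id q 0 0 = 0 -> exists B : R,
  nbhs (id q) [set v | range id v -> N (f v) <= B * N (v 0 0)].

(** Each [y] in [0, 1] is a critical value: take a cluster point of preimages of the points
    [(1 / (n + 1), y)] and apply [critical_cluster]. *)
Theorem no_proper_resolution : proper_map phi -> False.
Proof.
move=> prop; have [_ [[cont _] _] surj] := res.
have cphi i : continuous (fun p : S => phi p 0 i).
  move=> p A hA; exact: (cont p _ (@coord_continuous R 1 2 0 i (phi p) A hA)).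
pose Q : set 'rV[R]_2 := [set v | forall i, `[0, 1]%classic (v 0 i)].
have cQ : compact (phi @^-1` Q).
  have cQ : compact Q := rV_compact (fun=> @segment_compact R 0 1).
  exact: (prop Q cQ).
suff null01 : (@real_null R) `[0, 1]%classic.
  apply: (null_nbhs (x := 1 / 2) _ null01).
  apply/nbhs_ballP; exists (1 / 2) => //= y; rewrite /ball/= ltr_norml in_itv/= => /andP[].
  by lra.
apply: (@nullS _ _ _ (@real_null R) _ _ _ (null_critical (@real_null R) res C_Ck cQ)).
move=> y y01.
have /choice[q qP] : forall n : nat, exists p : S, phi p = \row_i (if i == 0 then n.+1%:R^-1 else y).
  by move=> n; exact: surj.
have q0 n : phi (q n) 0 0 = n.+1%:R^-1 by rewrite qP mxE.
have q1 n : phi (q n) 0 1 = y by rewrite qP mxE.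
have [|p [Qp clp]] := cQ (q @ \oo) _.
  exists 0%N => // n _ i /=; case: (ord2P i) => ->; rewrite ?q1// q0 in_itv/=.
  by rewrite invr_ge0 ler0n /= invf_le1 ?ltr0n// ler1n.
have hit W n0 : nbhs p W -> exists2 n, (n0 <= n)%N & W (q n).
  move=> pW; have [|_ [[n /= n0n <-] Wn]] := clp (q @` [set n | (n0 <= n)%N]) W _ pW.
    by exists n0 => // n /= n0n; exists n.
  by exists n.
have p1 : phi p 0 1 = y.
  apply/eqP; rewrite -subr_eq0 -normr_le0; apply/ler_addgt0Pr => e e0; rewrite add0r.
  have /cvgrPdist_lt/(_ _ e0)/(hit _ 0%N)[n _] := cphi 1 p.
  by rewrite q1 => /ltW.
have p0 : phi p 0 0 = 0.
  apply/eqP; rewrite -normr_le0; apply/ler_addgt0Pr => e e0; rewrite add0r.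
  have e2 : 0 < e / 2 by rewrite divr_gt0.
  have [n0 n00 hn0] := absf_arch 1 e2.
  have /cvgrPdist_lt/(_ _ e2)/(hit _ n0)[n n0n] := cphi 0 p.
  have num (x c : R) : `|x - c| < e / 2 -> 0 < c -> c < e / 2 -> `|x| <= e.
    by rewrite ltr_norml ler_norml; lra.
  rewrite q0 => /num; apply; first by rewrite invr_gt0 ltr0n.
  rewrite mul1r in hn0; apply: le_lt_trans hn0.
  by rewrite lef_pV2 ?posrE ?ltr0n// ler_nat leqW.
exists p => //; split=> // c ac cp.
have orange : open (range (@id 'rV[R]_2)) by rewrite image_id; exact: openT.
apply: (critical_cluster (N := N) res orange coord_regular C_Ck f_vanish ac cp p0) => W /(hit _ 0%N)[n _ Wn].
exists (q n); split=> //; rewrite /pull_coord.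
  by rewrite q0 invr_neq0// pnatr_eq0.
by rewrite q1 p1.
Qed.

End Proper.

Theorem theorem2 (R : realType) :
  [/\ forall f g : 'rV[R]_2 -> R,
        smooth_on setT g ->
        (forall u, f u = xcoord u * g u) ->
        (forall u, xcoord u != 0 -> g u != 0) ->
        ~ exists (S : bivector_manifold R 2) (phi : S -> poisson_plane f),
            symplectic_resolution (@smooth_on R) phi /\ proper_map phi,
      forall f g : 'rV[R]_2 -> R,
        real_analytic_on setT f ->
        (forall u, f u = xcoord u * g u) ->
        (forall u, xcoord u != 0 -> g u != 0) ->
        ~ exists (S : bivector_manifold R 2) (phi : S -> poisson_plane f),
            symplectic_resolution (@real_analytic_on R) phi /\
            connected [set: S]
    & forall (M : set 'rV[Cplx R]_2) (f g : 'rV[Cplx R]_2 -> Cplx R),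
        open M -> M 0 ->
        holomorphic_on M f ->
        (forall u, M u -> f u = xcoord u * g u) ->
        (forall u, M u -> xcoord u != 0 -> g u != 0) ->
        ~ exists (S : bivector_manifold (Cplx R) 2)
                 (phi : S -> poisson_open M f),
            symplectic_resolution (@holomorphic_on R) phi /\
            connected [set: S]].
Proof.
have oplane : open (range (@id 'rV[R]_2)) by rewrite image_id; exact: openT.
split.
- move=> f g gs fg _ [S [phi [res prop]]].
  apply: (no_proper_resolution res) prop.
  + by move=> i F; exact: coord_smooth.
  + by move=> U F _ /(_ 3%N)/Ck_onE.
  (* [f = x g], and [g] is bounded near [q]. *)
  + move=> q q0; exists (`|g q| + 1).
    have [gc _] := gs 0%N; have /cvgrPdist_lt/(_ _ ltr01) := gc q Logic.I.
    apply: filterS => v hv _; rewrite fg absfM mulrC ler_wpM2r ?absf_ge0//=.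
    by have := ler_normD (g q) (g v - g q); rewrite addrC subrK distrC; move: hv; lra.
- move=> f g fA fg _ [S [phi [res conn]]].
  apply: (no_connected_resolution (@real_null R) res oplane) conn => //.
  + by move=> i F; exact: coord_analytic.
  + by move=> U F _; exact: analytic_Ck.
  + move=> q q0; have [|B hB] := Ck_vanish_bound (@real_abs R) openT (p := q) Logic.I (analytic_Ck 2 fA) _ q0.
      by move=> v _ v0; rewrite fg /xcoord v0 mul0r.
    exists B; apply: filterS hB => v hv _; exact: hv.
  + by move=> U F _; exact: analytic_isolated.
move=> M f g oM M0 fH fg _ [S [phi [res conn]]].
have rM : range (@set_val _ M) = M.
  by apply/seteqP; split=> [_ [q _ <-]|v Mv]; [exact: set_valP|exists (SigSub (mem_set Mv))].
apply: (no_connected_resolution (@cplx_null R) res _) conn => //; rewrite ?rM//.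
- by move=> i F; exact: coord_holomorphic.
- by move=> U F; exact: holomorphic_Ck.
- move=> q q0; have Mq : M (set_val q) := set_valP q.
  have [|B hB] := Ck_vanish_bound (@cplx_abs R) oM Mq (holomorphic_Ck 2 oM fH) _ q0.
    by move=> v Mv v0; rewrite fg// /xcoord v0 mul0r.
  exists B; apply: filterS hB => v hv _; exact: hv.
- by move=> U F; exact: holomorphic_isolated.
Qed.
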